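(* Let $(M,h)$ be a simply connected Riemannian manifold and $V=V^i\frac{\partial}{\partial x^i}$, $W=W^i\frac{\partial}{\partial x^i}$ vector fields on $M$ with $\|V\|_h<1$ and $\|V+W\|_h<1$, such that (a) $V$ satisfies the differential relation $d\eta=d(\log\lambda)\wedge\eta$, where $\eta=V_i(x)\,dx^i$, $V_i=h_{ij}V^j$, $\lambda=1-\|V\|_h^2$; (b) $W$ is Killing with respect to $h$ and $\{V^*,W^*\}=0$, where $V^*=V^ip_i$ and $W^*=W^ip_i$. Let $F_1=\alpha+\beta$ be the solution of Zermelo's navigation problem with data $(M,h)$ and wind $V$, let $\widetilde F$ be the solution of Zermelo's navigation problem with data $(M,F_1)$ and wind $W$ (equivalently with data $(M,h)$ and wind $V+W$), and let $f:M\to\mathbb{R}$ be a smooth function with $\beta=df$. Then: (i) The $\widetilde F$-unit speed geodesics $\mathcal P(t)$ are given by $$\mathcal P(t)=\varphi(t,\rho(t)),$$ where $\varphi$ is the flow of $W$ and $\rho(t)$ is an $F_1$-unit speed geodesic. Equivalently, $$\mathcal P(t)=\varphi(t,\gamma(s(t))),$$ where $\gamma(s)$ is an $\alpha$-unit speed geodesic and $s=s(t)$ is the parameter change given by $t=\int_0^sF_1\left(\gamma(\tau),\frac{d\gamma}{d\tau}\right)d\tau$. (ii) The point $\mathcal P(l)$ is conjugate to $\mathcal P(0)=p$ along the $\widetilde F$-geodesic $\mathcal P(t)=\varphi(t,\rho(t))$ if and only if the corresponding point $\widehat q=\rho(l)=\varphi(-l,\mathcal P(l))$ on the $F_1$-geodesic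 $\rho$ is conjugate to $p$ along $\rho$, or equivalently, $\widehat q$ is conjugate to $p$ along the corresponding $\alpha$-geodesic from $p$ to $\widehat q$. (iii) If $\widehat q\in Cut_\alpha(p)$ then $q=\varphi(l,\widehat q)\in Cut_{\widetilde F}(p)$, where $l=d_{F_1}(p,\widehat q)=d_\alpha(p,\widehat q)+f(\widehat q)-f(p)$.
   Context: For a Finsler metric $G$ on $M$ (in particular $G=\|\cdot\|_h$) and a vector field $U$ (the wind) with $G(-U)<1$, the solution of Zermelo's navigation problem with data $(M,G)$ and wind $U$ is the Finsler metric $\widetilde G$ whose indicatrix $\{\widetilde G=1\}$ in each $T_xM$ is the translate of $\{G=1\}$ by $U(x)$; equivalently $G(y-\widetilde G(y)U)=\widetilde G(y)$. For data $(M,h)$, $V$ it is the Randers metric $F_1=\alpha+\beta$, $\alpha(x,y)=\sqrt{a_{ij}y^iy^j}$, $\beta=b_iy^i$ (identified with the 1-form $b_i\,dx^i$), with $a_{ij}=\frac1\lambda h_{ij}+\frac{V_i}{\lambda}\frac{V_j}{\lambda}$, $b_i=-\frac{V_i}{\lambda}$; the Riemannian metric $(a_{ij})$ is also denoted $\alpha$. When $M$ is simply connected, relation (a) is equivalent to $d\beta=0$, so that $\beta=df$ for a smooth function $f$, and then the $F_1$-geodesics are the $\alpha$-geodesics up to orientation-preserving reparametrization. Given $\|V\|_h<1$, the condition $\|V+W\|_h<1$ is equivalent to $F_1(-W)<1$. Here $(x,p)$ are canonical coordinates on $T^*M$ and $\{\cdot,\cdot\}$ is the canonical Poisson bracket $\{f,g\}=\frac{\partial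 f}{\partial p_k}\frac{\partial g}{\partial x^k}-\frac{\partial f}{\partial x^k}\frac{\partial g}{\partial p_k}$; the condition $\{V^*,W^*\}=0$ is equivalent to $[V,W]=0$. The distance $d_F(p,q)$ is the infimum of $\int F(\gamma,\dot\gamma)\,dt$ over piecewise $C^\infty$ curves from $p$ to $q$. A point $q$ on a geodesic emanating from $p$ is a cut point of $p$ if the geodesic is globally minimizing from $p$ up to $q$ but not beyond; $Cut(p)$ (with subscript the metric) is the set of all cut points of $p$.
   Formalization: In (iii) the Killing field W is assumed complete (otherwise φ(l,q̂) may not exist, e.g. on a sphere minus a point); in (i) only those P(t) are considered for which φ(-t,P(t)) is defined, which is no restriction when W is complete. *)

(* Defs.v *)
From mathcomp Require Import all_boot all_order all_algebra.
From mathcomp Require Import all_classical all_reals all_analysis.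
Import Order.TTheory GRing.Theory Num.Theory.
Import numFieldNormedType.Exports.

Set Implicit Arguments.
Unset Strict Implicit.
Unset Printing Implicit Defensive.

Local Open Scope classical_set_scope.
Local Open Scope ring_scope.

(* Tensor fields, Finsler metrics and 1-forms on a manifold are represented by
   their components in the charts of the atlas, subject to the usual
   transformation laws.  All functions are total; only the values on the
   indicated open sets (chart images, parameter intervals...) are meaningful. *)

(* Only meant for open U and finite-dimensional E. *)
Fixpoint Ck (R : realType) (E F : normedModType R) (k : nat) (U : set E)
    (f : E -> F) : Prop :=
  match k with
  | 0%N => forall x, U x -> {for x, continuous f}
  | k'.+1 => (forall x, U x -> differentiable f x) /\
             forall v : E, Ck k' U (fun x => 'D_v f x : F)
  end.

Definition Cinf (R : realType) (E F : normedModType R) (U : set E)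
    (f : E -> F) : Prop := forall k, Ck k U f.

Record manifold (R : realType) (n : nat) := Manifold {
  msort :> topologicalType;
  chart : Type;
  dom : chart -> set msort;
  coord : chart -> msort -> 'rV[R]_n;
  param : chart -> 'rV[R]_n -> msort;
  manifold_hausdorff : hausdorff_space msort;
  manifold_second_countable : @second_countable msort;
  chart_cover : forall p : msort, exists c, dom c p;
  dom_open : forall c, open (dom c);
  coordK : forall c p, dom c p -> param c (coord c p) = p;
  coord_continuous : forall c p, dom c p -> {for p, continuous (coord c)};
  coord_image_open : forall c, open (coord c @` dom c);
  param_continuous : forall c x, (coord c @` dom c) x ->
    {for x, continuous (param c)};
  transition_smooth : forall c d,
    Cinf (coord c @` (dom c `&` dom d)) (coord d \o param c)
}.

Arguments chart {R n}.
Arguments dom {R n m}.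
Arguments coord {R n m}.
Arguments param {R n m}.

Definition cim (R : realType) n (M : manifold R n) (c : chart M) :
  set 'rV[R]_n := coord c @` dom c.

Definition chart_at (R : realType) n (M : manifold R n) (p : M) : chart M :=
  projT1 (cid (chart_cover p)).

Definition simply_connected (R : realType) (T : topologicalType) : Prop :=
  (forall p q : T, exists s : R -> T,
    [/\ {within `[0, 1], continuous s}, s 0 = p & s 1 = q]) /\
  (forall s : R -> T, {within `[0, 1], continuous s} -> s 0 = s 1 ->
    exists H : R * R -> T,
    [/\ {within [set z | (0 <= z.1 <= 1) && (0 <= z.2 <= 1)], continuous H},
        forall t, 0 <= t <= 1 -> H (0, t) = s t,
        forall t, 0 <= t <= 1 -> H (1, t) = s 0 &
        forall u, 0 <= u <= 1 -> H (u, 0) = s 0 /\ H (u, 1) = s 0]).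

(* Differential at the point p of the change of coordinates from c to d. *)
Definition dtrans (R : realType) n (M : manifold R n) (c d : chart M) (p : M)
    (v : 'rV[R]_n) : 'rV[R]_n := 'D_v (coord d \o param c) (coord c p).

Definition partial (R : realType) n (k : 'I_n) (f : 'rV[R]_n -> R)
    (x : 'rV[R]_n) : R := 'D_(delta_mx 0 k) f x.

Definition vector_field (R : realType) n (M : manifold R n)
    (X : chart M -> 'rV[R]_n -> 'rV[R]_n) : Prop :=
  (forall c, Cinf (cim c) (X c)) /\
  (forall c d p, dom c p -> dom d p ->
    X d (coord d p) = dtrans c d p (X c (coord c p))).

Definition smooth_fun (R : realType) n (M : manifold R n) (f : M -> R) : Prop :=
  forall c : chart M, Cinf (cim c) (f \o param c).

Definition smooth_map (R : realType) n (M : manifold R n)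
    (E : normedModType R) (U : set E) (s : E -> M) : Prop :=
  (forall u, U u -> {for u, continuous s}) /\
  (forall c, Cinf (U `&` s @^-1` dom c) (coord c \o s)).

Definition riemannian (R : realType) n (M : manifold R n)
    (h : chart M -> 'rV[R]_n -> 'M[R]_n) : Prop :=
  [/\ forall c i j, Cinf (cim c) (fun x => h c x i j),
      forall c x, cim c x -> (h c x)^T = h c x,
      forall c x, cim c x -> forall v : 'rV[R]_n, v != 0 ->
        0 < (v *m h c x *m v^T) 0 0 &
      forall c d p, dom c p -> dom d p -> forall v w,
        (dtrans c d p v *m h d (coord d p) *m (dtrans c d p w)^T) 0 0
        = (v *m h c (coord c p) *m w^T) 0 0].

Definition rnorm (R : realType) n (M : manifold R n)
    (h : chart M -> 'rV[R]_n -> 'M[R]_n) (c : chart M)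
    (z : 'rV[R]_n * 'rV[R]_n) : R :=
  Num.sqrt ((z.2 *m h c z.1 *m z.2^T) 0 0).

(* Finsler metrics are functions on TM (positively homogeneous, not
   necessarily reversible), smooth off the zero section, with positive
   definite vertical Hessian of F^2/2. *)
Definition energy (R : realType) n (M : manifold R n)
    (F : chart M -> 'rV[R]_n * 'rV[R]_n -> R) (c : chart M)
    (z : 'rV[R]_n * 'rV[R]_n) : R := F c z ^+ 2 / 2.

Definition finsler (R : realType) n (M : manifold R n)
    (F : chart M -> 'rV[R]_n * 'rV[R]_n -> R) : Prop :=
  [/\ forall c, Cinf [set z | cim c z.1 /\ z.2 != 0] (F c),
      forall c x, cim c x -> forall y, y != 0 -> 0 < F c (x, y),
      forall c x, cim c x -> forall (k : R) y, 0 <= k ->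
        F c (x, k *: y) = k * F c (x, y),
      forall c x, cim c x -> forall y v, y != 0 -> v != 0 ->
        0 < 'D_(0, v) (fun z => 'D_(0, v) (energy F c) z : R) (x, y) &
      forall c d p, dom c p -> dom d p -> forall y,
        F d (coord d p, dtrans c d p y) = F c (coord c p, y)].

Definition zermelo (R : realType) n (M : manifold R n)
    (G : chart M -> 'rV[R]_n * 'rV[R]_n -> R)
    (U : chart M -> 'rV[R]_n -> 'rV[R]_n)
    (F : chart M -> 'rV[R]_n * 'rV[R]_n -> R) : Prop :=
  finsler F /\
  forall c x, cim c x ->
    [set y | F c (x, y) = 1] = [set y + U c x | y in [set y | G c (x, y) = 1]].

Definition lambda (R : realType) n (M : manifold R n)
    (h : chart M -> 'rV[R]_n -> 'M[R]_n) (V : chart M -> 'rV[R]_n -> 'rV[R]_n)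
    (c : chart M) (x : 'rV[R]_n) : R := 1 - rnorm h c (x, V c x) ^+ 2.

Definition flat (R : realType) n (M : manifold R n)
    (h : chart M -> 'rV[R]_n -> 'M[R]_n) (V : chart M -> 'rV[R]_n -> 'rV[R]_n)
    (c : chart M) (x : 'rV[R]_n) : 'rV[R]_n := V c x *m h c x.

Definition randers_a (R : realType) n (M : manifold R n)
    (h : chart M -> 'rV[R]_n -> 'M[R]_n) (V : chart M -> 'rV[R]_n -> 'rV[R]_n)
    (c : chart M) (x : 'rV[R]_n) : 'M[R]_n :=
  \matrix_(i, j) ((lambda h V c x)^-1 * h c x i j
    + flat h V c x 0 i / lambda h V c x * (flat h V c x 0 j / lambda h V c x)).

Definition randers_b (R : realType) n (M : manifold R n)
    (h : chart M -> 'rV[R]_n -> 'M[R]_n) (V : chart M -> 'rV[R]_n -> 'rV[R]_n)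
    (c : chart M) (x : 'rV[R]_n) : 'rV[R]_n :=
  \row_i (- (flat h V c x 0 i / lambda h V c x)).

(* The (i, j) components of the exterior derivative and of du /\ eta. *)
Definition ext_deriv (R : realType) n (eta : 'rV[R]_n -> 'rV[R]_n)
    (x : 'rV[R]_n) (i j : 'I_n) : R :=
  partial i (fun z => eta z 0 j) x - partial j (fun z => eta z 0 i) x.

Definition dwedge (R : realType) n (u : 'rV[R]_n -> R)
    (eta : 'rV[R]_n -> 'rV[R]_n) (x : 'rV[R]_n) (i j : 'I_n) : R :=
  partial i u x * eta x 0 j - partial j u x * eta x 0 i.

(* Vanishing of the Lie derivative of h along W. *)
Definition killing (R : realType) n (M : manifold R n)
    (h : chart M -> 'rV[R]_n -> 'M[R]_n) (W : chart M -> 'rV[R]_n -> 'rV[R]_n)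
    : Prop :=
  forall c x, cim c x -> forall i j : 'I_n,
    \sum_k (W c x 0 k * partial k (fun z => h c z i j) x
          + h c x k j * partial i (fun z => W c z 0 k) x
          + h c x i k * partial j (fun z => W c z 0 k) x) = 0.

(* Canonical coordinates z = (x, p) on the cotangent bundle. *)
Definition poisson (R : realType) n (f g : 'rV[R]_n * 'rV[R]_n -> R)
    (z : 'rV[R]_n * 'rV[R]_n) : R :=
  \sum_(k < n) ('D_(0, delta_mx 0 k) f z * 'D_(delta_mx 0 k, 0) g z
              - 'D_(delta_mx 0 k, 0) f z * 'D_(0, delta_mx 0 k) g z).

Definition star (R : realType) n (M : manifold R n)
    (X : chart M -> 'rV[R]_n -> 'rV[R]_n) (c : chart M)
    (z : 'rV[R]_n * 'rV[R]_n) : R := \sum_i X c z.1 0 i * z.2 0 i.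

Definition open_itv (R : realType) (I : set R) : Prop := open I /\ is_interval I.

Definition vel (R : realType) n (M : manifold R n) (c : chart M)
    (g : R -> M) (t : R) : 'rV[R]_n := derive1 (fun u => coord c (g u)) t.

Definition speed (R : realType) n (M : manifold R n)
    (F : chart M -> 'rV[R]_n * 'rV[R]_n -> R) (g : R -> M) (t : R) : R :=
  F (chart_at (g t)) (coord (chart_at (g t)) (g t), vel (chart_at (g t)) g t).

(* Affinely parametrized geodesics: solutions with nonvanishing velocity of
   the Euler-Lagrange equation of F^2/2. *)
Definition geodesic (R : realType) n (M : manifold R n)
    (F : chart M -> 'rV[R]_n * 'rV[R]_n -> R) (I : set R) (g : R -> M) : Prop :=
  smooth_map I g /\
  forall c t, I t -> dom c (g t) ->
    vel c g t != 0 /\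
    forall i : 'I_n,
      derive1 (fun u => 'D_(0, delta_mx 0 i) (energy F c)
                          (coord c (g u), vel c g u) : R) t
      = 'D_(delta_mx 0 i, 0) (energy F c) (coord c (g t), vel c g t).

Definition unit_geodesic (R : realType) n (M : manifold R n)
    (F : chart M -> 'rV[R]_n * 'rV[R]_n -> R) (I : set R) (g : R -> M) : Prop :=
  geodesic F I g /\ forall t, I t -> speed F g t = 1.

(* J, the variation field of a variation Gam of g|_I through geodesics, is a
   Jacobi field; it is given here by its components in the chart at g t. *)
Definition geodesic_variation (R : realType) n (M : manifold R n)
    (F : chart M -> 'rV[R]_n * 'rV[R]_n -> R) (I : set R) (g : R -> M)
    (Gam : R -> R -> M) : Prop :=
  exists2 e0 : R, 0 < e0 &
  [/\ smooth_map [set z : R * R | `|z.1| < e0 /\ I z.2]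
        (fun z => Gam z.1 z.2),
      forall e, `|e| < e0 -> geodesic F I (Gam e) &
      forall t, I t -> Gam 0 t = g t].

Definition variation_field (R : realType) n (M : manifold R n)
    (Gam : R -> R -> M) (t : R) : 'rV[R]_n :=
  vel (chart_at (Gam 0 t)) (fun e => Gam e t) 0.

(* g l is conjugate to g 0 along g (0 < l): some Jacobi field along g on a
   neighbourhood of [0, l] vanishes at 0 and l but not identically. *)
Definition conjugate (R : realType) n (M : manifold R n)
    (F : chart M -> 'rV[R]_n * 'rV[R]_n -> R) (g : R -> M) (l : R) : Prop :=
  exists I (Gam : R -> R -> M),
  [/\ open_itv I, `[0, l] `<=` I, geodesic_variation F I g Gam,
      variation_field Gam 0 = 0 /\ variation_field Gam l = 0 &
      exists2 t, 0 <= t <= l & variation_field Gam t != 0].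

(* Finite concatenations of smooth arcs, with their F-length. *)
Inductive pw_path (R : realType) n (M : manifold R n)
    (F : chart M -> 'rV[R]_n * 'rV[R]_n -> R) : M -> M -> R -> Prop :=
| pw_nil p : pw_path F p p 0
| pw_cons p q r (s : R -> M) (I : set R) (a b len : R) :
    open I -> a <= b -> `[a, b] `<=` I -> smooth_map I s ->
    s a = p -> s b = q -> pw_path F q r len ->
    pw_path F p r
      ((\int[@lebesgue_measure R]_(t in `[a, b]) speed F s t)%R + len).

Definition dist (R : realType) n (M : manifold R n)
    (F : chart M -> 'rV[R]_n * 'rV[R]_n -> R) (p q : M) : R :=
  inf [set L | pw_path F p q L].

Definition Cut (R : realType) n (M : manifold R n)
    (F : chart M -> 'rV[R]_n * 'rV[R]_n -> R) (p : M) : set M :=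
  [set q | exists I (g : R -> M) (l : R),
    [/\ open_itv I /\ I 0, unit_geodesic F I g, g 0 = p,
        [/\ 0 < l, I l & g l = q] &
        dist F p q = l /\
        forall t, I t -> l < t -> dist F p (g t) <> t]].

Definition integral_curve (R : realType) n (M : manifold R n)
    (W : chart M -> 'rV[R]_n -> 'rV[R]_n) (I : set R) (g : R -> M) : Prop :=
  smooth_map I g /\
  forall c t, I t -> dom c (g t) -> vel c g t = W c (coord c (g t)).

(* The maximal flow phi of W, with domain D; W is complete iff D is full. *)
Definition flow (R : realType) n (M : manifold R n)
    (W : chart M -> 'rV[R]_n -> 'rV[R]_n) (D : set (R * M))
    (phi : R -> M -> M) : Prop :=
  [/\ open D,
      forall x, open_itv [set t | D (t, x)] /\ D (0, x) /\ phi 0 x = x,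
      forall c, smooth_map [set z : R * 'rV[R]_n |
                              cim c z.2 /\ D (z.1, param c z.2)]
                  (fun z => phi z.1 (param c z.2)),
      forall x, integral_curve W [set t | D (t, x)] (phi^~ x) &
      forall I g, open_itv I -> I 0 -> integral_curve W I g ->
        forall t, I t -> D (t, g 0)].

(* Oriented integral of g from 0 to s. *)
Definition integral0 (R : realType) (g : R -> R) (s : R) : R :=
  (if 0 <= s then \int[@lebesgue_measure R]_(x in `[0%R, s]) g x
   else - \int[@lebesgue_measure R]_(x in `[s, 0%R]) g x)%R.

Definition arc_parameter (R : realType) n (M : manifold R n)
    (F : chart M -> 'rV[R]_n * 'rV[R]_n -> R) (I J : set R) (g : R -> M)
    (s : R -> R) : Prop :=
  forall t, I t -> J (s t) /\ t = integral0 (speed F g) (s t).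

(* Main.v *)
(* The flow of W preserves h, and also V and V + W, which commute with W; hence
   it preserves F1 and Ft.  The velocity of P(t) = phi(t, rho(t)) is
   dphi(rho') + W, so P has Ft-unit speed when rho has F1-unit speed.
   Differentiating F1(y - Ft(y) W) = Ft(y) implicitly relates the momenta of the
   two metrics by the factor 1 + p(W), which is constant along extremals because
   W generates symmetries; so the Euler-Lagrange equations of P and of rho are
   equivalent.  As F1 = alpha + df, the metrics F1 and alpha have the same
   extremals up to parametrization.

   Geodesic variations correspond to each other under both passages, once the
   speeds are normalized: a Jacobi field vanishing at two points comes from a
   variation whose speed is stationary, so the normalization does not disturb
   its zeros.

   With fixed end points the F1- and alpha-lengths differ by a constant.  A path
   c of Ft-length less than T is carried by phi(-theta(t), c(t)) to a path of
   F1-length less than T, where theta' is a smooth function slightly larger than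
   the Ft-speed of c, and conversely; so minimality and its failure pass from
   alpha to F1 and from F1 to Ft. *)

Require Import Defs.
From HB Require Import structures.
From mathcomp Require Import all_boot all_order all_algebra.
From mathcomp Require Import all_classical all_reals all_analysis.
From mathcomp Require Import ring lra.
Import Order.TTheory GRing.Theory Num.Theory.
Import numFieldNormedType.Exports.
Import Defs.

Set Implicit Arguments.
Unset Strict Implicit.
Unset Printing Implicit Defensive.

Local Open Scope classical_set_scope.
Local Open Scope ring_scope.

(** The Killing field supplies the uniqueness statements for its own flow: fields dragged along the
    flow keep their [h]-length, so two of them that agree once agree always. The invariance of [V]
    and [W] and the inverse of the time-[t] map both come from this. Geodesics and Jacobi fields are
    never solved for: curves, and whole variations through geodesics, are transformed into others.
    An arc-length parameter therefore has to be inverted smoothly together with the variation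
    parameter. Each equivalence rests on one implication used twice. The navigation argument is
    stated for an abstract pair of metrics and a local flow, and is applied again to the wind [- W]
    with time reversed; the exact change of metric is applied again with [- f]. For distances the
    obstacle is that a Finsler speed is not smooth where a path stops. A strict inequality between
    length and available time leaves room for a smooth majorant of the speed, and the time left over
    is spent on a flow line, which is strictly shorter because the wind is weaker than the
    metric. *)

(** * Directional derivatives *)

(* [Ck] involves one direction of differentiation at a time; it is stable under
   composition because finitely many coordinates determine a vector. *)
Definition findim (R : realType) (E : normedModType R) : Prop :=
  exists m (e : 'I_m -> E) (l : 'I_m -> {linear E -> R^o}),
    (forall i, continuous (l i)) /\ forall w, w = \sum_i l i w *: e i.

Section DirectionalDerivatives.
Context {R : realType}.
Implicit Types E F G : normedModType R.

Lemma D_add_dir E F (f : E -> F) (x a b : E) : differentiable f x ->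
  'D_(a + b) f x = 'D_a f x + 'D_b f x.
Proof. by move=> df; rewrite !deriveE // linearD. Qed.

Lemma D_scale_dir E F (f : E -> F) (x a : E) (k : R) : differentiable f x ->
  'D_(k *: a) f x = k *: 'D_a f x.
Proof. by move=> df; rewrite !deriveE // linearZ. Qed.

Lemma D_opp_dir E F (f : E -> F) (x a : E) : differentiable f x ->
  'D_(- a) f x = - 'D_a f x.
Proof. by move=> df; rewrite !deriveE // linearN. Qed.

Lemma D_sub_dir E F (f : E -> F) (x a b : E) : differentiable f x ->
  'D_(a - b) f x = 'D_a f x - 'D_b f x.
Proof. by move=> df; rewrite !deriveE // linearB. Qed.

Lemma D_sum_dir E F (f : E -> F) (x : E) m (k : 'I_m -> R) (e : 'I_m -> E) :
  differentiable f x ->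
  'D_(\sum_i k i *: e i) f x = \sum_i k i *: 'D_(e i) f x.
Proof.
move=> df; rewrite deriveE // linear_sum; apply: eq_bigr => i _.
by rewrite linearZ /= deriveE.
Qed.

Lemma D_comp E F G (g : F -> G) (f : E -> F) (x v : E) :
  differentiable f x -> differentiable g (f x) ->
  'D_v (fun y => g (f y)) x = 'D_('D_v f x) g (f x).
Proof.
move=> df dg; rewrite (deriveE _ df) (deriveE _ dg).
rewrite -[fun y => _]/(g \o f) deriveE; last exact: differentiable_comp.
by rewrite diff_comp.
Qed.

Lemma D_pair E F G (f : E -> F) (g : E -> G) (x v : E) :
  differentiable f x -> differentiable g x ->
  'D_v (fun y => (f y, g y)) x = ('D_v f x, 'D_v g x).
Proof.
move=> df dg; rewrite (deriveE _ df) (deriveE _ dg) deriveE.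
  by rewrite diff_pair.
exact: differentiable_pair.
Qed.

Lemma D_ext E F (f g : E -> F) (x v : E) :
  (\near x, f x = g x) -> 'D_v f x = 'D_v g x.
Proof. exact: near_eq_derive. Qed.

(** The first-order expansion of [f] passes to [g] on a neighbourhood, and uniqueness of the
    differential identifies ['d f x] as the differential of [g]. *)
Lemma near_differentiable E F (f g : E -> F) (x : E) :
  (\near x, f x = g x) -> differentiable f x -> differentiable g x.
Proof.
move=> fg df; have fgx := nbhs_singleton fg.
have dfl := diff_locally df.
have [dgc _] := (diff_locallyP x f).1 df.
have key : g \o shift x = cst (g x) + 'd f x +o_ 0 id.
  apply/eqaddoP => e e0.
  move/eqaddoP : dfl => /(_ e e0) H.
  have fg0 : \forall y \near (0 : E), f (y + x) = g (y + x).
    by move: fg; rewrite (near_shift 0) /= subr0.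
  near=> y; have -> : (g \o shift x - (cst (g x) + 'd f x)) y =
                     (f \o shift x - (cst (f x) + 'd f x)) y.
    by rewrite !fctE /= -fgx -(near fg0 y).
  by near: y.
have := diff_unique dgc key => /= dgE.
by apply/diff_locallyP; rewrite dgE.
Unshelve. all: by end_near. Qed.

(** The two difference quotients coincide as functions of the step. *)
Lemma D_slice1 E F G (f : E * F -> G) (z : E) (w : F) (a : E) :
  'D_(a, 0) f (z, w) = 'D_a (fun z => f (z, w)) z.
Proof.
rewrite /derive; set d := (fun _ : R => _); set d' := (fun _ : R => _).
suff -> : d = d' by [].
apply/funext => k; rewrite /d /d' /=; congr (_ *: (f _ - _)).
by congr pair; rewrite /= scaler0 add0r.
Qed.

Lemma D_slice2 E F G (f : E * F -> G) (z : E) (w : F) (a : F) :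
  'D_(0, a) f (z, w) = 'D_a (fun w => f (z, w)) w.
Proof.
rewrite /derive; set d := (fun _ : R => _); set d' := (fun _ : R => _).
suff -> : d = d' by [].
apply/funext => k; rewrite /d /d' /=; congr (_ *: (f _ - _)).
by congr pair; rewrite /= scaler0 add0r.
Qed.

Lemma D_pair_dir E F G (f : E * F -> G) x (a : E) (b : F) :
  differentiable f x -> 'D_(a, b) f x = 'D_(a, 0) f x + 'D_(0, b) f x.
Proof.
move=> df; rewrite -D_add_dir //; congr ('D_ _ f x).
by congr pair; rewrite /= ?addr0 ?add0r.
Qed.

Lemma differentiable_clin E F (l : {linear E -> F}) x :
  continuous l -> differentiable l x.
Proof. by move=> lc; apply: linear_differentiable. Qed.

Lemma D_clin E F (l : {linear E -> F}) x v : continuous l ->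
  'D_v l x = l v.
Proof.
by move=> lc; rewrite deriveE ?diff_lin //; exact: differentiable_clin.
Qed.

End DirectionalDerivatives.

(** * Smooth functions *)

Section Smoothness.
Context {R : realType}.
Implicit Types E F G : normedModType R.

Lemma Ck_continuous E F k (U : set E) (f : E -> F) : Ck k U f ->
  forall x, U x -> {for x, continuous f}.
Proof.
by case: k => [|k] /= H x Ux; [exact: H|apply: differentiable_continuous; case: H => + _; apply].
Qed.

Lemma Ck_weaken E F k (U : set E) (f : E -> F) : Ck k.+1 U f -> Ck k U f.
Proof.
elim: k f => [|k IH] f H; first exact: (@Ck_continuous _ _ 1).
by case: H => d H; split => // v; apply: IH; exact: H.
Qed.

(** [Ck] evaluates the iterated derivatives only at points of the set, so it splits over singletons;
    [sm] below asks for an open neighbourhood. *)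
Lemma Ck_pt E F k (U : set E) (f : E -> F) :
  Ck k U f <-> forall x, U x -> Ck k [set x] f.
Proof.
elim: k f => [|k IH] f /=; first by split=> [H x Ux _ ->|H x Ux]; [exact: H|exact: (H x Ux x)].
split=> [[d H] x Ux|H].
  by split=> [_ ->|v]; [exact: d|apply: (IH _).1 => //; exact: H].
split=> [x Ux|v]; first by case: (H x Ux) => + _; apply.
by apply/IH => x Ux; case: (H x Ux) => _; apply.
Qed.

Lemma Ck_subset E F k (U V : set E) (f : E -> F) : V `<=` U ->
  Ck k U f -> Ck k V f.
Proof. by move=> VU /Ck_pt H; apply/Ck_pt => x /VU; exact: H. Qed.

Lemma Ck_ext E F k (U : set E) (f g : E -> F) : open U ->
  (forall x, U x -> f x = g x) -> Ck k U f -> Ck k U g.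
Proof.
move=> oU; elim: k f g => [|k IH] f g fg /= H.
  move=> x Ux; suff : g @ x --> f x by rewrite (fg x Ux).
  apply: cvg_trans (H x Ux); apply: near_eq_cvg.
  have : nbhs x U by exact: open_nbhs_nbhs.
  by apply: filterS => y; exact: fg.
have fgn x : U x -> \near x, f x = g x.
  move=> Ux; have : nbhs x U by exact: open_nbhs_nbhs.
  by apply: filterS => y; exact: fg.
case: H => d H; split=> [x Ux|v].
  by apply: near_differentiable (d x Ux); exact: fgn.
by apply: IH (H v) => x Ux; apply: D_ext; exact: fgn.
Qed.

Lemma Ck_cst E F k (U : set E) (a : F) : Ck k U (fun _ : E => a).
Proof.
elim: k a => [|k IH] a /=; first by move=> x _; exact: cvg_cst.
split=> [x _|v]; first exact: differentiable_cst.
rewrite [X in Ck k U X](_ : _ = fun _ => 0); first exact: IH.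
by apply/funext => x; rewrite [LHS]derive_cst.
Qed.

Lemma Ck_linear E F k (U : set E) (l : {linear E -> F}) : continuous l ->
  Ck k U l.
Proof.
move=> lc; case: k => [|k] /=; first by move=> x _; exact: lc.
split=> [x _|v]; first exact: differentiable_clin.
rewrite [X in Ck k U X](_ : _ = fun _ => l v); first exact: Ck_cst.
by apply/funext => x; rewrite D_clin.
Qed.

Lemma Ck_add E F k (U : set E) (f g : E -> F) : open U -> Ck k U f -> Ck k U g ->
  Ck k U (fun x => f x + g x).
Proof.
move=> oU; elim: k f g => [|k IH] f g /=.
  by move=> fc gc x Ux; apply: cvgD; [exact: fc|exact: gc].
move=> [df Hf] [dg Hg]; split=> [x Ux|v].
  by apply: differentiableD; [exact: df|exact: dg].
apply: (Ck_ext oU _ (IH _ _ (Hf v) (Hg v))) => x Ux.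
by rewrite [RHS]deriveD //; apply: diff_derivable; [exact: df|exact: dg].
Qed.

Lemma Ck_sum E F k (U : set E) m (f : 'I_m -> E -> F) : open U ->
  (forall i, Ck k U (f i)) -> Ck k U (fun x => \sum_i f i x).
Proof.
move=> oU; elim: m f => [|m IH] f H.
  rewrite [X in Ck k U X](_ : _ = fun _ => 0); first exact: Ck_cst.
  by apply/funext => x; rewrite big_ord0.
rewrite [X in Ck k U X](_ : _ = fun x =>
  \sum_(i < m) f (widen_ord (leqnSn m) i) x + f ord_max x).
  by apply: Ck_add => //; apply: IH.
by apply/funext => x; rewrite big_ord_recr.
Qed.

Lemma Ck_clin E F G k (U : set E) (l : {linear F -> G}) (f : E -> F) : open U ->
  continuous l -> Ck k U f -> Ck k U (fun x => l (f x)).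
Proof.
move=> oU lc; elim: k f => [|k IH] f /=.
  by move=> fc x Ux; apply: continuous_comp; [exact: fc|exact: lc].
move=> [df Hf]; split=> [x Ux|v].
  by apply: differentiable_comp; [exact: df|exact: differentiable_clin].
apply: (Ck_ext oU _ (IH _ (Hf v))) => x Ux.
rewrite (@D_comp _ _ _ _ l f) ?D_clin //; first exact: df.
exact: differentiable_clin.
Qed.

(** Puts scaling among the bilinear maps, whose differential is known; the product rule [D_scale]
    follows. *)
Lemma scaler_is_bilinear F :
  bilinear_for
    (GRing.Scale.Law.clone _ _ *:%R _) (GRing.Scale.Law.clone _ _ *:%R _)
    (@GRing.scale R F).
Proof.
split=> [u'|u] a x y /=.
- by rewrite scalerDl scalerA.
- by rewrite scalerDr !scalerA mulrC.
Qed.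
HB.instance Definition _ F :=
  bilinear_isBilinear.Build R R^o F F _ _ (@GRing.scale R F) (@scaler_is_bilinear F).

Lemma differentiable_scale E F (a : E -> R) (f : E -> F) x :
  differentiable a x -> differentiable f x ->
  differentiable (fun y => a y *: f y) x.
Proof.
move=> da df.
have -> : (fun y => a y *: f y) =
  (fun p : R^o * F => (p.1 *: p.2 : F)) \o (fun y => (a y, f y)) by [].
apply: differentiable_comp; first exact: differentiable_pair.
by apply: differentiable_bilin; exact: scale_continuous.
Qed.

Lemma D_scale E F (a : E -> R) (f : E -> F) x v :
  differentiable a x -> differentiable f x ->
  'D_v (fun y => a y *: f y) x = a x *: 'D_v f x + 'D_v a x *: f x.
Proof.
move=> da df.
have cs : continuous (fun p : R^o * F => (p.1 *: p.2 : F)) by exact: scale_continuous.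
rewrite (@D_comp _ E (R^o * F)%type F (fun p => p.1 *: p.2) (fun y => (a y, f y))) //.
- rewrite D_pair // deriveE ?diff_bilin //=.
  exact: differentiable_bilin.
- exact: differentiable_pair.
- exact: differentiable_bilin.
Qed.

Lemma D_scale_cst E F (k : R) (f : E -> F) x v : differentiable f x ->
  'D_v (fun y => k *: f y) x = k *: 'D_v f x.
Proof. by move=> df; rewrite [LHS]deriveZ //; exact: diff_derivable. Qed.

Lemma Ck_scale E F k (U : set E) (a : E -> R) (f : E -> F) : open U ->
  Ck k U a -> Ck k U f -> Ck k U (fun x => a x *: f x).
Proof.
move=> oU; elim: k a f => [|k IH] a f /=.
  by move=> ac fc x Ux; apply: cvgZ; [exact: ac|exact: fc].
move=> Ha Hf; have := (Ha, Hf); move=> [[da H1] [df H2]].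
split=> [x Ux|v].
  by apply: differentiable_scale; [exact: da|exact: df].
have H : Ck k U (fun x => a x *: 'D_v f x + 'D_v a x *: f x).
  by apply: Ck_add => //; apply: IH; do ?[exact: Ck_weaken]; [exact: H2|exact: H1].
by apply: (Ck_ext oU _ H) => x Ux; rewrite D_scale //; [exact: da|exact: df].
Qed.

Lemma Ck_comp E F G k (U : set E) (V : set F) (f : E -> F) (g : F -> G) :
  findim F -> open U -> (forall x, U x -> V (f x)) ->
  Ck k U f -> Ck k V g -> Ck k U (fun x => g (f x)).
Proof.
move=> [m [e [l [lc lE]]]] oU UV; elim: k g => [|k IH] g.
  by move=> fc gc x Ux; apply: continuous_comp; [exact: fc|exact/gc/UV].
move=> Hf Hg; have := (Hf, Hg) => -[[df H1] [dg H2]].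
split=> [x Ux|v].
  by apply: differentiable_comp; [exact: df|exact/dg/UV].
(* The chain rule differentiates [g] in the direction ['D_v f x], which moves with [x]; expanded in
   the [e i] it leaves fixed directions, to which the induction hypothesis applies. *)
have H : Ck k U (fun x => \sum_i (l i ('D_v f x) : R) *: 'D_(e i) g (f x)).
  apply: Ck_sum => // i; apply: Ck_scale => //.
    exact: (@Ck_clin E F R^o k U (l i) _ oU (lc i) (H1 v)).
  by apply: (IH (fun y => 'D_(e i) g y)); [exact: Ck_weaken|exact: H2].
apply: (Ck_ext oU _ H) => x Ux.
have dgx := dg _ (UV _ Ux).
by rewrite -(D_sum_dir (fun i => l i ('D_v f x)) e dgx) -lE (@D_comp _ _ _ _ g f) //; exact: df.
Qed.

Lemma Ck_pair E F G k (U : set E) (f : E -> F) (g : E -> G) : open U ->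
  Ck k U f -> Ck k U g -> Ck k U (fun x => (f x, g x)).
Proof.
move=> oU; elim: k f g => [|k IH] f g /=.
  by move=> fc gc x Ux; apply: cvg_pair; [exact: fc|exact: gc].
move=> [df Hf] [dg Hg]; split=> [x Ux|v].
  by apply: differentiable_pair; [exact: df|exact: dg].
apply: (Ck_ext oU _ (IH _ _ (Hf v) (Hg v))) => x Ux.
by rewrite D_pair //; [exact: df|exact: dg].
Qed.

Lemma Ck_mul E k (U : set E) (f g : E -> R) : open U ->
  Ck k U f -> Ck k U g -> Ck k U (fun x => f x * g x).
Proof. by move=> oU Hf Hg; apply: (@Ck_scale E R k U f g). Qed.

Lemma D_mul E (f g : E -> R) x v : differentiable f x -> differentiable g x ->
  'D_v (fun y => f y * g y) x = f x * 'D_v g x + 'D_v f x * g x.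
Proof. exact: (@D_scale E R). Qed.

Lemma D_inv E (f : E -> R) x v : differentiable f x -> f x != 0 ->
  'D_v (fun y => (f y)^-1) x = - ('D_v f x * ((f x)^-1 * (f x)^-1)).
Proof.
move=> df f0; rewrite [LHS]deriveV //; last exact: diff_derivable.
by rewrite -[_ *: _]/(_ * _) mulNr mulrC expr2 invfM.
Qed.

Lemma Ck_inv E k (U : set E) (f : E -> R) : open U ->
  (forall x, U x -> f x != 0) -> Ck k U f -> Ck k U (fun x => (f x)^-1).
Proof.
move=> oU f0; elim: k => [|k IH] /=.
  by move=> fc x Ux; apply: cvgV; [exact: f0|exact: fc].
move=> Hf; have [df H] := Hf; split=> [x Ux|v].
  by apply: differentiableV; [exact: df|exact: f0].
have H' : Ck k U (fun x => - 1 * ('D_v f x * ((f x)^-1 * (f x)^-1))).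
  have I : Ck k U (fun x => (f x)^-1) by apply: IH; exact: Ck_weaken.
  by do 3 ?[apply: Ck_mul => //]; exact: Ck_cst.
apply: (Ck_ext oU _ H') => x Ux.
by rewrite D_inv ?mulN1r //; [exact: df|exact: f0].
Qed.

Lemma differentiable_sqrt E (f : E -> R) x : differentiable f x -> 0 < f x ->
  differentiable (fun y => Num.sqrt (f y)) x.
Proof.
move=> df f0; apply: (@differentiable_comp _ _ _ _ f Num.sqrt) => //.
by apply/derivable1_diffP; have [] := is_derive1_sqrt f0.
Qed.

Lemma D_sqrt E (f : E -> R) x v : differentiable f x -> 0 < f x ->
  'D_v (fun y => Num.sqrt (f y)) x = 'D_v f x * (2 * Num.sqrt (f x))^-1.
Proof.
move=> df f0; have [dv dE] := is_derive1_sqrt f0.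
rewrite (@D_comp _ _ _ _ Num.sqrt f) //; last exact/derivable1_diffP.
rewrite -['D_v f x]mulr1 D_scale_dir; last exact/derivable1_diffP.
by rewrite dE -[_ *: _]/(_ * _) mulr1.
Qed.

Lemma Ck_sqrt E k (U : set E) (f : E -> R) : open U ->
  (forall x, U x -> 0 < f x) -> Ck k U f -> Ck k U (fun x => Num.sqrt (f x)).
Proof.
move=> oU f0; elim: k => [|k IH] /=.
  by move=> fc x Ux; apply: continuous_comp; [exact: fc|exact: sqrt_continuous].
move=> Hf; have [df H] := Hf; split=> [x Ux|v].
  by apply: differentiable_sqrt; [exact: df|exact: f0].
have H' : Ck k U (fun x => 'D_v f x * (2 * Num.sqrt (f x))^-1).
  apply: Ck_mul => //; apply: Ck_inv => //.
    by move=> x Ux; rewrite mulf_neq0 // gt_eqF // sqrtr_gt0 f0.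
  by apply: Ck_mul; [by []|exact: Ck_cst|apply: IH; exact: Ck_weaken].
apply: (Ck_ext oU _ H') => x Ux.
by rewrite D_sqrt //; [exact: df|exact: f0].
Qed.

End Smoothness.

(** * Finite-dimensional spaces *)

Section FiniteDimension.
Context {R : realType}.

Lemma findim_R : findim (R : normedModType R).
Proof.
exists 1%N, (fun=> 1), (fun=> idfun : {linear R -> R^o}).
by split=> [_ x|w]; [exact: cvg_id|rewrite big_ord1 -[_ *: _]/(_ * _) mulr1].
Qed.

Definition mx_coord m n (i : 'I_m) (j : 'I_n) (A : 'M[R]_(m, n)) : R^o := A i j.

Lemma mx_coord_linear m n (i : 'I_m) (j : 'I_n) : linear (mx_coord i j).
Proof. by move=> a u v; rewrite /mx_coord !mxE. Qed.
HB.instance Definition _ m n (i : 'I_m) (j : 'I_n) :=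
  GRing.isLinear.Build R 'M[R]_(m, n) R^o _ (mx_coord i j) (mx_coord_linear i j).

Lemma mx_coord_continuous m n (i : 'I_m) (j : 'I_n) : continuous (mx_coord i j).
Proof. exact: matrix_normedtype.coord_continuous. Qed.

Lemma findim_rV n : findim 'rV[R]_n.
Proof.
exists n, (fun i => delta_mx 0 i), (fun i => mx_coord 0 i : {linear 'rV[R]_n -> R^o}).
split=> [i|w]; first exact: mx_coord_continuous.
exact: row_sum_delta.
Qed.

Lemma findim_prod (E F : normedModType R) : findim E -> findim F ->
  findim (E * F)%type.
Proof.
move=> [m [e [l [lc lE]]]] [m' [e' [l' [lc' lE']]]].
pose L1 i : {linear (E * F)%type -> R^o} := l i \o fst.
pose L2 i : {linear (E * F)%type -> R^o} := l' i \o snd.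
exists (m + m')%N,
  (fun i : 'I_(m + m') => match fintype.split i with inl i => (e i, 0) | inr i => (0, e' i) end),
  (fun i : 'I_(m + m') => match fintype.split i with inl i => L1 i | inr i => L2 i end).
split=> [i x|[u v]].
  case: (fintype.split i) => j.
    by apply: continuous_comp; [exact: cvg_fst|exact: lc].
  by apply: continuous_comp; [exact: cvg_snd|exact: lc'].
rewrite big_split_ord /=.
under eq_bigr => i _ do rewrite (unsplitK (inl i)).
under [X in _ = _ + X]eq_bigr => i _ do rewrite (unsplitK (inr i)).
rewrite /L1 /L2 /= {1}(lE u) {1}(lE' v).
have -> : \sum_(i < m) l i u *: (e i, 0) = (\sum_(i < m) l i u *: e i, 0) :> E * F.
  elim/big_rec2: _ => // i a b _ ->; congr pair => /=.
  by rewrite scaler0 addr0.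
have -> : \sum_(i < m') l' i v *: (0, e' i) = (0, \sum_(i < m') l' i v *: e' i) :> E * F.
  elim/big_rec2: _ => // i a b _ ->; congr pair => /=.
  by rewrite scaler0 addr0.
by congr pair; rewrite /= ?addr0 ?add0r.
Qed.

End FiniteDimension.

#[global] Hint Extern 0 (findim _) => solve [repeat first
  [exact: findim_R | exact: findim_rV | apply: findim_prod]] : core.

(** Asking for a whole neighbourhood makes smoothness a property of germs that propagates to nearby
    points, so that domains need not be carried through the calculus below. *)
Definition sm (R : realType) (E F : normedModType R) (f : E -> F) (x : E) :=
  exists2 U, open_nbhs x U & Cinf U f.

Section SmoothAt.
Context {R : realType}.
Implicit Types E F G : normedModType R.

Lemma sm_near E F (f : E -> F) x : sm f x -> \near x, sm f x.
Proof.
move=> [U [oU Ux] H]; have : nbhs x U by exact: open_nbhs_nbhs.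
by apply: filterS => y Uy; exists U.
Qed.

Lemma Cinf_sm E F (U : set E) (f : E -> F) : open U ->
  Cinf U f <-> forall x, U x -> sm f x.
Proof.
move=> oU; split=> [H x Ux|H k]; first by exists U.
apply/Ck_pt => x Ux; have [V [oV Vx] HV] := H x Ux.
by apply: Ck_subset (HV k) => _ ->.
Qed.

Lemma near_open_nbhs E (x : E) (P : E -> Prop) : (\near x, P x) ->
  exists2 U, open_nbhs x U & forall y, U y -> P y.
Proof.
by move=> H; exists P° => [|y]; [split; [exact: open_interior|exact: H]|exact: interior_subset].
Qed.

Lemma open_nbhsI E (x : E) U V : open_nbhs x U -> open_nbhs x V -> open_nbhs x (U `&` V).
Proof. by move=> [oU Ux] [oV Vx]; split; [exact: openI|]. Qed.

Lemma sm_ext E F (f g : E -> F) x : (\near x, f x = g x) -> sm f x -> sm g x.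
Proof.
move=> /near_open_nbhs[V oV fg] [U oU H]; exists (U `&` V); first exact: open_nbhsI.
move=> k; apply: (@Ck_ext _ _ _ _ _ f) => [|y [_ /fg]//|].
  by case: (open_nbhsI oU oV).
by apply: Ck_subset (H k) => ? [].
Qed.

Lemma sm_diff E F (f : E -> F) x : sm f x -> differentiable f x.
Proof. by move=> [U [_ Ux] H]; case: (H 1%N) => + _; apply. Qed.

Lemma sm_cont E F (f : E -> F) x : sm f x -> {for x, continuous f}.
Proof. by move=> /sm_diff/differentiable_continuous. Qed.

Lemma sm_near_im E F (f : E -> F) x (P : set F) : sm f x -> nbhs (f x) P ->
  \near x, P (f x).
Proof. by move=> /sm_cont fc /fc. Qed.

Lemma sm_D E F (f : E -> F) v x : sm f x -> sm (fun y => 'D_v f y) x.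
Proof. by move=> [U xU H]; exists U => // k; case: (H k.+1) => _; apply. Qed.

Lemma sm_cst E F (a : F) (x : E) : sm (fun _ => a) x.
Proof. by exists setT => [|k]; [split => //; exact: openT|exact: Ck_cst]. Qed.

Lemma sm_linear E F (l : {linear E -> F}) x : continuous l -> sm l x.
Proof. by exists setT => [|k]; [split => //; exact: openT|exact: Ck_linear]. Qed.

Lemma sm_id E (x : E) : sm (fun y => y) x.
Proof. by apply: (@sm_linear _ _ idfun) => ?; exact: cvg_id. Qed.

Lemma sm_comp E F G (g : F -> G) (f : E -> F) x : findim F ->
  sm f x -> sm g (f x) -> sm (fun y => g (f y)) x.
Proof.
move=> fd [U [oU Ux] Hf] [V [oV Vfx] Hg].
have oUV : open (U `&` f @^-1` V).
  rewrite openE => y [Uy Vfy]; apply: filterI; first exact: open_nbhs_nbhs.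
  by apply: (Ck_continuous (Hf 0%N) Uy); exact: open_nbhs_nbhs.
exists (U `&` f @^-1` V); first by [].
move=> k; apply: (Ck_comp (V := V)) => // [? []//|].
by apply: Ck_subset (Hf k) => ? [].
Qed.

Lemma sm_pair E F G (f : E -> F) (g : E -> G) x : sm f x -> sm g x ->
  sm (fun y => (f y, g y)) x.
Proof.
move=> [U oU Hf] [V oV Hg]; exists (U `&` V) => [|k]; first exact: open_nbhsI.
have [oUV _] := open_nbhsI oU oV.
by apply: Ck_pair => //; [apply: Ck_subset (Hf k)|apply: Ck_subset (Hg k)] => ? [].
Qed.

Lemma sm_clin E F G (l : {linear F -> G}) (f : E -> F) x : continuous l ->
  sm f x -> sm (fun y => l (f y)) x.
Proof. by move=> lc [U [oU Ux] H]; exists U => // k; exact: Ck_clin. Qed.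

Lemma sm_fst E F G (f : E -> F * G) x : sm f x -> sm (fun y => (f y).1) x.
Proof. by apply: (@sm_clin _ _ _ fst) => ?; exact: cvg_fst. Qed.

Lemma sm_snd E F G (f : E -> F * G) x : sm f x -> sm (fun y => (f y).2) x.
Proof. by apply: (@sm_clin _ _ _ snd) => ?; exact: cvg_snd. Qed.

Lemma sm_coord E m n (f : E -> 'M[R]_(m, n)) i j x : sm f x ->
  sm (fun y => f y i j) x.
Proof.
by apply: (@sm_clin _ _ R^o (mx_coord i j)); exact: mx_coord_continuous.
Qed.

Lemma sm_add E F (f g : E -> F) x : sm f x -> sm g x -> sm (fun y => f y + g y) x.
Proof.
move=> [U oU Hf] [V oV Hg]; exists (U `&` V) => [|k]; first exact: open_nbhsI.
have [oUV _] := open_nbhsI oU oV.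
by apply: Ck_add => //; [apply: Ck_subset (Hf k)|apply: Ck_subset (Hg k)] => ? [].
Qed.

Lemma sm_scale E F (a : E -> R) (f : E -> F) x : sm a x -> sm f x ->
  sm (fun y => a y *: f y) x.
Proof.
move=> [U oU Hf] [V oV Hg]; exists (U `&` V) => [|k]; first exact: open_nbhsI.
have [oUV _] := open_nbhsI oU oV.
by apply: Ck_scale => //; [apply: Ck_subset (Hf k)|apply: Ck_subset (Hg k)] => ? [].
Qed.

Lemma sm_mul E (f g : E -> R) x : sm f x -> sm g x -> sm (fun y => f y * g y) x.
Proof. exact: (@sm_scale E R). Qed.

Lemma sm_opp E F (f : E -> F) x : sm f x -> sm (fun y => - f y) x.
Proof.
move=> H; apply: (@sm_ext _ _ (fun y => (-1) *: f y)).
  by apply: nearW => y; rewrite scaleN1r.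
by apply: sm_scale => //; exact: sm_cst.
Qed.

Lemma sm_sub E F (f g : E -> F) x : sm f x -> sm g x -> sm (fun y => f y - g y) x.
Proof. by move=> Hf Hg; apply: sm_add => //; exact: sm_opp. Qed.

Lemma sm_sum E F m (f : 'I_m -> E -> F) x : (forall i, sm (f i) x) ->
  sm (fun y => \sum_i f i y) x.
Proof.
elim: m f => [|m IH] f H.
  by apply: (@sm_ext _ _ (fun=> 0)); [apply: nearW => y; rewrite big_ord0|exact: sm_cst].
apply: (@sm_ext _ _ (fun y => f ord0 y + \sum_(i < m) f (lift ord0 i) y)).
  by apply: nearW => y; rewrite big_ord_recl.
by apply: sm_add => //; exact: IH.
Qed.

Lemma sm_inv E (f : E -> R) x : f x != 0 -> sm f x -> sm (fun y => (f y)^-1) x.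
Proof.
move=> f0 sf; have [U oU Hf] := sf.
have [V oV Hg] : exists2 V, open_nbhs x V & forall y, V y -> f y != 0.
  by apply: near_open_nbhs; apply: (sm_near_im (P := [set y | y != 0]) sf); apply: open_nbhs_nbhs; split => //; exact: open_neq.
exists (U `&` V) => [|k]; first exact: open_nbhsI.
have [oUV _] := open_nbhsI oU oV.
by apply: Ck_inv => // [? [_ /Hg]//|]; apply: Ck_subset (Hf k) => ? [].
Qed.

Lemma sm_sqrt E (f : E -> R) x : 0 < f x -> sm f x -> sm (fun y => Num.sqrt (f y)) x.
Proof.
move=> f0 sf; have [U oU Hf] := sf.
have [V oV Hg] : exists2 V, open_nbhs x V & forall y, V y -> 0 < f y.
  by apply: near_open_nbhs; apply: (sm_near_im (P := [set y : R | 0 < y]) sf); apply: open_nbhs_nbhs; split => //; exact: open_gt.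
exists (U `&` V) => [|k]; first exact: open_nbhsI.
have [oUV _] := open_nbhsI oU oV.
by apply: Ck_sqrt => // [? [_ /Hg]//|]; apply: Ck_subset (Hf k) => ? [].
Qed.

Lemma sm_Ddir E F G (f : E -> F) (g w : G -> E) x : findim E ->
  sm g x -> sm w x -> sm f (g x) -> sm (fun y => 'D_(w y) f (g y)) x.
Proof.
move=> fd sg sw sf; have [m [e [l [lc lE]]]] := fd.
apply: (@sm_ext _ _ (fun y => \sum_i (l i (w y) : R) *: 'D_(e i) f (g y))).
  have sfg := sm_near_im sg (sm_near sf).
  near=> y; rewrite -(D_sum_dir (fun i => l i (w y)) e) -?lE //.
  by apply: sm_diff; near: y.
apply: sm_sum => i; apply: sm_scale.
  exact: (@sm_clin _ _ R^o (l i)).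
by apply: (@sm_comp _ _ _ (fun z => 'D_(e i) f z)) => //; exact: sm_D.
Unshelve. all: by end_near. Qed.

Lemma D_clin_comp E F G (l : {linear F -> G}) (f : E -> F) x v : continuous l ->
  differentiable f x -> 'D_v (fun y => l (f y)) x = l ('D_v f x).
Proof.
move=> lc df; rewrite (@D_comp _ _ _ _ l f) ?D_clin //.
exact: differentiable_clin.
Qed.

Lemma D_sum E F m (f : 'I_m -> E -> F) x v : (forall i, differentiable (f i) x) ->
  'D_v (fun y => \sum_i f i y) x = \sum_i 'D_v (f i) x.
Proof.
move=> df; rewrite -derive_sum; last by move=> i; exact/diff_derivable.
by congr ('D_v _ x); apply/funext => y; rewrite fct_sumE.
Qed.

(** A derivative is linear in its direction, so this is a Leibniz rule: one term for the motion of
    the direction, one for the motion of the base point. It serves to differentiate momenta paired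
    with moving vectors. *)
Lemma D_Ddir E F G (f : E -> F) (g w : G -> E) x v : findim E ->
  sm g x -> sm w x -> sm f (g x) ->
  'D_v (fun y => 'D_(w y) f (g y)) x =
  'D_('D_v w x) f (g x) + 'D_('D_v g x) (fun z => 'D_(w x) f z) (g x).
Proof.
move=> fd sg sw sf; have [m [e [l [lc lE]]]] := fd.
have dl i : differentiable (fun y => l i (w y) : R) x.
  by apply: sm_diff; exact: (@sm_clin _ _ R^o (l i)).
have dD i : differentiable (fun z => 'D_(e i) f z) (g x).
  by apply: sm_diff; exact: sm_D.
have dDg i : differentiable (fun y => 'D_(e i) f (g y)) x.
  by apply: (@differentiable_comp _ _ _ _ g (fun z => 'D_(e i) f z)) => //; exact: sm_diff.
rewrite (@D_ext _ _ _ _ (fun y => \sum_i (l i (w y) : R) *: 'D_(e i) f (g y))); last first.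
  have sfg := sm_near_im sg (sm_near sf).
  near=> y; rewrite -(D_sum_dir (fun i => l i (w y)) e) -?lE //.
  by apply: sm_diff; near: y.
rewrite D_sum; last by move=> i; exact: differentiable_scale.
rewrite [X in _ = _ + X](@D_ext _ _ _ _ (fun z => \sum_i (l i (w x) : R) *: 'D_(e i) f z)); last first.
  have sfn := sm_near sf; near=> z.
  rewrite -(D_sum_dir (fun i => l i (w x)) e) -?lE //.
  by apply: sm_diff; near: z.
rewrite D_sum; last first.
  by move=> i; apply: differentiable_scale => //; exact: differentiable_cst.
rewrite [X in 'D_X f (g x)](lE ('D_v w x)) D_sum_dir; last exact: sm_diff.
rewrite -big_split /=; apply: eq_bigr => i _.
rewrite (D_scale v (dl i) (dDg i)).
have E2 : 'D_('D_v g x) (fun z => (l i (w x) : R) *: 'D_(e i) f z) (g x) =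
    (l i (w x) : R) *: 'D_('D_v g x) (fun z => 'D_(e i) f z) (g x).
  exact: D_scale_cst.
rewrite E2 addrC; congr (_ *: _ + _ *: _).
  by rewrite (@D_comp _ _ _ _ (fun z => 'D_(e i) f z) g) //; exact: sm_diff.
exact: (@D_clin_comp _ _ R^o (l i) w x v (lc i) (sm_diff sw)).
Unshelve. all: by end_near. Qed.

End SmoothAt.

(** * Mean values and symmetry of second derivatives *)

Section Differentiability.
Context {R : realType}.
Implicit Types E F : normedModType R.

Lemma differentiable_near E F (f : E -> F) x : differentiable f x ->
  forall eps : R, 0 < eps ->
  \forall y \near x, `|f y - f x - 'd f x (y - x)| <= eps * `|y - x|.
Proof.
move=> df eps e0; have /eqaddoP/(_ _ e0) := diff_locally df.
rewrite (near_shift 0 x) subr0; apply: filterS => y.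
by rewrite !fctE /= addrK opprD addrA.
Qed.

Lemma near_differentiable_lin E F (f : E -> F) x (l : {linear E -> F}) :
  continuous l ->
  (forall eps : R, 0 < eps ->
  \forall y \near x, `|f y - f x - l (y - x)| <= eps * `|y - x|) ->
  differentiable f x /\ 'd f x = l :> (E -> F).
Proof.
move=> lc H.
have key : f \o shift x = cst (f x) + l +o_ 0 id.
  apply/eqaddoP => e e0; have := H e e0.
  rewrite (near_shift 0 x) subr0; apply: filterS => y /=.
  by rewrite !fctE /= addrK opprD addrA.
have dE := diff_unique lc key.
by split=> //; apply/diff_locallyP; rewrite dE.
Qed.

End Differentiability.

Section OneVariable.
Context {R : realType}.

Lemma D_line (E F : normedModType R) (f : E -> F) x (u : E) (s : R) :
  differentiable f (x + s *: u) ->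
  is_derive s 1 (fun s : R => f (x + s *: u)) ('D_u f (x + s *: u)).
Proof.
move=> df.
have dl : differentiable (fun s : R => x + s *: u) s.
  apply: differentiableD; first exact: differentiable_cst.
  by apply: (@differentiable_scale _ _ _ idfun) => //; exact: differentiable_cst.
apply: DeriveDef; first by apply/diff_derivable/(@differentiable_comp _ _ _ _ (fun s : R => x + s *: u) f).
rewrite (@D_comp _ _ _ _ f (fun s : R => x + s *: u)) //; congr ('D_ _ f _).
have di : differentiable (fun s : R => s) s by [].
have du : differentiable (fun _ : R => u) s by exact: differentiable_cst.
rewrite [LHS]deriveD; [|exact: derivable_cst|]; last first.
  exact/diff_derivable/(differentiable_scale di du).
rewrite derive_cst add0r.
have -> : 'D_1 (fun s : R => s *: u) s = s *: 'D_1 (fun _ : R => u) s + 'D_1 (fun s : R => s) s *: u.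
  exact: D_scale.
have -> : 'D_1 (fun _ : R => u) s = 0 by exact: derive_cst.
have -> : 'D_1 (fun s : R => s) s = 1 by exact: derive_id.
by rewrite scaler0 add0r scale1r.
Qed.

Lemma mean_value (f df : R -> R) (a b : R) : a < b ->
  (forall x : R, a <= x <= b -> is_derive x 1 f (df x)) ->
  exists2 c, a < c < b & f b - f a = df c * (b - a).
Proof.
move=> ab H.
have [| |c cab E] := @MVT R f df a b ab.
- by move=> x; rewrite in_itv /= => /andP[ax xb]; apply: H; rewrite !ltW.
- apply: continuous_in_subspaceT => x /set_mem /=; rewrite in_itv /= => xab.
  have [dx _] := H x xab.
  by apply: differentiable_continuous; exact/derivable1_diffP.
- by exists c => //; move: cab; rewrite in_itv.
Qed.

Lemma derive0_constant (I : set R) (g : R -> R) : is_interval I ->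
  (forall t : R, I t -> is_derive t 1 g 0) -> forall a b : R, I a -> I b -> g a = g b.
Proof.
move=> iI H a b; wlog ab : a b / a < b => [W Ia Ib|Ia Ib].
  by have [ab|ba|->//] := ltgtP a b; [exact: W|apply/esym/W].
have [x axb|c _] := @mean_value g (fun=> 0) a b ab.
  by apply: H; apply: (iI a b).
by rewrite mul0r => /eqP; rewrite subr_eq0 => /eqP.
Qed.

Lemma derive_gt0_lt (J : set R) (g dg : R -> R) : is_interval J ->
  (forall t : R, J t -> is_derive t 1 g (dg t)) -> (forall t, J t -> 0 < dg t) ->
  forall a b : R, J a -> J b -> (g a < g b) = (a < b).
Proof.
move=> iJ H dg0.
have key (a b : R) : J a -> J b -> a < b -> g a < g b.
  move=> Ja Jb ab.
  have [x axb|c /andP[ac cb] E] := @mean_value g dg a b ab.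
    by apply: H; apply: (iJ a b).
  rewrite -subr_gt0 E mulr_gt0 ?subr_gt0 // dg0 //; apply: (iJ a b) => //.
  by rewrite !ltW.
move=> a b Ja Jb; have [ab|ba|->] := ltgtP a b; first by rewrite key.
  by apply/negbTE; rewrite -leNgt ltW // key.
by rewrite ltxx.
Qed.

Lemma derive_ge0_le (J : set R) (g dg : R -> R) : is_interval J ->
  (forall t : R, J t -> is_derive t 1 g (dg t)) -> (forall t, J t -> 0 <= dg t) ->
  forall a b : R, J a -> J b -> a <= b -> g a <= g b.
Proof.
move=> iJ H dg0 a b Ja Jb; rewrite le_eqVlt => /orP[/eqP->//|ab].
have [x axb|c /andP[ac cb] E] := @mean_value g dg a b ab.
  by apply: H; apply: (iJ a b).
rewrite -subr_ge0 E mulr_ge0 ?subr_ge0 ?(ltW ab) // dg0 //; apply: (iJ a b) => //.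
by rewrite !ltW.
Qed.

End OneVariable.

Section Schwarz.
Context {R : realType}.

(** Mean value theorem for [g], a difference along [v] seen as a function of the step along [u], and
    then for ['D_u f] along [v]. The double difference is symmetric in [u] and [v] while the result
    is not, so exchanging them compares the two mixed derivatives. *)
Lemma double_difference (E : normedModType R) (f : E -> R) x (u v : E) (t : R) :
  0 < t ->
  (forall s r : R, 0 <= s <= t -> 0 <= r <= t -> sm f (x + s *: u + r *: v)) ->
  exists s r : R, [/\ 0 <= s <= t, 0 <= r <= t &
    f (x + t *: u + t *: v) - f (x + t *: u) - f (x + t *: v) + f x =
    'D_v (fun y => 'D_u f y) (x + s *: u + r *: v) * t * t].
Proof.
move=> t0 H; have t00 : 0 <= t <= t by rewrite lexx ltW.
have z0t : (0 : R) <= 0 <= t by rewrite lexx ltW.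
pose g s := f (x + t *: v + s *: u) - f (x + s *: u).
have [s s0t|s s0t E1] := @mean_value R g
  (fun s => 'D_u f (x + t *: v + s *: u) - 'D_u f (x + s *: u)) 0 t t0.
  apply: is_deriveB; apply: D_line.
    by rewrite addrAC; apply/sm_diff/H.
  by have := H s 0 s0t z0t; rewrite scale0r addr0 => /sm_diff.
have s0t' : 0 <= s <= t by case/andP: s0t => ? ?; rewrite !ltW.
have [r r0t|r r0t E2] := @mean_value R (fun r => 'D_u f (x + s *: u + r *: v))
  (fun r => 'D_v (fun y => 'D_u f y) (x + s *: u + r *: v)) 0 t t0.
  by apply: (@D_line _ _ _ (fun y => 'D_u f y)); apply: sm_diff; apply: sm_D; exact: H.
exists s, r; split => //; first by case/andP: r0t => ? ?; rewrite !ltW.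
move: E2; rewrite subr0 scale0r addr0 => <-.
move: E1; rewrite /g subr0 scale0r !addr0 [x + t *: v + s *: u]addrAC => <-.
rewrite [x + t *: v + t *: u]addrAC opprB addrA addrAC.
by rewrite -!addrA; congr (_ + _); rewrite addrC -!addrA.
Qed.

Lemma Schwarz_R (E : normedModType R) (f : E -> R) x (u v : E) : sm f x ->
  'D_v (fun y => 'D_u f y) x = 'D_u (fun y => 'D_v f y) x.
Proof.
move=> sf; apply/eqP; rewrite -subr_eq0 -normr_le0; apply/ler_addgt0Pr => e e0.
rewrite add0r.
have e20 : 0 < e / 2 by rewrite divr_gt0.
pose A y := 'D_v (fun y => 'D_u f y) y; pose B y := 'D_u (fun y => 'D_v f y) y.
have near_x : \forall y \near x, [/\ sm f y, `|A x - A y| < e / 2 & `|B x - B y| < e / 2].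
  have nA : \forall y \near x, `|A x - A y| < e / 2.
    by have cA : A @ x --> A x := sm_cont (sm_D v (sm_D u sf)); move/cvgrPdist_lt : cA; apply.
  have nB : \forall y \near x, `|B x - B y| < e / 2.
    by have cB : B @ x --> B x := sm_cont (sm_D u (sm_D v sf)); move/cvgrPdist_lt : cB; apply.
  by move: (sm_near sf) nA nB; apply: filterS3.
have /nbhs_ballP[d /= d0 Hd] := near_x.
(* The parallelogram with sides [t *: u] and [t *: v] fits in the ball of radius [d]; the summand 1
   covers [u = v = 0], and the half makes the inclusion strict. *)
pose t := d / (1 + `|u| + `|v|) / 2.
have c0 : 0 < 1 + `|u| + `|v| by rewrite -addrA ltr_pwDl // addr_ge0.
have t0 : 0 < t by rewrite !divr_gt0.
have inb s r : 0 <= s <= t -> 0 <= r <= t -> ball x d (x + s *: u + r *: v).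
  move=> /andP[s0 st] /andP[r0 rt]; rewrite -ball_normE /=.
  rewrite -addrA opprD addNKr normrN.
  apply: (@le_lt_trans _ _ (t * (1 + `|u| + `|v|))).
    apply: (le_trans (ler_normD _ _)); rewrite !normrZ !ger0_norm //.
    rewrite !mulrDr mulr1 -addrA; apply: (@le_trans _ _ (t * `|u| + t * `|v|)).
      by apply: lerD; rewrite ler_wpM2r.
    by rewrite lerDr ltW.
  rewrite /t mulrAC divfK ?gt_eqF // ltr_pdivrMr // ltr_pMr // ltr1n //.
have [s [r [Hs Hr E1]]] := @double_difference E f x u v t t0
  (fun s r Hs Hr => let: And3 a _ _ := Hd _ (inb s r Hs Hr) in a).
have [s' [r' [Hs' Hr' E2]]] := @double_difference E f x v u t t0
  (fun s r Hs Hr => let: And3 a _ _ := Hd _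
     (eq_ind _ (fun w => ball x d w) (inb r s Hr Hs) _ (addrAC _ _ _)) in a).
have [_ H1 _] := Hd _ (inb _ _ Hs Hr).
have [_ _] := Hd _ (inb _ _ Hr' Hs'); rewrite addrAC => H2.
(* The same double difference computed in both orders: the mixed derivatives agree at two points
   near [x], and their continuity at [x] concludes. *)
have AB : A (x + s *: u + r *: v) = B (x + s' *: v + r' *: u).
  apply: (mulIf (lt0r_neq0 t0)); apply: (mulIf (lt0r_neq0 t0)).
  apply: (etrans (esym E1)); apply: (etrans _ E2).
  rewrite [x + t *: v + t *: u]addrAC; congr (_ + _).
  by rewrite -!addrA; congr (_ + _); rewrite addrC.
rewrite (splitr e) -/(A x) -/(B x).
have -> : A x - B x = (A x - A (x + s *: u + r *: v)) - (B x - B (x + s' *: v + r' *: u)).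
  by rewrite AB opprB addrA subrK.
apply: (le_trans (ler_normB _ _)); apply: lerD; [exact: (ltW H1)|exact: (ltW H2)].
Qed.

Lemma Schwarz (E F : normedModType R) (f : E -> F) x (u v : E) : findim F ->
  sm f x -> 'D_v (fun y => 'D_u f y) x = 'D_u (fun y => 'D_v f y) x.
Proof.
move=> [m [e [l [lc lE]]]] sf.
have key i a b : l i ('D_b (fun y => 'D_a f y) x) =
    'D_b (fun y => 'D_a (fun z => l i (f z) : R) y) x.
  rewrite -(@D_clin_comp _ _ _ R^o (l i) (fun y => 'D_a f y)) //; last exact/sm_diff/sm_D.
  apply: D_ext; have sfn := sm_near sf; near=> y; apply/esym.
  by apply: (@D_clin_comp _ _ _ R^o (l i) f) => //; apply: sm_diff; near: y.
apply: (etrans (lE _)); apply: (etrans _ (esym (lE _))).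
apply: eq_bigr => i _; apply: (congr1 (fun a : R => a *: e i)).
apply: (etrans (key i u v)); apply: (etrans _ (esym (key i v u))).
apply: Schwarz_R; exact: (@sm_clin _ _ _ R^o (l i)).
Unshelve. all: by end_near. Qed.

End Schwarz.

(** * Inverse functions of one variable *)

Lemma continuous_pair (R : realType) (E F G : normedModType R) (f : E -> F)
  (g : E -> G) x : {for x, continuous f} -> {for x, continuous g} ->
  {for x, continuous (fun y => (f y, g y))}.
Proof. by move=> fc gc; apply: cvg_pair. Qed.

Lemma continuous_fst (R : realType) (E F : normedModType R) :
  continuous (fun z : E * F => z.1).
Proof. by move=> z; exact: cvg_fst. Qed.

Lemma continuous_snd (R : realType) (E F : normedModType R) :
  continuous (fun z : E * F => z.2).
Proof. by move=> z; exact: cvg_snd. Qed.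

Lemma nearS (R : realType) (E : normedModType R) (x : E) (P Q : E -> Prop) :
  (forall y, P y -> Q y) -> (\near x, P x) -> \near x, Q x.
Proof. exact: filterS. Qed.

Lemma nearT (R : realType) (E : normedModType R) (x : E) (P : E -> Prop) :
  (forall y, P y) -> \near x, P x.
Proof. by move=> H; exact: nearW. Qed.

Lemma nearI (R : realType) (E : normedModType R) (x : E) (P Q : E -> Prop) :
  (\near x, P x) -> (\near x, Q x) -> \near x, P x /\ Q x.
Proof. exact: filterI. Qed.

Section InverseFunction.
Context {R : realType}.
Implicit Types (T S : R * R -> R) (z : R * R).

Lemma inverse_linear (A B : R) :
  exists2 l : {linear (R * R)%type -> R^o}, continuous l &
    forall z, l z = (z.2 - A * z.1) / B.
Proof.
pose l z : R^o := (z.2 - A * z.1) / B.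
have ll : linear l.
  by move=> k u v; rewrite /l /= -[_ *: (_ / _)]/(_ * _) -![k *: _]/(_ * _); ring.
pose lM := GRing.isLinear.Build _ _ _ _ _ ll.
pose L : {linear _ -> _} := HB.pack l lM.
exists L => // z; rewrite -[L : _ -> _]/l /l.
apply: sm_cont; apply: sm_mul; last exact: sm_cst.
apply: sm_sub; first by apply: sm_snd; exact: sm_id.
by apply: sm_mul; [exact: sm_cst|apply: sm_fst; exact: sm_id].
Qed.

(** Here [T (e, s)] is a family of functions of [s] with parameter [e], and [S (e, t)] solves
    [T (e, s) = t]. In the application [e] numbers the geodesics of a variation and [T] measures
    length along them. *)
Lemma inverse_differentiable T S (z0 : R * R) :
  let p0 := (z0.1, S z0) in
  differentiable T p0 -> 0 < 'D_(0, 1) T p0 -> {for z0, continuous S} ->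
  (\near z0, T (z0.1, S z0) = z0.2) ->
  differentiable S z0 /\
  forall v, 'D_v S z0 = (v.2 - 'D_(1, 0) T p0 * v.1) * ('D_(0, 1) T p0)^-1.
Proof.
move=> p0 dT; set B := 'D_(0, 1) T p0; set A := 'D_(1, 0) T p0 => B0 cS TS.
have [l lc lE] := inverse_linear A B.
have LE (a b : R) : 'd T p0 (a, b) = A * a + B * b.
  rewrite -deriveE // D_pair_dir //.
  have -> : (a, 0) = a *: (1, 0) :> R * R by congr pair; rewrite /= ?[_ *: _]mulr1 ?scaler0.
  have -> : (0, b) = b *: (0, 1) :> R * R by congr pair; rewrite /= ?[_ *: _]mulr1 ?scaler0.
  by rewrite !D_scale_dir // [A * a]mulrC [B * b]mulrC.
suff H (eps : R) : 0 < eps ->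
    \forall z \near z0, `|S z - S z0 - l (z - z0)| <= eps * `|z - z0|.
  have [dS dSE] := @near_differentiable_lin _ _ R^o S z0 l lc H.
  split=> [|v]; first exact: dS.
  apply: (etrans (deriveE v dS)).
  by apply: (etrans (congr1 (fun g : R * R -> R => g v) dSE)); exact: lE.
move=> eps0.
(* An error of at most [B / 2] in the expansion of [T] is absorbed by [B * |c|] and yields
   [|c| <= C * d]. The second bound on [eta] then makes the total error [eta * (1 + C) * d] at most
   [eps * B * d]. *)
pose C := 2 / B * (1 + `|A| + B / 2).
have C0 : 0 < C.
  by rewrite mulr_gt0 ?divr_gt0 // addr_gt0 ?divr_gt0 // ltr_pwDl.
pose eta := Num.min (B / 2) (eps * B / (1 + C)).
have eta0 : 0 < eta by rewrite lt_min !divr_gt0 ?mulr_gt0 ?addr_gt0.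
have cp : {for z0, continuous (fun z : R * R => (z.1, S z))}.
  by apply: continuous_pair; [exact: continuous_fst|].
have := cp _ (differentiable_near dT eta0).
move: TS; rewrite !near_simpl => TS; have TS0 := nbhs_singleton TS.
move: TS; apply: filterS2 => z TS /=.
rewrite TS TS0 lE.
have [a [b [aE bE]]] : exists a b, z.1 - z0.1 = a /\ z.2 - z0.2 = b by do 2 eexists.
set c := S z - S z0.
have -> : (z.1, S z) - p0 = (a, c) by rewrite -aE.
have zE : z - z0 = (a, b) by rewrite -aE -bE.
rewrite LE zE bE /=.
have [na nb] : `|a| <= `|(a, b)| /\ `|b| <= `|(a, b)|.
  by rewrite prod_normE /= !le_max !lexx orbT.
set d := `|(a, b)|; rewrite -/d in na nb.
have nac : `|(a, c)| <= d + `|c|.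
  by rewrite prod_normE /= ge_max (le_trans na) ?lerDl //= lerDr (le_trans _ na).
move=> H0.
have H : `|b - (A * a + B * c)| <= eta * (d + `|c|).
  by apply: (le_trans H0); rewrite ler_wpM2l // ltW.
have eta1 : eta <= B / 2 by rewrite ge_min lexx.
have eta2 : eta * (1 + C) <= eps * B.
  by rewrite -ler_pdivlMr ?addr_gt0 // ge_min lexx orbT.
have d0 : 0 <= d by exact: normr_ge0.
have cC : `|c| <= C * d.
  have h1 : B * `|c| <= `|b - (A * a + B * c)| + `|b| + `|A| * `|a|.
    have -> : B * `|c| = `|- (b - (A * a + B * c)) + b - A * a|.
      have -> : - (b - (A * a + B * c)) + b - A * a = B * c by ring.
      by rewrite normrM (gtr0_norm B0).
    rewrite -[`|A| * _]normrM; apply: (le_trans (ler_normB _ _)).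
    by rewrite lerD2r; apply: (le_trans (ler_normD _ _)); rewrite normrN.
  have h2 : eta * (d + `|c|) <= B / 2 * (d + `|c|) by rewrite ler_wpM2r // addr_ge0.
  have h3 : `|A| * `|a| <= `|A| * d by rewrite ler_wpM2l.
  have h4 : B / 2 * `|c| <= (1 + `|A| + B / 2) * d by lra.
  rewrite /C -mulrA -ler_pdivrMl ?divr_gt0 // invf_div.
  exact: h4.
have -> : c - (b - A * a) / B = - (b - (A * a + B * c)) / B.
  by field; rewrite gt_eqF.
rewrite normrM normrN normfV (gtr0_norm B0) ler_pdivrMr //.
apply: (le_trans H); apply: (@le_trans _ _ (eta * (1 + C) * d)).
  by rewrite -mulrA ler_wpM2l ?(ltW eta0) //; lra.
by rewrite [leRHS]mulrAC ler_wpM2r.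
Qed.

(** The derivative of [S] is a rational expression in the derivatives of [T] at [(e, S)], so each
    order of smoothness of [S] gives the next. *)
Lemma inverse_sm T S (z0 : R * R) :
  (\forall z \near z0, [/\ sm T (z.1, S z), 0 < 'D_(0, 1) T (z.1, S z),
     {for z, continuous S} & T (z.1, S z) = z.2]) -> sm S z0.
Proof.
move=> H0.
have [U [oU Uz0] HU] := near_open_nbhs H0.
exists U; first by [].
have TS z : U z -> \near z, T (z.1, S z) = z.2.
  move=> Uz; have : nbhs z U by exact: open_nbhs_nbhs.
  by apply: filterS => y /HU[].
have D z : U z -> differentiable S z /\
    forall v, 'D_v S z = (v.2 - 'D_(1, 0) T (z.1, S z) * v.1) * ('D_(0, 1) T (z.1, S z))^-1.
  move=> Uz; have [sT T0 cS _] := HU z Uz.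
  by apply: inverse_differentiable => //; [exact: sm_diff|exact: TS].
elim => [|k IH]; first by move=> z /HU[].
split=> [z /D[]//|v].
have cp : Ck k U (fun z => (z.1, S z)).
  apply: Ck_pair => //; apply: (@Ck_linear _ _ _ _ _ fst).
  by move=> ?; exact: cvg_fst.
have cD w : Ck k U (fun z => 'D_w T (z.1, S z)).
  apply: (@Ck_comp _ _ _ _ k U ((fun z => (z.1, S z)) @` U) (fun z => (z.1, S z)) (fun p => 'D_w T p)) => //.
    by move=> z Uz; exists z.
  apply/Ck_pt => _ [z Uz <-]; have [sT _ _ _] := HU z Uz.
  have [V [oV Vz] HV] := sm_D w sT.
  by apply: Ck_subset (HV k) => _ ->.
have H : Ck k U (fun z => (v.2 + (-1) * ('D_(1, 0) T (z.1, S z) * v.1)) * ('D_(0, 1) T (z.1, S z))^-1).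
  apply: Ck_mul => //; last by apply: Ck_inv => // z /HU[_ ? _ _]; rewrite gt_eqF.
  apply: Ck_add => //; first exact: Ck_cst.
  apply: Ck_mul => //; first exact: Ck_cst.
  by apply: Ck_mul => //; exact: Ck_cst.
by apply: (Ck_ext oU _ H) => z /D[_ ->]; rewrite mulN1r.
Qed.

(** By monotonicity in the second variable, [S z] lies between [S z0 - r] and [S z0 + r] as soon as
    [z.2] lies between the values of [T] there, and this persists for [z] near [z0]. *)
Lemma inverse_continuous T S (z0 : R * R) (J : set R) :
  is_interval J -> open J -> J (S z0) ->
  (forall s, J s -> {for (z0.1, s), continuous T}) ->
  (\forall z \near z0, [/\ J (S z), T (z.1, S z) = z.2 &
    forall a b, J a -> J b -> (T (z.1, a) < T (z.1, b)) = (a < b)]) ->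
  {for z0, continuous S}.
Proof.
move=> iJ oJ J0 cT H.
have [J00 T0 mono0] := nbhs_singleton H.
suff : S @ z0 --> S z0 by [].
apply/cvgrPdist_le => e e0.
have /nbhs_ballP[d /= d0 Hd] : nbhs (S z0) J by exact: open_nbhs_nbhs.
pose r := Num.min (d / 2) e.
have r0 : 0 < r by rewrite lt_min divr_gt0.
have rd : r < d by rewrite gt_min ltr_pdivrMr // ltr_pMr // ltr1n.
have Jm : J (S z0 - r) by apply: Hd; rewrite /ball /= opprB addrCA subrr addr0 gtr0_norm.
have Jp : J (S z0 + r) by apply: Hd; rewrite /ball /= opprD addNKr normrN gtr0_norm.
have cz s : J s -> (fun z => T (z.1, s)) @ z0 --> T (z0.1, s).
  move=> Js; apply: (@continuous_comp _ _ _ (fun z : R * R => (z.1, s)) T); last exact: cT.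
  by apply: continuous_pair; [exact: continuous_fst|exact: cvg_cst].
have lo : T (z0.1, S z0 - r) - z0.2 < 0.
  by rewrite -T0 subr_lt0 mono0 // gtrDl oppr_lt0.
have hi : 0 < T (z0.1, S z0 + r) - z0.2.
  by rewrite -T0 subr_gt0 mono0 // ltrDl.
have clo : (fun z => T (z.1, S z0 - r) - z.2) @ z0 --> T (z0.1, S z0 - r) - z0.2.
  by apply: cvgB; [exact: cz|exact: continuous_snd].
have chi : (fun z => T (z.1, S z0 + r) - z.2) @ z0 --> T (z0.1, S z0 + r) - z0.2.
  by apply: cvgB; [exact: cz|exact: continuous_snd].
have nlo := cvgr_lt _ clo _ lo.
have nhi := cvgr_gt _ chi _ hi.
apply: nearS (nearI H (nearI (nlo (nbhs_filter z0)) (nhi (nbhs_filter z0)))) => z [[Jz Tz mono] []] /=.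
rewrite subr_lt0 subr_gt0 -{1 2}Tz !mono // => h1 h2.
have re : r <= e by rewrite ge_min lexx orbT.
by rewrite distrC ler_norml; apply/andP; split; lra.
Qed.

End InverseFunction.

(** * Charts, smooth maps and metrics *)

(** The germ version of [smooth_map], as [sm] is of [Cinf]; continuity keeps nearby values inside a
    chart domain, where the coordinates are meaningful. *)
Definition smap (R : realType) n (M : manifold R n) (E : normedModType R)
    (s : E -> M) (u : E) : Prop :=
  (\near u, {for u, continuous s}) /\
  forall c, dom c (s u) -> sm (fun v => coord c (s v)) u.

Section Charts.
Context {R : realType} {n : nat} {M : manifold R n}.
Implicit Types (E F : normedModType R) (c d : chart M) (p q : M).

Lemma cim_open c : open (cim c).
Proof. exact: coord_image_open. Qed.

Lemma cim_coord c p : dom c p -> cim c (coord c p).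
Proof. by exists p. Qed.

Lemma dom_param c x : cim c x -> dom c (param c x).
Proof. by move=> [p cp <-]; rewrite coordK. Qed.

Lemma paramK c x : cim c x -> coord c (param c x) = x.
Proof. by move=> [p cp <-]; rewrite coordK. Qed.

Lemma near_cim c x : cim c x -> \near x, cim c x.
Proof. by move=> cx; apply: open_nbhs_nbhs; split => //; exact: cim_open. Qed.

Lemma chart_atP p : dom (chart_at p) p.
Proof. by rewrite /chart_at; case: cid. Qed.

Lemma near_dom c E (s : E -> M) u : {for u, continuous s} -> dom c (s u) ->
  \near u, dom c (s u).
Proof. by move=> cs du; apply: cs; apply: open_nbhs_nbhs; split => //; exact: dom_open. Qed.

Lemma transition_sm c d p : dom c p -> dom d p ->
  sm (fun x => coord d (param c x)) (coord c p).
Proof.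
move=> cp dp; exists (cim c `&` param c @^-1` dom d); last first.
  move=> k; apply: Ck_subset (transition_smooth c d k) => x [cx dx].
  by exists (param c x); [split=> //; exact: dom_param|exact: paramK].
split; last by split; [exact: cim_coord|rewrite /= coordK].
rewrite openE => x [cx dx]; apply: filterI; first exact: near_cim.
by apply: (param_continuous cx); apply: open_nbhs_nbhs; split => //; exact: dom_open.
Qed.

Lemma smap_cont E (s : E -> M) u : smap s u -> {for u, continuous s}.
Proof. by case=> /nbhs_singleton. Qed.

Lemma smap_coord E (s : E -> M) u c : smap s u -> dom c (s u) ->
  sm (fun v => coord c (s v)) u.
Proof. by case=> _; apply. Qed.

Lemma smap_near_param E (s : E -> M) u c : smap s u -> dom c (s u) ->
  \near u, s u = param c (coord c (s u)).
Proof.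
move=> /smap_cont cs du; apply: nearS (near_dom cs du) => v dv.
by rewrite coordK.
Qed.

Lemma smap_param E c (x : E -> 'rV[R]_n) u : cim c (x u) -> sm x u ->
  smap (fun v => param c (x v)) u.
Proof.
move=> cx sx; split=> [|d dd].
  have H : \near u, sm x u /\ cim c (x u).
    by apply: nearI; [exact: sm_near|apply: (sm_near_im sx); exact: near_cim].
  apply: nearS H => v [/sm_cont cv cxv].
  apply: (@continuous_comp _ _ _ x (param c)); first exact: cv.
  exact: param_continuous.
apply: (@sm_comp _ _ _ _ (fun x => coord d (param c x)) x) => //.
by rewrite -(paramK cx); apply: transition_sm => //; exact: dom_param.
Qed.

Lemma near_near E (u : E) (P : E -> Prop) :
  (\near u, P u) -> \near u, \near u, P u.
Proof.
move=> /near_open_nbhs[U [oU Uu] H]; apply: nearS (open_nbhs_nbhs (conj oU Uu)) => v Uv.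
by apply: nearS (open_nbhs_nbhs (conj oU Uv)) => w; exact: H.
Qed.

Lemma smap_ext E (s s' : E -> M) u : (\near u, s u = s' u) -> smap s u -> smap s' u.
Proof.
move=> H [cs ss]; have su := nbhs_singleton H; split=> [|c dc].
  apply: nearS (nearI cs (near_near H)) => v [cv Hv].
  have sv := nbhs_singleton Hv; suff : s' @ v --> s v by rewrite sv.
  by apply: cvg_trans cv; apply: near_eq_cvg; exact: Hv.
apply: (@sm_ext _ _ _ (fun v => coord c (s v))).
  by apply: nearS H => v ->.
by apply: ss; rewrite su.
Qed.

Lemma smap_near E (s : E -> M) u : smap s u -> \near u, smap s u.
Proof.
move=> ss; have cu := chart_atP (s u); set c := chart_at (s u) in cu.
have sc := smap_coord ss cu; have E1 := smap_near_param ss cu.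
have H : \near u, sm (fun v => coord c (s v)) u /\ dom c (s u).
  by apply: nearI; [exact: sm_near|apply: near_dom => //; exact: smap_cont].
apply: nearS (nearI H (near_near E1)) => v [[sv dv] Ev].
apply: (@smap_ext _ (fun v => param c (coord c (s v)))).
  by apply: nearS Ev => w <-.
by apply: smap_param => //; exact: cim_coord.
Qed.

Lemma smap_comp E F (s : F -> M) (g : E -> F) u : findim F -> sm g u ->
  smap s (g u) -> smap (fun v => s (g v)) u.
Proof.
move=> fF sg [cs ss]; split=> [|c dc].
  apply: nearS (nearI (sm_near sg) (sm_near_im sg cs)) => v [/sm_cont gv sv].
  by apply: (@continuous_comp _ _ _ g s); [exact: gv|exact: sv].
by apply: (@sm_comp _ _ _ _ (fun w => coord c (s w)) g) => //; exact: ss.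
Qed.

Lemma smooth_mapP E (U : set E) (s : E -> M) : open U ->
  smooth_map U s <-> forall u, U u -> smap s u.
Proof.
move=> oU; split=> [[cs ss] u Uu|H].
  have nU v : U v -> \near v, U v by move=> Uv; exact: open_nbhs_nbhs.
  split=> [|c dc]; first by apply: nearS (nU u Uu) => v; exact: cs.
  exists (U `&` s @^-1` dom c); last exact: ss.
  split=> //; rewrite openE => v [Uv dv]; apply: filterI; first exact: nU.
  exact: near_dom (cs v Uv) dv.
have cs u : U u -> {for u, continuous s} by move=> /H/smap_cont.
split=> // c; apply/Cinf_sm => [|u [Uu dc]]; last exact: smap_coord (H u Uu) dc.
rewrite openE => v [Uv dv]; apply: filterI; first exact: open_nbhs_nbhs.
exact: near_dom (cs v Uv) dv.
Qed.

Lemma near_transition E (s : E -> M) u c d : {for u, continuous s} ->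
  dom c (s u) -> \near u, coord d (s u) = coord d (param c (coord c (s u))).
Proof.
by move=> cs dc; apply: nearS (near_dom cs dc) => v dv; rewrite coordK.
Qed.

Lemma D_chart E (s : E -> M) u v c d : smap s u -> dom c (s u) -> dom d (s u) ->
  'D_v (fun w => coord d (s w)) u =
  dtrans c d (s u) ('D_v (fun w => coord c (s w)) u).
Proof.
move=> ss dc dd.
rewrite (D_ext _ (near_transition d (smap_cont ss) dc)).
apply: (@D_comp _ _ _ _ (fun x => coord d (param c x)) (fun w => coord c (s w))).
  exact/sm_diff/smap_coord.
exact/sm_diff/transition_sm.
Qed.

Lemma velE c (g : R -> M) t : vel c g t = 'D_1 (fun u => coord c (g u)) t.
Proof. exact: derive1E. Qed.

Lemma vel_chart (g : R -> M) t c d : smap g t -> dom c (g t) -> dom d (g t) ->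
  vel d g t = dtrans c d (g t) (vel c g t).
Proof. by move=> *; rewrite !velE; exact: D_chart. Qed.

Lemma dtrans_lin c d p : dom c p -> dom d p ->
  forall (k : R) v w, dtrans c d p (k *: v + w) = k *: dtrans c d p v + dtrans c d p w.
Proof.
move=> dc dd k v w; have df := sm_diff (transition_sm dc dd).
by rewrite /dtrans D_add_dir // D_scale_dir.
Qed.

Lemma dtrans_sub c d p v w : dom c p -> dom d p ->
  dtrans c d p (v - w) = dtrans c d p v - dtrans c d p w.
Proof. by move=> dc dd; apply: D_sub_dir; exact/sm_diff/transition_sm. Qed.

Lemma dtransZ c d p (k : R) v : dom c p -> dom d p ->
  dtrans c d p (k *: v) = k *: dtrans c d p v.
Proof. by move=> dc dd; apply: D_scale_dir; exact/sm_diff/transition_sm. Qed.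

Lemma dtransK c d p v : dom c p -> dom d p ->
  dtrans d c p (dtrans c d p v) = v.
Proof.
move=> dc dd; rewrite /dtrans -{1}(coordK dc).
rewrite -(@D_comp _ _ _ _ (fun x => coord c (param d x)) (fun x => coord d (param c x))).
- rewrite (@D_ext _ _ _ _ (fun x => x)) ?derive_id //.
  have sp : smap (fun x => param c x) (coord c p).
    by apply: (@smap_param _ c (fun x => x)); [exact: cim_coord|exact: sm_id].
  have := near_dom (c := d) (smap_cont sp); rewrite coordK // => /(_ dd) nd.
  apply: nearS (nearI nd (near_cim (cim_coord dc))) => x [dx cx].
  by rewrite coordK // paramK.
- exact/sm_diff/transition_sm.
- by rewrite /= coordK //; exact/sm_diff/transition_sm.
Qed.

Lemma dtrans0 c d p v : dom c p -> dom d p -> (dtrans c d p v == 0) = (v == 0).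
Proof.
move=> dc dd; apply/eqP/eqP => [H|->]; last exact: derive0.
by rewrite -(dtransK v dc dd) H /dtrans derive0.
Qed.

End Charts.

Lemma near_neq0 (R : realType) (E : normedModType R) (w : E) : w != 0 ->
  \near w, w != 0.
Proof. by move=> w0; apply: (@cvgr_neq0 R E E (nbhs w) _ id w) => //; exact: cvg_id. Qed.

(** The common ground of [F1], [Ft] and the Riemannian norm [alpha], for which it is checked in
    [alpha_metric]. *)
Definition metric (R : realType) n (M : manifold R n)
    (F : chart M -> 'rV[R]_n * 'rV[R]_n -> R) : Prop :=
  [/\ forall c x y, cim c x -> y != 0 -> sm (F c) (x, y),
      forall c x y, cim c x -> y != 0 -> 0 < F c (x, y),
      forall c x y (k : R), cim c x -> 0 <= k -> F c (x, k *: y) = k * F c (x, y) &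
      forall c d p y, dom c p -> dom d p ->
        F d (coord d p, dtrans c d p y) = F c (coord c p, y)].

Section Metrics.
Context {R : realType} {n : nat} {M : manifold R n}.
Implicit Types (F : chart M -> 'rV[R]_n * 'rV[R]_n -> R) (c d : chart M).

Lemma finsler_metric F : finsler F -> metric F.
Proof.
move=> [H1 H2 H3 _ H5]; split=> [c x y cx y0||c x y k cx|c d p y dc dd].
- have o : open [set z : 'rV[R]_n * 'rV[R]_n | cim c z.1 /\ z.2 != 0].
    rewrite openE => z [cz z0]; apply: filterI.
      by apply: (@continuous_fst _ _ _ z); exact: near_cim.
    exact: (@continuous_snd _ _ _ z _ (near_neq0 z0)).
  by apply: ((Cinf_sm _ o).1 (H1 c)).
- by move=> c x y cx; exact: H2.
- by move=> k0; exact: H3.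
- exact: H5.
Qed.

Lemma metric0 F c x : metric F -> cim c x -> F c (x, 0) = 0.
Proof. by move=> [_ _ H _] cx; have := H c x 0 0 cx (lexx _); rewrite scale0r mul0r. Qed.

Lemma metric_ge0 F c x y : metric F -> cim c x -> 0 <= F c (x, y).
Proof.
move=> mF cx; have [->|y0] := eqVneq y 0; first by rewrite metric0.
by case: mF => _ P _ _; rewrite ltW // P.
Qed.

Lemma speedE F (g : R -> M) t c : metric F -> smap g t -> dom c (g t) ->
  speed F g t = F c (coord c (g t), vel c g t).
Proof.
move=> [_ _ _ T] sg dc; have da := chart_atP (g t).
by rewrite /speed (vel_chart sg dc da) T.
Qed.

Lemma smooth_fun_sm (f : M -> R) c x : smooth_fun f -> cim c x ->
  sm (fun x => f (param c x)) x.
Proof. by move=> sf cx; exists (cim c); [split=> //; exact: cim_open|exact: sf]. Qed.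

Lemma vector_field_sm (X : chart M -> 'rV[R]_n -> 'rV[R]_n) c x : vector_field X ->
  cim c x -> sm (X c) x.
Proof. by move=> [sX _] cx; exists (cim c); [split=> //; exact: cim_open|exact: sX]. Qed.

Lemma smooth_fun_smap (f : M -> R) (E : normedModType R) (s : E -> M) u : smooth_fun f -> smap s u ->
  sm (fun v => f (s v)) u.
Proof.
move=> sf ss; have dc := chart_atP (s u); set c := chart_at (s u) in dc.
apply: (@sm_ext _ _ _ (fun v => f (param c (coord c (s v))))).
  by apply: nearS (smap_near_param ss dc) => v <-.
apply: (@sm_comp _ _ _ _ (fun x => f (param c x)) (fun v => coord c (s v))) => //.
  exact: smap_coord.
by apply: smooth_fun_sm => //; exact: cim_coord.
Qed.

Lemma D_smooth_fun (f : M -> R) (E : normedModType R) (s : E -> M) u v c :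
  smooth_fun f -> smap s u -> dom c (s u) ->
  'D_v (fun w => f (s w)) u =
  'D_('D_v (fun w => coord c (s w)) u) (fun x => f (param c x)) (coord c (s u)).
Proof.
move=> sf ss dc.
have E1 : \near u, f (s u) = f (param c (coord c (s u))).
  by apply: nearS (smap_near_param ss dc) => w <-.
rewrite (D_ext _ E1).
apply: (@D_comp _ _ _ _ (fun x => f (param c x)) (fun w => coord c (s w))).
  exact/sm_diff/smap_coord.
by apply/sm_diff/smooth_fun_sm => //; exact: cim_coord.
Qed.

End Metrics.

(** * Transport along the flow of a Killing field *)

Section Components.
Context {R : realType}.

Lemma D_coord (E : normedModType R) m n (f : E -> 'M[R]_(m, n)) i j x v :
  differentiable f x -> 'D_v (fun y => f y i j) x = ('D_v f x) i j.
Proof.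
move=> df.
have cc : continuous (mx_coord i j : 'M[R]_(m, n) -> R^o) by exact: mx_coord_continuous.
exact: (@D_clin_comp _ _ _ R^o (mx_coord i j) f x v cc df).
Qed.

Lemma D_partial n (f : 'rV[R]_n -> R) x v : differentiable f x ->
  'D_v f x = \sum_k v 0 k * partial k f x.
Proof.
move=> df; rewrite {1}(row_sum_delta v).
exact: (D_sum_dir (fun k => v 0 k) (fun k => delta_mx 0 k) df).
Qed.

Lemma formE n (A : 'M[R]_n) (v w : 'rV[R]_n) :
  (v *m A *m w^T) 0 0 = \sum_i \sum_j v 0 i * A i j * w 0 j.
Proof.
rewrite mxE exchange_big; apply: eq_bigr => j _ /=.
by rewrite !mxE mulr_suml.
Qed.

(** For values in an arbitrary type, connectedness of the interval is brought back to a real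
    function: the indicator of [k u <> k a] has derivative zero. *)
Lemma locally_constant (T : Type) (I : set R) (k : R -> T) : is_interval I ->
  (forall t, I t -> \forall u \near t, k u = k t) ->
  forall a b, I a -> I b -> k a = k b.
Proof.
move=> iI H a b Ia Ib; apply: contrapT => kab.
pose g u : R := if `[<k u = k a>] then 0 else 1.
have : g a = g b.
  apply: (derive0_constant iI) => // t It.
  apply: (@near_eq_is_derive R R R (fun _ : R => g t)).
  by apply: nearS (H t It) => u; rewrite /g => ->.
rewrite /g asboolT // asboolF; last by move=> kba; apply: kab.
by move/eqP; rewrite eq_sym oner_eq0.
Qed.

Lemma D_const_near m n (y : R -> 'M[R]_(m, n)) t :
  (\near t, differentiable y t /\ 'D_1 y t = 0) -> \forall u \near t, y u = y t.
Proof.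
move=> /nbhs_ballP[d /= d0 H]; apply/nbhs_ballP; exists d => //= u tu.
have tt : ball t d t by exact: ballxx.
apply/matrixP => i j; apply: (@derive0_constant _ (ball t d) (fun u => y u i j)) => //.
  by move=> a b /=; rewrite !ball_itv /=; exact: interval_is_interval.
move=> s /H[dy Dy]; apply: DeriveDef.
  by apply: diff_derivable; apply: (@differentiable_comp _ _ _ _ y (fun A => A i j)) => //; exact: differentiable_coord.
by rewrite D_coord // Dy mxE.
Qed.

End Components.

(** Lie transport along an integral curve of [W]: the field solves the linearization of the equation
    of the flow. It is given by its components in every chart. *)
Definition transported (R : realType) n (M : manifold R n)
    (W : chart M -> 'rV[R]_n -> 'rV[R]_n) (I : set R) (X : R -> M)
    (eta : chart M -> R -> 'rV[R]_n) : Prop :=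
  (forall t c d, I t -> dom c (X t) -> dom d (X t) ->
     eta d t = dtrans c d (X t) (eta c t)) /\
  (forall t c, I t -> dom c (X t) -> sm (eta c) t /\
     'D_1 (eta c) t = 'D_(eta c t) (W c) (coord c (X t))).

Section Transport.
Context {R : realType} {n : nat} {M : manifold R n}.
Variables (h : chart M -> 'rV[R]_n -> 'M[R]_n) (W : chart M -> 'rV[R]_n -> 'rV[R]_n).
Hypotheses (hh : riemannian h) (hW : vector_field W) (hK : killing h W).
Implicit Types (c d : chart M).

Definition hform c (x v w : 'rV[R]_n) : R := (v *m h c x *m w^T) 0 0.

Lemma h_sm c x i j : cim c x -> sm (fun x => h c x i j) x.
Proof.
by case: hh => H _ _ _ cx; exists (cim c); [split=> //; exact: cim_open|exact: H].
Qed.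

(** The Killing equation contracted twice with [v], in the shape taken by the derivative of
    [h (eta, eta)] along a transported field. *)
Lemma killing_D c (x : 'rV[R]_n) (v : 'rV[R]_n) : cim c x ->
  \sum_i \sum_j (('D_v (W c) x) 0 i * h c x i j * v 0 j
     + v 0 i * 'D_(W c x) (fun z => h c z i j) x * v 0 j
     + v 0 i * h c x i j * ('D_v (W c) x) 0 j) = 0.
Proof.
move=> cx; have sW := vector_field_sm hW cx.
have dW k : differentiable (fun z => W c z 0 k) x by apply/sm_diff/sm_coord.
have DW k : ('D_v (W c) x) 0 k = \sum_i v 0 i * partial i (fun z => W c z 0 k) x.
  by rewrite -D_partial // D_coord //; exact: sm_diff.
have Dh i j : 'D_(W c x) (fun z => h c z i j) x =
    \sum_k W c x 0 k * partial k (fun z => h c z i j) x.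
  by rewrite D_partial //; apply/sm_diff/h_sm.
transitivity (\sum_i \sum_j v 0 i * v 0 j * \sum_k (W c x 0 k * partial k (fun z => h c z i j) x
          + h c x k j * partial i (fun z => W c z 0 k) x
          + h c x i k * partial j (fun z => W c z 0 k) x)); last first.
  by apply: big1 => i _; apply: big1 => j _; rewrite hK // mulr0.
pose A i j := \sum_k v 0 i * v 0 j * (W c x 0 k * partial k (fun z => h c z i j) x).
pose B i j := \sum_k v 0 i * v 0 j * (h c x k j * partial i (fun z => W c z 0 k) x).
pose C i j := \sum_k v 0 i * v 0 j * (h c x i k * partial j (fun z => W c z 0 k) x).
transitivity (\sum_i \sum_j (B i j + A i j + C i j)); last first.
  apply: eq_bigr => i _; apply: eq_bigr => j _; rewrite mulr_sumr -!big_split /=.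
  by apply: eq_bigr => k _; ring.
under eq_bigr => i _ do rewrite !big_split /=.
under [RHS]eq_bigr => i _ do rewrite !big_split /=.
rewrite !big_split /=; congr (_ + _ + _).
- rewrite exchange_big [RHS]exchange_big; apply: eq_bigr => j _ /=.
  transitivity (\sum_i \sum_k v 0 k * partial k (fun z => W c z 0 i) x * h c x i j * v 0 j).
    by apply: eq_bigr => i _; rewrite DW !mulr_suml.
  rewrite exchange_big; apply: eq_bigr => i _; apply: eq_bigr => k _ /=; ring.
- apply: eq_bigr => i _; apply: eq_bigr => j _; rewrite Dh /A mulr_sumr mulr_suml.
  by apply: eq_bigr => k _; ring.
- apply: eq_bigr => i _ /=.
  transitivity (\sum_j \sum_k v 0 i * h c x i j * (v 0 k * partial k (fun z => W c z 0 j) x)).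
    by apply: eq_bigr => j _; rewrite DW mulr_sumr.
  rewrite exchange_big; apply: eq_bigr => j _; apply: eq_bigr => k _ /=; ring.
Qed.

Lemma hform_chart c d p v w : dom c p -> dom d p ->
  hform d (coord d p) (dtrans c d p v) (dtrans c d p w) = hform c (coord c p) v w.
Proof. by case: hh => _ _ _ H dc dd; exact: H. Qed.

(** The derivative of the squared length is the expression in [killing_D]. Since [h] is definite, a
    transported field that vanishes at one time vanishes at all times: uniqueness for the linearized
    equation. *)
Lemma transported_hform I X eta : open_itv I -> integral_curve W I X ->
  transported W I X eta -> forall a b c d, I a -> I b -> dom c (X a) -> dom d (X b) ->
  hform c (coord c (X a)) (eta c a) (eta c a) = hform d (coord d (X b)) (eta d b) (eta d b).
Proof.
move=> [oI iI] [/(smooth_mapP _ oI) sX vX] [T1 T2] a b c d Ia Ib ca db.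
(* Each point is read in its own chart here; chart invariance of [h] lets one fixed chart be used
   near a given time, where [q] is differentiated. *)
pose q t := hform (chart_at (X t)) (coord (chart_at (X t)) (X t))
  (eta (chart_at (X t)) t) (eta (chart_at (X t)) t).
have qE t c' : I t -> dom c' (X t) ->
    q t = hform c' (coord c' (X t)) (eta c' t) (eta c' t).
  move=> It ct; have dt := chart_atP (X t).
  by rewrite /q (T1 t c' _ It ct dt) hform_chart.
rewrite -qE // -qE //.
apply: (derive0_constant iI) => // t It.
have {c d ca db} := chart_atP (X t); set c := chart_at (X t) => ct.
have qEn : \forall u \near t,
    \sum_i \sum_j eta c u 0 i * h c (coord c (X u)) i j * eta c u 0 j = q u.
  have nI : nbhs t I by exact: open_nbhs_nbhs.
  apply: nearS (nearI nI (near_dom (smap_cont (sX t It)) ct)) => u [Iu cu].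
  by rewrite (qE u c) // /hform formE.
apply: (near_eq_is_derive qEn).
have [se De] := T2 t c It ct.
have sx := smap_coord (sX t It) ct.
have Dx : 'D_1 (fun u => coord c (X u)) t = W c (coord c (X t)) by rewrite -velE vX.
have cx := cim_coord ct.
have sei i : sm (fun u => eta c u 0 i) t by exact: sm_coord.
have shij i j : sm (fun u => h c (coord c (X u)) i j) t.
  by apply: (@sm_comp _ _ _ _ (fun x => h c x i j) (fun u => coord c (X u))) => //; exact: h_sm.
have Dh i j : 'D_1 (fun u => h c (coord c (X u)) i j) t =
    'D_(W c (coord c (X t))) (fun x => h c x i j) (coord c (X t)).
  rewrite -Dx; apply: (@D_comp _ _ _ _ (fun x => h c x i j) (fun u => coord c (X u))).
    exact: sm_diff.
  exact/sm_diff/h_sm.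
have sprod i j : sm (fun u => eta c u 0 i * h c (coord c (X u)) i j * eta c u 0 j) t.
  by do 2 ?apply: sm_mul.
apply: DeriveDef.
  by apply/diff_derivable/sm_diff/sm_sum => i; apply: sm_sum => j.
rewrite D_sum; last by move=> i; apply/sm_diff/sm_sum => j.
apply: (etrans _ (killing_D (eta c t) cx)); apply: eq_bigr => i _.
rewrite D_sum; last by move=> j; apply/sm_diff.
apply: eq_bigr => j _.
rewrite D_mul; [|by apply/sm_diff/sm_mul|exact/sm_diff].
rewrite D_mul; [|exact/sm_diff|exact/sm_diff].
by rewrite Dh (D_coord _ i _ (sm_diff se)) (D_coord _ j _ (sm_diff se)) De; ring.
Qed.

Lemma transported_sub I X eta1 eta2 : integral_curve W I X -> open I ->
  transported W I X eta1 ->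
  transported W I X eta2 -> transported W I X (fun c t => eta1 c t - eta2 c t).
Proof.
move=> [+ _] oI [T1 T2] [T3 T4]; move/(smooth_mapP _ oI) => sX; split.
- move=> t c d It ct dt; rewrite (T1 t c d) // (T3 t c d) //.
  exact/esym/dtrans_sub.
- move=> t c It ct; have [s1 D1] := T2 t c It ct; have [s2 D2] := T4 t c It ct.
  split; first exact: sm_sub.
  have cx := cim_coord ct.
  rewrite D_sub_dir; last exact/sm_diff/vector_field_sm.
  by rewrite -D1 -D2 [LHS]deriveB //; exact/diff_derivable/sm_diff.
Qed.

(** For the restriction of a field to the curve, the linearized equation is the vanishing of the
    bracket with [W]. *)
Lemma transported_field I X (V : chart M -> 'rV[R]_n -> 'rV[R]_n) :
  open I -> integral_curve W I X -> vector_field V ->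
  (forall c x, cim c x -> 'D_(W c x) (V c) x = 'D_(V c x) (W c) x) ->
  transported W I X (fun c t => V c (coord c (X t))).
Proof.
move=> oI [+ vX] vV br; move/(smooth_mapP _ oI) => sX; split.
  by move=> t c d It ct dt; case: vV => _; apply.
move=> t c It ct; have sx := smap_coord (sX t It) ct; have cx := cim_coord ct.
have sV := vector_field_sm vV cx.
split; first exact: (@sm_comp _ _ _ _ (V c) (fun u => coord c (X u))).
rewrite (@D_comp _ _ _ _ (V c) (fun u => coord c (X u))); [|exact: sm_diff|exact: sm_diff].
by rewrite -velE vX // br.
Qed.

End Transport.

(* Neither maximality nor the semigroup law is recorded, so that the notion is
   stable under reversing time and [U]. *)
Record local_flow (R : realType) n (M : manifold R n)
    (U : chart M -> 'rV[R]_n -> 'rV[R]_n) (D : set (R * M)) (psi : R -> M -> M)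
    : Prop := LocalFlow {
  lflow_open : forall (c : chart M) t x, cim c x -> D (t, param c x) ->
    \forall z \near (t, x), cim c z.2 /\ D (z.1, param c z.2);
  lflow_smooth : forall (c : chart M) t x, cim c x -> D (t, param c x) ->
    smap (fun z : R * 'rV[R]_n => psi z.1 (param c z.2)) (t, x);
  lflow_ode : forall (c d : chart M) t x, cim c x -> D (t, param c x) ->
    dom d (psi t (param c x)) ->
    'D_(1, 0) (fun z : R * 'rV[R]_n => coord d (psi z.1 (param c z.2))) (t, x)
    = U d (coord d (psi t (param c x)));
  lflow0 : forall p, D (0, p) /\ psi 0 p = p;
  lflow_inv : forall t p, D (t, p) -> D (- t, psi t p) /\ psi (- t) (psi t p) = p
}.

(** * The flow of a Killing field and its differential *)

Section Flow.
Context {R : realType} {n : nat} {M : manifold R n}.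
Variables (h : chart M -> 'rV[R]_n -> 'M[R]_n) (W : chart M -> 'rV[R]_n -> 'rV[R]_n).
Variables (D : set (R * M)) (phi : R -> M -> M).
Hypotheses (hh : riemannian h) (hW : vector_field W) (hK : killing h W).
Hypothesis (hphi : flow W D phi).
Implicit Types (c d : chart M).

Let fopen c (t : R) x : cim c x -> D (t, param c x) ->
    \forall z \near (t, x), cim c z.2 /\ D (z.1, param c z.2).
Proof.
move=> cx Dx; have [oD _ _ _ _] := hphi.
apply: nearI.
  exact: (@continuous_snd _ R 'rV[R]_n (t, x) _ (near_cim cx)).
have : nbhs (t, param c x) D by exact: open_nbhs_nbhs.
move=> [[A B] /= [At Bx] AB].
have cp : {for (t, x), continuous (fun z : R * 'rV[R]_n => param c z.2)}.
  apply: (@continuous_comp _ _ _ (fun z : R * 'rV[R]_n => z.2) (param c)); first exact: continuous_snd.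
  exact: param_continuous.
apply: nearS (nearI (@continuous_fst _ R 'rV[R]_n (t, x) _ At) (cp _ Bx)) => z [Az Bz].
by apply: AB; split.
Qed.

Let fsmooth c (t : R) x : cim c x -> D (t, param c x) ->
    smap (fun z : R * 'rV[R]_n => phi z.1 (param c z.2)) (t, x).
Proof.
move=> cx Dx; have [_ _ sphi _ _] := hphi.
have o : open [set z : R * 'rV[R]_n | cim c z.2 /\ D (z.1, param c z.2)].
  by rewrite openE => -[s y] [cy Dy]; exact: fopen.
by apply: ((smooth_mapP _ o).1 (sphi c)).
Qed.

Lemma flow_curve x : integral_curve W [set t | D (t, x)] (phi^~ x).
Proof. by case: hphi. Qed.

Lemma flow_itv x : open_itv [set t | D (t, x)].
Proof. by case: hphi => _ H _ _ _; case: (H x). Qed.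

Lemma flow0 x : D (0, x) /\ phi 0 x = x.
Proof. by case: hphi => _ H _ _ _; case: (H x) => _ []. Qed.

Let fode c d (t : R) x : cim c x -> D (t, param c x) ->
    dom d (phi t (param c x)) ->
    'D_(1, 0) (fun z : R * 'rV[R]_n => coord d (phi z.1 (param c z.2))) (t, x)
    = W d (coord d (phi t (param c x))).
Proof.
move=> cx Dx dx; rewrite D_slice1 /= -velE.
by have [_ ->] := flow_curve (param c x).
Qed.

(** The differential of the time-[t] map, from the chart [c] to the chart [d]. *)
Definition push c x (v : 'rV[R]_n) d (t : R) : 'rV[R]_n :=
  'D_v (fun y => coord d (phi t (param c y))) x.

Lemma push_slice c x v d t :
  push c x v d t = 'D_(0, v) (fun z : R * 'rV[R]_n => coord d (phi z.1 (param c z.2))) (t, x).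
Proof. by rewrite D_slice2. Qed.

Lemma flow_space_smap c x t : cim c x -> D (t, param c x) ->
  smap (fun y => phi t (param c y)) x.
Proof.
move=> cx Dx; apply: (@smap_comp _ _ _ _ (R * 'rV[R]_n)%type (fun z : R * 'rV[R]_n => phi z.1 (param c z.2)) (fun y => (t, y))) => //.
  by apply: sm_pair; [exact: sm_cst|exact: sm_id].
exact: fsmooth.
Qed.

(** Exchanging the time and space derivatives ([Schwarz]) turns the equation of the flow into its
    linearization. *)
Lemma transported_push c x v : cim c x ->
  transported W [set t | D (t, param c x)] (phi^~ (param c x)) (push c x v).
Proof.
move=> cx; split.
  move=> t d e Dt dd de.
  by apply: (@D_chart _ _ _ _ (fun y => phi t (param c y))) => //; exact: flow_space_smap.
move=> t d Dt dd.
set Phi := fun z : R * 'rV[R]_n => coord d (phi z.1 (param c z.2)).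
have sPhi : sm Phi (t, x) by apply: smap_coord => //; exact: fsmooth.
have pE : push c x v d = fun s => 'D_(0, v) Phi (s, x).
  by apply/funext => s; exact: push_slice.
have sts : sm (fun s : R => (s, x)) t by apply: sm_pair; [exact: sm_id|exact: sm_cst].
rewrite pE; split.
  apply: (@sm_comp _ _ _ _ (fun z => 'D_(0, v) Phi z) (fun s => (s, x))) => //.
  exact: sm_D.
have -> : 'D_1 (fun s : R => 'D_(0, v) Phi (s, x)) t =
    'D_(1, 0) (fun z => 'D_(0, v) Phi z) (t, x) by rewrite D_slice1.
rewrite (Schwarz _ _ (findim_rV n) sPhi).
have nE : \forall z \near (t, x), 'D_(1, 0) Phi z = W d (Phi z).
  have nd := near_dom (smap_cont (fsmooth cx Dt)) dd.
  apply: nearS (nearI (fopen cx Dt) nd) => -[s y] [[cy Dy] dy].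
  exact: fode.
have sW : sm (W d) (Phi (t, x)) := vector_field_sm hW (cim_coord dd).
rewrite (D_ext _ nE).
exact: (@D_comp _ _ _ _ (W d) Phi _ _ (sm_diff sPhi) (sm_diff sW)).
Qed.

Lemma push0 c x v : cim c x -> push c x v c 0 = v.
Proof.
move=> cx; rewrite /push (@D_ext _ _ _ _ (fun y => y)); first exact: derive_id.
by apply: nearS (near_cim cx) => y cy; rewrite (flow0 _).2 paramK.
Qed.

(** Both sides are transported and agree at time 0, so their difference has constant [h]-length
    zero. *)
Lemma push_field c x d t (V : chart M -> 'rV[R]_n -> 'rV[R]_n) : vector_field V ->
  (forall c x, cim c x -> 'D_(W c x) (V c) x = 'D_(V c x) (W c) x) ->
  cim c x -> D (t, param c x) -> dom d (phi t (param c x)) ->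
  push c x (V c x) d t = V d (coord d (phi t (param c x))).
Proof.
move=> vV br cx Dt dd; have [oI iI] := flow_itv (param c x).
have T1 := transported_push (V c x) cx.
have T2 := transported_field oI (flow_curve (param c x)) vV br.
have T := transported_sub hW (flow_curve (param c x)) oI T1 T2.
have [D0 p0] := flow0 (param c x).
have := transported_hform hh hW hK (flow_itv _) (flow_curve _) T D0 Dt (c := c) (d := d).
rewrite p0 => /(_ (dom_param cx) dd); rewrite paramK // push0 // subrr.
have -> : hform h c x 0 0 = 0 by rewrite /hform !mul0mx mxE.
set z := push _ _ _ _ _ - _ => /esym z0; apply/eqP; rewrite -subr_eq0 -/z.
apply: contraT => zn0; have [_ _ P _] := hh.
by have := P _ _ (cim_coord dd) z zn0; rewrite -/(hform h d _ z z) z0 ltxx.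
Qed.

Lemma locally_constant_map (I : set R) (k : R -> M) : open_itv I ->
  (forall t, I t -> exists c, [/\ dom c (k t), {for t, continuous k} &
     \forall u \near t, differentiable (fun u => coord c (k u)) u /\
        'D_1 (fun u => coord c (k u)) u = 0]) ->
  forall a b, I a -> I b -> k a = k b.
Proof.
move=> [oI iI] H; apply: locally_constant => // t /H[c [ct kt E]].
apply: nearS (nearI (near_dom kt ct) (D_const_near E)) => u [cu Eu].
by rewrite -(coordK cu) Eu coordK.
Qed.

(** The velocity of [phi (- t) (g t)] is [- W] plus the image of [W] under the differential of the
    flow. The two cancel because the flow preserves [W]. *)
Lemma integral_curve_pull I (g : R -> M) : open_itv I -> integral_curve W I g ->
  (forall t, I t -> D (- t, g t)) ->
  forall a b, I a -> I b -> phi (- a) (g a) = phi (- b) (g b).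
Proof.
move=> [oI iI] [/(smooth_mapP _ oI) sg vg] Dg.
apply: (@locally_constant_map I (fun t => phi (- t) (g t))) => // t It.
have dt := chart_atP (phi (- t) (g t)); set d := chart_at _ in dt.
have ct := chart_atP (g t); set c := chart_at (g t) in ct.
have cx := cim_coord ct.
have sx := smap_coord (sg t It) ct.
have Dc : D (- t, param c (coord c (g t))) by rewrite coordK //; exact: Dg.
set Psi := fun z : R * 'rV[R]_n => phi z.1 (param c z.2).
set z := fun u : R => (- u, coord c (g u)).
have sz : sm z t by apply: sm_pair => //; apply: sm_opp; exact: sm_id.
have sk : smap (fun u => Psi (z u)) t by apply: smap_comp => //; exact: fsmooth.
have kE : \near t, Psi (z t) = phi (- t) (g t).
  by apply: nearS (near_dom (smap_cont (sg t It)) ct) => u cu; rewrite /Psi /= coordK.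
have sk' : smap (fun t => phi (- t) (g t)) t by apply: smap_ext sk.
exists d; split => //; first exact: smap_cont.
have nI : nbhs t I by exact: open_nbhs_nbhs.
have nd := near_dom (smap_cont sk') dt.
have nc := near_dom (smap_cont (sg t It)) ct.
have := nearI (nearI nI (near_near kE)) (nearI nd nc).
apply: nearS => u [[Iu kEu] [du cu]].
have Eu : phi (- u) (g u) = Psi (z u) by rewrite (nbhs_singleton kEu).
have Du : D (- u, param c (coord c (g u))) by rewrite coordK //; exact: Dg.
have cxu := cim_coord cu.
have sPu : smap Psi (z u) by exact: fsmooth.
have du' : dom d (Psi (z u)) by rewrite -Eu.
have sxu := smap_coord (sg u Iu) cu.
have szu : sm z u by apply: sm_pair => //; apply: sm_opp; exact: sm_id.
have kEu' : \near u, coord d (phi (- u) (g u)) = coord d (Psi (z u)).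
  by apply: nearS kEu => w ->.
have sdP : sm (fun w => coord d (Psi w)) (z u) by exact: smap_coord.
split.
  apply: (@near_differentiable _ _ _ (fun u => coord d (Psi (z u)))).
    by apply: nearS kEu' => w ->.
  by apply: sm_diff; apply: (@sm_comp _ _ _ _ (fun w => coord d (Psi w)) z).
rewrite (D_ext _ kEu') (@D_comp _ _ _ _ (fun w => coord d (Psi w)) z); [|exact: sm_diff|exact: sm_diff].
have -> : 'D_1 z u = (- 1, 0) + (0, W c (coord c (g u))).
  rewrite D_pair; [|by apply/sm_diff/sm_opp/sm_id|exact: sm_diff].
  rewrite -velE vg // [X in (X, _)](_ : _ = - 1).
    by congr pair; rewrite /= ?addr0 ?add0r.
  by rewrite [LHS]deriveN ?derive_id.
rewrite D_add_dir; last exact: sm_diff.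
have -> : (- 1, 0) = - (1, 0) :> R * 'rV[R]_n by congr pair; rewrite /= ?oppr0.
rewrite D_opp_dir; last exact: sm_diff.
rewrite fode // D_slice2.
have P := push_field hW (fun _ _ _ => erefl) cxu Du du'.
by rewrite /push /= in P; rewrite P addNr.
Qed.

(** Maximality of the flow, applied to the shifted curve [u |-> phi (s + u) x], gives the domain;
    [integral_curve_pull] between the times [t] and 0 gives the value. *)
Lemma flow_inverse t x : D (t, x) -> D (- t, phi t x) /\ phi (- t) (phi t x) = x.
Proof.
move=> Dt; have [oI iI] := flow_itv x.
have Dinv s : D (s, x) -> D (- s, phi s x).
  move=> Ds; pose I := [set u : R | D (s + u, x)].
  have := flow_curve x; move=> [/(smooth_mapP _ oI) sp vp].
  have oI' : open I.
    rewrite openE => u Iu; have nD : nbhs (s + u) [set t | D (t, x)] by exact: open_nbhs_nbhs.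
    have : {for u, continuous (fun u : R => s + u)}.
      by apply: sm_cont; apply: sm_add; [exact: sm_cst|exact: sm_id].
    by move=> /(_ _ nD).
  have aff u : sm (fun u : R => s + u) u by apply: sm_add; [exact: sm_cst|exact: sm_id].
  have [_ _ _ _ max] := hphi.
  have := max I (fun u => phi (s + u) x); rewrite /I /= addr0; apply=> //.
  - split=> // a b Ia Ib y /andP[ay yb]; apply: (iI (s + a) (s + b)) => //.
    by rewrite !lerD2l ay.
  - split.
      apply/smooth_mapP => // u Iu.
      by apply: (@smap_comp _ _ _ _ R (phi^~ x)) => //; exact: sp.
    move=> c u Iu cu; rewrite velE.
    rewrite (@D_comp _ _ _ _ (fun v => coord c (phi v x)) (fun u => s + u)).
    + have -> : 'D_1 (fun u : R => s + u) u = 1 by rewrite [LHS]deriveD // derive_cst derive_id add0r.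
      by rewrite -velE vp.
    + exact: sm_diff.
    + by apply: sm_diff; apply: smap_coord => //; exact: sp.
  - by rewrite subrr; case: (flow0 x).
split; first exact: Dinv.
have := integral_curve_pull (flow_itv x) (flow_curve x) Dinv Dt (flow0 x).1.
by rewrite (flow0 x).2 oppr0 (flow0 x).2.
Qed.

Lemma flow_local : local_flow W D phi.
Proof. by split; [exact: fopen|exact: fsmooth|exact: fode|exact: flow0|exact: flow_inverse]. Qed.

End Flow.

(** * Zermelo metrics *)

Section HForm.
Context {R : realType} {n : nat} {M : manifold R n}.
Variables (h : chart M -> 'rV[R]_n -> 'M[R]_n).
Hypotheses (hh : riemannian h).
Implicit Types (c d : chart M).
Local Notation q := (hform h).

Lemma hformDl c x u v w : q c x (u + v) w = q c x u w + q c x v w.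
Proof. by rewrite /hform !mulmxDl mxE. Qed.

Lemma hformDr c x u v w : q c x w (u + v) = q c x w u + q c x w v.
Proof. by rewrite /hform linearD /= mulmxDr mxE. Qed.

Lemma hformZl c x k v w : q c x (k *: v) w = k * q c x v w.
Proof. by rewrite /hform -!scalemxAl mxE. Qed.

Lemma hformZr c x k v w : q c x w (k *: v) = k * q c x w v.
Proof. by rewrite /hform linearZ /= -scalemxAr mxE. Qed.

Lemma hform_opp c x v : q c x (- v) (- v) = q c x v v.
Proof. by rewrite -scaleN1r hformZl hformZr; ring. Qed.

Lemma hformC c x v w : cim c x -> q c x v w = q c x w v.
Proof.
move=> cx; case: hh => _ S _ _; rewrite /hform.
have {1}-> : v *m h c x *m w^T = (w *m h c x *m v^T)^T.
  by rewrite !trmx_mul trmxK S // mulmxA.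
by rewrite mxE.
Qed.

Lemma hform_ge0 c x v : cim c x -> 0 <= q c x v v.
Proof.
move=> cx; have [->|v0] := eqVneq v 0; first by rewrite /hform !mul0mx mxE.
by case: hh => _ _ P _; rewrite ltW // P.
Qed.

Lemma hform_gt0 c x v : cim c x -> v != 0 -> 0 < q c x v v.
Proof. by move=> cx v0; case: hh => _ _ P _; exact: P. Qed.

Lemma hform_subZ c x y k u : cim c x -> q c x (y - k *: u) (y - k *: u) =
  q c x y y - 2 * k * q c x y u + k ^+ 2 * q c x u u.
Proof.
move=> cx; rewrite -scaleNr hformDl !hformDr !hformZl !hformZr (hformC u y cx).
by ring.
Qed.

Lemma rnormE c x v : rnorm h c (x, v) = Num.sqrt (q c x v v).
Proof. by []. Qed.

End HForm.

Section Zermelo.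
Context {R : realType} {n : nat} {M : manifold R n}.
Variables (h : chart M -> 'rV[R]_n -> 'M[R]_n) (U : chart M -> 'rV[R]_n -> 'rV[R]_n).
Variable (F : chart M -> 'rV[R]_n * 'rV[R]_n -> R).
Hypotheses (hh : riemannian h).
Hypotheses (hU1 : forall c x, cim c x -> rnorm h c (x, U c x) < 1).
Hypothesis (hF : zermelo (rnorm h) U F).
Implicit Types (c d : chart M).
Local Notation q := (hform h).

Lemma zermelo_metric : metric F.
Proof. by case: hF => /finsler_metric. Qed.

Lemma translated_unit (G G' : chart M -> 'rV[R]_n * 'rV[R]_n -> R) c x y u :
  [set y | G' c (x, y) = 1] = [set y + u | y in [set y | G c (x, y) = 1]] ->
  G' c (x, y) = 1 <-> G c (x, y - u) = 1.
Proof.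
move=> E; have -> : (G' c (x, y) = 1) = [set y | G' c (x, y) = 1] y by [].
rewrite E; split=> [[z /= Gz <-]|Gy]; first by rewrite addrK.
by exists (y - u) => //; rewrite subrK.
Qed.

Lemma lambdaE c x : cim c x -> lambda h U c x = 1 - q c x (U c x) (U c x).
Proof. by move=> cx; rewrite /lambda rnormE sqr_sqrtr // hform_ge0. Qed.

Lemma lambda_gt0 c x : cim c x -> 0 < lambda h U c x.
Proof.
move=> cx; rewrite /lambda subr_gt0 -[ltRHS](expr1n _ 2).
by rewrite ltr_pXn2r ?nnegrE ?sqrtr_ge0 // hU1.
Qed.

(** [y / F - U] is an [h]-unit vector; this is [h (y - F U, y - F U) = F ^ 2] expanded. *)
Lemma zermelo_quadratic c x y : cim c x ->
  lambda h U c x * F c (x, y) ^+ 2 + 2 * F c (x, y) * q c x y (U c x) = q c x y y.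
Proof.
move=> cx; have mF := zermelo_metric.
have [->|y0] := eqVneq y 0.
  by rewrite (metric0 mF cx) /hform !mul0mx mxE; ring.
have [_ P H _] := mF; have k0 := P c x y cx y0.
set k := F c (x, y) in k0 *.
have kn0 : k != 0 by rewrite gt_eqF.
have : F c (x, k^-1 *: y) = 1 by rewrite H // ?invr_ge0 ?ltW // mulVf.
rewrite (translated_unit _ (hF.2 c x cx)) rnormE.
have -> : k^-1 *: y - U c x = k^-1 *: (y - k *: U c x).
  by rewrite scalerBr scalerA mulVf // scale1r.
rewrite hformZl hformZr hform_subZ // => /(congr1 (fun a => a ^+ 2)).
rewrite sqr_sqrtr; last first.
  rewrite mulrA mulr_ge0 ?mulr_ge0 ?invr_ge0 ?(ltW k0) //.
  by rewrite -hform_subZ // hform_ge0.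
rewrite expr1n lambdaE // => E.
have {}E : q c x y y - 2 * k * q c x y (U c x) + k ^+ 2 * q c x (U c x) (U c x) = k ^+ 2.
  have fE (S : R) : k ^+ 2 * (k^-1 * (k^-1 * S)) = S by field.
  by rewrite -[LHS]fE E mulr1.
by rewrite mulrBl mul1r; lra.
Qed.

(** Under the root stands [(l k + B) ^ 2], by the quadratic equation; the sign of the base follows
    from [2 k (l k + B) = l k ^ 2 + A]. *)
Lemma zermelo_formula c x y : cim c x -> lambda h U c x * F c (x, y) =
  - q c x y (U c x) + Num.sqrt (q c x y (U c x) ^+ 2 + lambda h U c x * q c x y y).
Proof.
move=> cx; have Q := zermelo_quadratic y cx; have l0 := lambda_gt0 cx.
have F0 := metric_ge0 y zermelo_metric cx.
set l := lambda _ _ _ _ in Q l0 *; set k := F c (x, y) in Q F0 *.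
set B := q c x y (U c x) in Q *; set A := q c x y y in Q *.
have -> : B ^+ 2 + l * A = (l * k + B) ^+ 2 by rewrite -Q; ring.
rewrite sqrtr_sqr ger0_norm ?addrK //; first by ring.
have A0 : 0 <= A by exact: hform_ge0.
have [k0|kp] := eqVneq k 0; first last.
  have k0 : 0 < k by rewrite lt_neqAle eq_sym kp.
  rewrite -(pmulr_rge0 _ k0); nra.
have y0 : y = 0.
  apply: contra_eq k0 => y0; have [_ P _ _] := zermelo_metric.
  by rewrite gt_eqF // P.
by rewrite k0 mulr0 add0r /B y0 /hform !mul0mx mxE.
Qed.

Lemma zermelo_factor c x y (k : R) : cim c x -> y != 0 -> 0 <= k -> exists2 P, 0 < P &
  k ^+ 2 - q c x (y - k *: U c x) (y - k *: U c x) = (k - F c (x, y)) * P.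
Proof.
move=> cx yn0 k0; have Q := zermelo_quadratic y cx; have l0 := lambda_gt0 cx.
have Kp : 0 < F c (x, y) by have [_ P _ _] := zermelo_metric; exact: P.
rewrite hform_subZ //; have := lambdaE cx.
set l := lambda _ _ _ _ in Q l0 *; set K := F c (x, y) in Q Kp *.
set B := q c x y (U c x) in Q *; set A := q c x y y in Q *.
set C := q c x (U c x) (U c x) => lC.
have {}lC : C = 1 - l by rewrite lC; ring.
exists (l * (k + K) + 2 * B); last by rewrite -Q lC; ring.
have Ap : 0 < A by exact: hform_gt0.
rewrite -(pmulr_rgt0 _ Kp); have lkK : 0 <= l * k * K by rewrite !mulr_ge0 // ltW.
by nra.
Qed.

Lemma zermelo_le c x y (k : R) : cim c x -> 0 <= k ->
  F c (x, y) <= k <-> q c x (y - k *: U c x) (y - k *: U c x) <= k ^+ 2.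
Proof.
move=> cx k0; rewrite -subr_ge0 -(subr_ge0 _ (k ^+ 2)).
have [->|yn0] := eqVneq y 0; last first.
  by have [P P0 ->] := zermelo_factor cx yn0 k0; rewrite (pmulr_lge0 _ P0).
have q00 w : q c x 0 w = 0 by rewrite /hform !mul0mx mxE.
rewrite (metric0 zermelo_metric cx) subr0 hform_subZ // !q00.
split=> // _; have := lambda_gt0 cx; rewrite lambdaE // => l0.
have -> : k ^+ 2 - (0 - 2 * k * 0 + k ^+ 2 * q c x (U c x) (U c x)) =
  k ^+ 2 * (1 - q c x (U c x) (U c x)) by ring.
by rewrite mulr_ge0 ?sqr_ge0 // ltW.
Qed.

Lemma zermelo_lt1 c x y : cim c x -> q c x (y - U c x) (y - U c x) < 1 -> F c (x, y) < 1.
Proof.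
move=> cx; have [->|yn0] := eqVneq y 0; first by rewrite (metric0 zermelo_metric cx) ltr01.
have [P P0] := zermelo_factor cx yn0 ler01; rewrite scale1r expr1n => E.
by rewrite -subr_gt0 E (pmulr_lgt0 _ P0) subr_gt0.
Qed.

End Zermelo.

(** * Randers metrics and invariance under the flow *)

Section Randers.
Context {R : realType} {n : nat} {M : manifold R n}.
Implicit Types (c d : chart M) (F : chart M -> 'rV[R]_n * 'rV[R]_n -> R)
  (V W : chart M -> 'rV[R]_n -> 'rV[R]_n) (h : chart M -> 'rV[R]_n -> 'M[R]_n).

Lemma zermelo_add h V W F1 Ft : zermelo (rnorm h) V F1 -> zermelo F1 W Ft ->
  zermelo (rnorm h) (fun c x => V c x + W c x) Ft.
Proof.
move=> [_ H1] [fF H2]; split=> // c x cx; rewrite H2 // H1 //.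
apply/seteqP; split=> [_ /= [_ [y Hy <-] <-]|_ /= [y Hy <-]].
  by exists y => //; rewrite addrA.
by exists (y + V c x); [exists y|rewrite addrA].
Qed.

(** Reversing the wind exchanges the two metrics, which turns every implication about the navigation
    problem into its converse. *)
Lemma zermelo_sub W F1 Ft : finsler F1 ->
  zermelo F1 W Ft -> zermelo Ft (fun c x => - W c x) F1.
Proof.
move=> fF [_ H]; split=> // c x cx; rewrite H //.
apply/seteqP; split=> [y /= Hy|_ /= [_ [y Hy <-] <-]]; last by rewrite addrK.
by exists (y + W c x); [exists y|rewrite addrK].
Qed.

Lemma vector_field_add V W : vector_field V -> vector_field W ->
  vector_field (fun c x => V c x + W c x).
Proof.
move=> vV vW; split=> [c|c d p dc dd].
  by apply: (Cinf_sm _ (@cim_open _ _ _ c)).2 => x cx; apply: sm_add; exact: vector_field_sm.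
rewrite (vV.2 c d p dc dd).
rewrite (vW.2 c d p dc dd).
by have := dtrans_lin dc dd 1 (V c (coord c p)) (W c (coord c p)); rewrite !scale1r.
Qed.

Lemma vector_field_opp W : vector_field W -> vector_field (fun c x => - W c x).
Proof.
move=> vW; split=> [c|c d p dc dd].
  by apply: (Cinf_sm _ (@cim_open _ _ _ c)).2 => x cx; apply: sm_opp; exact: vector_field_sm.
rewrite (vW.2 c d p dc dd).
by have := dtransZ (-1) (W c (coord c p)) dc dd; rewrite !scaleN1r.
Qed.

Lemma star_D V c x p (v w : 'rV[R]_n) : vector_field V -> cim c x ->
  'D_(v, w) (star V c) (x, p) =
  \sum_i (V c x 0 i * w 0 i + ('D_v (V c) x) 0 i * p 0 i).
Proof.
move=> vV cx; have sV := vector_field_sm vV cx.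
have d1 : differentiable (fun z : 'rV[R]_n * 'rV[R]_n => z.1) (x, p) by exact/sm_diff/sm_fst/sm_id.
have d2 : differentiable (fun z : 'rV[R]_n * 'rV[R]_n => z.2) (x, p) by exact/sm_diff/sm_snd/sm_id.
have D1 : 'D_(v, w) (fun z : 'rV[R]_n * 'rV[R]_n => z.1) (x, p) = v.
  by rewrite (@D_clin _ _ _ fst) //; exact: continuous_fst.
have D2 : 'D_(v, w) (fun z : 'rV[R]_n * 'rV[R]_n => z.2) (x, p) = w.
  by rewrite (@D_clin _ _ _ snd) //; exact: continuous_snd.
have s1 i : sm (fun z : 'rV[R]_n * 'rV[R]_n => V c z.1 0 i) (x, p).
  apply: sm_coord; apply: (@sm_comp _ _ _ _ (V c) (fun z => z.1)) => //.
  exact/sm_fst/sm_id.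
have s2 i : sm (fun z : 'rV[R]_n * 'rV[R]_n => z.2 0 i) (x, p).
  by apply: sm_coord; exact/sm_snd/sm_id.
rewrite /star D_sum; last by move=> i; apply/sm_diff/sm_mul.
apply: eq_bigr => i _; rewrite D_mul; [|exact: sm_diff|exact: sm_diff].
rewrite (D_coord _ i _ d2) D2; congr (_ + _ * _).
rewrite (@D_comp _ _ _ _ (fun y => V c y 0 i) (fun z => z.1)) // ?D1.
  by rewrite D_coord //; exact: sm_diff.
by apply/sm_diff/sm_coord.
Qed.

(** The Poisson bracket of two fibre-linear functions is fibre-linear, with the components of
    [[V, W]] as coefficients; the covector [delta_mx 0 i] selects the [i]-th one. *)
Lemma poisson_bracket V W c x : vector_field V -> vector_field W -> cim c x ->
  (forall p, poisson (star V c) (star W c) (x, p) = 0) ->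
  'D_(W c x) (V c) x = 'D_(V c x) (W c) x.
Proof.
move=> vV vW cx H; apply/rowP => i; apply/esym/eqP; rewrite -subr_eq0; apply/eqP.
rewrite -[RHS](H (delta_mx 0 i)) /poisson.
have dV := sm_diff (vector_field_sm vV cx); have dW := sm_diff (vector_field_sm vW cx).
have E (a : 'I_n -> R) : \sum_j (0 + a j * (delta_mx 0 i : 'rV[R]_n) 0 j) = a i.
  rewrite (bigD1 i) //= mxE !eqxx mulr1 add0r big1 ?addr0 // => j ji.
  by rewrite mxE (negbTE ji) andbF mulr0 addr0.
have E0 (a b : 'I_n -> R) : \sum_j (b j * (0 : 'rV[R]_n) 0 j + a j * (delta_mx 0 i : 'rV[R]_n) 0 j) = a i.
  by rewrite -[RHS]E; apply: eq_bigr => j _; rewrite mxE mulr0.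
have E1 (k : 'I_n) (a b : 'I_n -> R) : (forall j, b j = 0) ->
    \sum_j (a j * (delta_mx 0 k : 'rV[R]_n) 0 j + b j * (delta_mx 0 i : 'rV[R]_n) 0 j) = a k.
  move=> b0; rewrite (bigD1 k) //= mxE !eqxx mulr1 b0 mul0r addr0 big1 ?addr0 // => j jk.
  by rewrite mxE (negbTE jk) andbF mulr0 b0 mul0r addr0.
have A1 X k : vector_field X -> 'D_(0, delta_mx 0 k) (star X c) (x, delta_mx 0 i) = X c x 0 k.
  move=> vX; apply: (etrans (star_D _ _ _ vX cx)).
  by apply: (E1 k (fun j => X c x 0 j)) => j; rewrite derive0 mxE.
have A2 X k : vector_field X ->
    'D_(delta_mx 0 k, 0) (star X c) (x, delta_mx 0 i) = ('D_(delta_mx 0 k) (X c) x) 0 i.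
  by move=> vX; apply: (etrans (star_D _ _ _ vX cx)); exact: E0.
have A3 X v : vector_field X ->
    ('D_v (X c) x) 0 i = \sum_k v 0 k * ('D_(delta_mx 0 k) (X c) x) 0 i.
  move=> vX; have dX := sm_diff (vector_field_sm vX cx).
  rewrite {1}(row_sum_delta v) (D_sum_dir (fun k => v 0 k) (fun k => delta_mx 0 k) dX).
  by rewrite summxE; apply: eq_bigr => k _; rewrite mxE.
rewrite (A3 W _ vW) (A3 V _ vV) -sumrB; apply: eq_bigr => k _.
by rewrite (A1 V k vV) (A1 W k vW) (A2 V k vV) (A2 W k vW) [X in _ - X]mulrC.
Qed.

Section Beta.
Variables (h : chart M -> 'rV[R]_n -> 'M[R]_n) (V : chart M -> 'rV[R]_n -> 'rV[R]_n).
Variables (F : chart M -> 'rV[R]_n * 'rV[R]_n -> R) (f : M -> R).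
Hypotheses (hh : riemannian h) (hV : vector_field V).
Hypotheses (hV1 : forall c x, cim c x -> rnorm h c (x, V c x) < 1).
Hypothesis (hF : zermelo (rnorm h) V F).
Hypotheses (hf : smooth_fun f)
  (hdf : forall c x, cim c x -> forall i : 'I_n,
    partial i (f \o param c) x = randers_b h V c x 0 i).
Local Notation alpha := (rnorm (randers_a h V)).

Lemma flat_hform c x (y : 'rV[R]_n) : cim c x ->
  \sum_i flat h V c x 0 i * y 0 i = hform h c x y (V c x).
Proof.
move=> cx; rewrite (hformC hh _ _ cx) /hform /flat [RHS]mxE.
by apply: eq_bigr => i _; congr (_ * _); rewrite mxE.
Qed.

Lemma beta_df c x (y : 'rV[R]_n) : cim c x ->
  'D_y (fun x => f (param c x)) x = - (hform h c x y (V c x) / lambda h V c x).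
Proof.
move=> cx; rewrite D_partial; last exact/sm_diff/smooth_fun_sm.
rewrite -flat_hform // mulr_suml -sumrN; apply: eq_bigr => i _.
by rewrite -[partial _ _ _]/(partial i (f \o param c) x) hdf // mxE; ring.
Qed.

(** Divided by [lambda], the two terms of [zermelo_formula] are [beta], which is [df], and the norm
    of the matrix [randers_a]. *)
Lemma randers_alpha c x y : cim c x ->
  F c (x, y) = alpha c (x, y) + 'D_y (fun x => f (param c x)) x.
Proof.
move=> cx; rewrite beta_df //; have l0 := lambda_gt0 hV1 cx.
have Z := zermelo_formula hh hV1 hF y cx.
have ln0 : lambda h V c x != 0 by rewrite gt_eqF.
have -> : F c (x, y) = (lambda h V c x)^-1 * (lambda h V c x * F c (x, y)).
  by rewrite mulrA mulVf // mul1r.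
rewrite Z mulrDr addrC mulrN [in X in _ - X]mulrC; congr (_ - _).
rewrite -[X in X * _](ger0_norm (x := (lambda h V c x)^-1)) ?invr_ge0 ?ltW //.
rewrite -sqrtr_sqr -sqrtrM ?sqr_ge0 // /rnorm; congr Num.sqrt.
rewrite formE /=.
transitivity ((lambda h V c x)^-1 * hform h c x y y +
   (\sum_i flat h V c x 0 i * y 0 i / lambda h V c x) ^+ 2).
  rewrite -mulr_suml flat_hform //; field.
  exact: ln0.
rewrite /hform formE mulr_sumr expr2 mulr_suml -big_split; apply: eq_bigr => i _ /=.
rewrite !mulr_sumr -big_split; apply: eq_bigr => j _ /=.
by rewrite !mxE /flat; ring.
Qed.

(** Smoothness, homogeneity and chart invariance are inherited through [alpha = F - df]; positivity
    comes from the square root in [zermelo_formula]. *)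
Lemma alpha_metric : metric alpha.
Proof.
have mF := zermelo_metric hF; have [F1 F2 F3 F4] := mF.
have aE c x y : cim c x -> alpha c (x, y) = F c (x, y) - 'D_y (fun x => f (param c x)) x.
  by move=> cx; rewrite randers_alpha // addrK.
have df c x : cim c x -> differentiable (fun x => f (param c x)) x.
  by move=> cx; exact/sm_diff/smooth_fun_sm.
split.
- move=> c x y cx y0.
  apply: (@sm_ext _ _ _ (fun z => F c z - 'D_(z.2) (fun x => f (param c x)) z.1)).
    apply: nearS (@continuous_fst _ _ _ (x, y) _ (near_cim cx)) => -[a b] ca.
    by rewrite aE.
  apply: sm_sub; first exact: F1.
  apply: (@sm_Ddir _ _ _ _ (fun x => f (param c x)) (fun z => z.1) (fun z => z.2)) => //.
  + exact/sm_fst/sm_id.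
  + exact/sm_snd/sm_id.
  + exact: smooth_fun_sm.
- move=> c x y cx y0; rewrite lt_neqAle sqrtr_ge0 andbT eq_sym.
  rewrite aE // beta_df // opprK.
  apply/negP => /eqP E; have l0 := lambda_gt0 hV1 cx.
  have Z := zermelo_formula hh hV1 hF y cx.
  have : lambda h V c x * (F c (x, y) + hform h c x y (V c x) / lambda h V c x) = 0.
    by rewrite E mulr0.
  rewrite mulrDr Z [X in _ + X]mulrC divfK ?gt_eqF // addrC addrA subrr add0r.
  move/eqP; rewrite sqrtr_eq0 leNgt => /negP[].
  by rewrite ltr_wpDl ?sqr_ge0 // mulr_gt0 // hform_gt0.
- move=> c x y k cx k0; rewrite !aE // F3 // D_scale_dir ?mulrBr //; exact: df.
- move=> c d p y dc dd; have cx := cim_coord dc; have cy := cim_coord dd.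
  rewrite !aE // F4 //; congr (_ - _).
  have sp : smap (param c) (coord c p).
    by apply: (@smap_param _ _ _ _ c (fun x => x)) => //; exact: sm_id.
  have dc' : dom c (param c (coord c p)) by rewrite coordK.
  have dd' : dom d (param c (coord c p)) by rewrite coordK.
  have E1 := D_smooth_fun y hf sp dd'.
  by rewrite /= coordK // in E1; rewrite E1.
Qed.

End Beta.

Section Invariance.
Variables (h : chart M -> 'rV[R]_n -> 'M[R]_n) (U W : chart M -> 'rV[R]_n -> 'rV[R]_n).
Variables (F : chart M -> 'rV[R]_n * 'rV[R]_n -> R) (D : set (R * M)) (phi : R -> M -> M).
Hypotheses (hh : riemannian h) (hU : vector_field U) (hW : vector_field W).
Hypotheses (hK : killing h W) (hphi : flow W D phi).
Hypothesis (br : forall c x, cim c x -> 'D_(W c x) (U c) x = 'D_(U c x) (W c) x).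
Hypothesis (hF : zermelo (rnorm h) U F).

(** [y / F - U] is a difference of two transported fields, since [U] commutes with [W]. It remains
    [h]-unit, so indicatrix is carried to indicatrix. *)
Lemma zermelo_push c d x t y : cim c x -> D (t, param c x) ->
  dom d (phi t (param c x)) ->
  F d (coord d (phi t (param c x)), push phi c x y d t) = F c (x, y).
Proof.
move=> cx Dt dd; have mF := zermelo_metric hF.
have cd := cim_coord dd.
have sp := smap_coord (flow_space_smap hphi cx Dt) dd.
have pZ (k : R) v : push phi c x (k *: v) d t = k *: push phi c x v d t.
  by rewrite /push D_scale_dir //; exact: sm_diff.
have [->|y0] := eqVneq y 0.
  by rewrite (metric0 mF cx) /push derive0 (metric0 mF cd).
have [_ P H _] := mF; have k0 := P c x y cx y0.
set k := F c (x, y) in k0 *.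
have kn0 : k != 0 by rewrite gt_eqF.
have : F c (x, k^-1 *: y) = 1 by rewrite H // ?invr_ge0 ?ltW // mulVf.
rewrite (translated_unit _ (hF.2 c x cx)) rnormE.
have [oI iI] := flow_itv hphi (param c x).
have cv := flow_curve hphi (param c x).
have T1 := transported_push hW hphi (k^-1 *: y) cx.
have T2 := transported_field oI cv hU br.
have T := transported_sub hW cv oI T1 T2.
have [D0 p0] := flow0 hphi (param c x).
have := transported_hform hh hW hK (flow_itv hphi _) cv T D0 Dt (c := c) (d := d).
rewrite p0 => /(_ (dom_param cx) dd); rewrite paramK // (push0 hphi) // => ->.
rewrite -rnormE -(translated_unit _ (hF.2 d _ cd)) pZ H ?invr_ge0 ?ltW // => E.
by rewrite -[RHS]mulr1 -E mulrA mulfV // mul1r.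
Qed.

End Invariance.
End Randers.

(** * Extremals of a homogeneous Lagrangian *)

(** The equation is tested on constant vectors [w]: ['D_(0, w) L] is the momentum paired with
    [w]. *)
Definition EL (R : realType) n (L : 'rV[R]_n * 'rV[R]_n -> R) (x : R -> 'rV[R]_n)
    (t : R) : Prop :=
  forall w, 'D_1 (fun u => 'D_(0, w) L (x u, 'D_1 x u)) t
            = 'D_(w, 0) L (x t, 'D_1 x t).

Section EulerLagrange.
Context {R : realType} {n : nat}.
Implicit Types (L : 'rV[R]_n * 'rV[R]_n -> R) (x : R -> 'rV[R]_n).

Lemma D_sm_curve x t : sm x t -> sm (fun u => (x u, 'D_1 x u)) t.
Proof. by move=> sx; apply: sm_pair => //; exact: sm_D. Qed.

Lemma sm_momentum L x t w : sm x t -> sm L (x t, 'D_1 x t) ->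
  sm (fun u => 'D_(0, w) L (x u, 'D_1 x u)) t.
Proof.
move=> sx sL; apply: (@sm_comp _ _ _ _ (fun z => 'D_(0, w) L z) (fun u => (x u, 'D_1 x u))) => //.
  exact: D_sm_curve.
exact: sm_D.
Qed.

Lemma delta_pair (w : 'rV[R]_n) :
  (0, w) = \sum_i w 0 i *: (0, delta_mx 0 i) :> 'rV[R]_n * 'rV[R]_n.
Proof.
rewrite {1}(row_sum_delta w).
elim/big_rec2: _ => // i a b _ <-; congr pair => /=.
by rewrite scaler0 addr0.
Qed.

Lemma delta_pair' (w : 'rV[R]_n) :
  (w, 0) = \sum_i w 0 i *: (delta_mx 0 i, 0) :> 'rV[R]_n * 'rV[R]_n.
Proof.
rewrite {1}(row_sum_delta w).
elim/big_rec2: _ => // i a b _ <-; congr pair => /=.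
by rewrite scaler0 addr0.
Qed.

Lemma EL_basis L x t : sm x t -> sm L (x t, 'D_1 x t) ->
  (forall i, 'D_1 (fun u => 'D_(0, delta_mx 0 i) L (x u, 'D_1 x u)) t
            = 'D_(delta_mx 0 i, 0) L (x t, 'D_1 x t)) -> EL L x t.
Proof.
move=> sx sL H w.
have nL := sm_near_im (D_sm_curve sx) (sm_near sL).
have E : \near t, 'D_(0, w) L (x t, 'D_1 x t) =
    \sum_i w 0 i *: 'D_(0, delta_mx 0 i) L (x t, 'D_1 x t).
  apply: nearS nL => u sLu; rewrite {1}delta_pair.
  exact: (D_sum_dir (fun i => w 0 i) (fun i => (0, delta_mx 0 i)) (sm_diff sLu)).
have sm i : sm (fun u => 'D_(0, delta_mx 0 i) L (x u, 'D_1 x u)) t by exact: sm_momentum.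
rewrite (D_ext _ E) D_sum; last first.
  by move=> i; apply/sm_diff/sm_scale => //; exact: sm_cst.
rewrite delta_pair' (D_sum_dir (fun i => w 0 i) (fun i => (delta_mx 0 i, 0)) (sm_diff sL)).
apply: eq_bigr => i _; rewrite -H.
exact: (D_scale_cst (w 0 i) _ (sm_diff (sm i))).
Qed.

(** Letting the test vector move adds the momentum paired with its derivative, by the Leibniz rule
    [D_Ddir]. *)
Lemma EL_moving L x t (w : R -> 'rV[R]_n) : sm x t -> sm L (x t, 'D_1 x t) ->
  EL L x t -> sm w t ->
  'D_1 (fun u => 'D_(0, w u) L (x u, 'D_1 x u)) t =
  'D_(w t, 'D_1 w t) L (x t, 'D_1 x t).
Proof.
move=> sx sL H sw.
have sz := D_sm_curve sx.
have sW : sm (fun u => (0 : 'rV[R]_n, w u)) t by apply: sm_pair => //; exact: sm_cst.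
rewrite (@D_Ddir _ _ _ _ L (fun u => (x u, 'D_1 x u)) (fun u => (0, w u))) //.
have -> : 'D_1 (fun u => (0 : 'rV[R]_n, w u)) t = (0, 'D_1 w t).
  have d0 : differentiable (fun _ : R => (0 : 'rV[R]_n)) t by exact: differentiable_cst.
  by rewrite (D_pair _ d0 (sm_diff sw)); congr pair; exact: derive_cst.
have -> : 'D_('D_1 (fun u => (x u, 'D_1 x u)) t) (fun z => 'D_(0, w t) L z) (x t, 'D_1 x t)
    = 'D_(w t, 0) L (x t, 'D_1 x t).
  rewrite -H (@D_comp _ _ _ _ (fun z => 'D_(0, w t) L z) (fun u => (x u, 'D_1 x u))) //.
    exact: sm_diff.
  exact/sm_diff/sm_D.
by rewrite [RHS]D_pair_dir 1?addrC //; exact: sm_diff.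
Qed.

(** The first variation formula before integration: [EL_moving] for the variation field, whose time
    derivative is the parameter derivative of the velocity by [Schwarz]. *)
Lemma first_variation L x t (Y : R * R -> 'rV[R]_n) : sm x t ->
  sm L (x t, 'D_1 x t) -> EL L x t -> sm Y (0, t) -> (\near t, Y (0, t) = x t) ->
  'D_1 (fun u => 'D_(0, 'D_(1, 0) Y (0, u)) L (x u, 'D_1 x u)) t =
  'D_(1, 0) (fun z => L (Y z, 'D_(0, 1) Y z)) (0, t).
Proof.
move=> sx sL H sY Yx.
have s0 : sm (fun u : R => (0 : R, u)) t by apply: sm_pair; [exact: sm_cst|exact: sm_id].
have sYe : sm (fun u => 'D_(1, 0) Y (0, u)) t.
  by apply: (@sm_comp _ _ _ _ (fun z => 'D_(1, 0) Y z) (fun u => (0, u))) => //; exact: sm_D.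
rewrite (EL_moving sx sL H sYe).
have xt : Y (0, t) = x t by exact: nbhs_singleton Yx.
have Yt : 'D_(0, 1) Y (0, t) = 'D_1 x t by rewrite D_slice2; exact: D_ext.
have sYt : sm (fun z => 'D_(0, 1) Y z) (0, t) by exact: sm_D.
rewrite (@D_comp _ _ _ _ L (fun z => (Y z, 'D_(0, 1) Y z))); first last.
- by rewrite xt Yt; exact: sm_diff.
- by apply: sm_diff; apply: sm_pair.
rewrite xt Yt (D_pair _ (sm_diff sY) (sm_diff sYt)).
by rewrite (Schwarz _ _ (findim_rV n) sY) D_slice2.
Qed.

End EulerLagrange.

(** * Euler's identity, momenta and conservation of energy *)

Section Homogeneity.
Context {R : realType} {n : nat} {M : manifold R n}.
Variables (F : chart M -> 'rV[R]_n * 'rV[R]_n -> R).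
Hypothesis (mF : metric F).
Implicit Types (c d : chart M) (x y w : 'rV[R]_n).

Lemma metric_sm c x y : cim c x -> y != 0 -> sm (F c) (x, y).
Proof. by case: mF => + _ _ _; apply. Qed.

Lemma metric_pos c x y : cim c x -> y != 0 -> 0 < F c (x, y).
Proof. by case: mF => _ + _ _; apply. Qed.

Lemma metric_hom c x y (k : R) : cim c x -> 0 <= k -> F c (x, k *: y) = k * F c (x, y).
Proof. by case: mF => _ _ + _; apply. Qed.

Lemma metric_neq0 c x y : cim c x -> F c (x, y) != 0 -> y != 0.
Proof. by move=> cx; apply: contra_neq => ->; exact: metric0. Qed.

Lemma sm_slice2 (E F' G : normedModType R) (f : E * F' -> G) a b :
  findim E -> findim F' -> sm f (a, b) -> sm (fun b => f (a, b)) b.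
Proof.
move=> fE fF sf; apply: (@sm_comp _ _ _ _ f (fun b => (a, b))) => //; first exact: findim_prod.
by apply: sm_pair; [exact: sm_cst|exact: sm_id].
Qed.

Lemma sm_slice1 (E F' G : normedModType R) (f : E * F' -> G) a b :
  findim E -> findim F' -> sm f (a, b) -> sm (fun a => f (a, b)) a.
Proof.
move=> fE fF sf; apply: (@sm_comp _ _ _ _ f (fun a => (a, b))) => //; first exact: findim_prod.
by apply: sm_pair; [exact: sm_id|exact: sm_cst].
Qed.

Lemma euler c x y : cim c x -> y != 0 -> 'D_(0, y) (F c) (x, y) = F c (x, y).
Proof.
move=> cx y0; have sF := sm_slice2 (findim_rV n) (findim_rV n) (metric_sm cx y0).
rewrite D_slice2.
have dF : differentiable (fun b => F c (x, b)) (y + 0 *: y).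
  by rewrite scale0r addr0; exact: sm_diff.
have := D_line dF; rewrite scale0r addr0 => -[_ <-].
rewrite (@D_ext _ _ _ _ (fun s : R => (1 + s) * F c (x, y))); last first.
  have : \forall s \near (0 : R), - 1 < s by apply: lt_nbhsr; rewrite ltrN10.
  apply: nearS => s s1; rewrite -metric_hom //; last by lra.
  by rewrite scalerDl scale1r.
have d1 : differentiable (fun s : R => 1 + s) 0.
  by apply: differentiableD => //; exact: differentiable_cst.
have dc : differentiable (fun s : R => F c (x, y)) 0 by exact: differentiable_cst.
rewrite (D_mul _ d1 dc).
have -> : 'D_1 (fun _ : R => F c (x, y)) 0 = 0 by exact: derive_cst.
have -> : 'D_1 (fun s : R => 1 + s) 0 = 1.
  by rewrite [LHS]deriveD // derive_cst derive_id add0r.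
by rewrite mulr0 mul1r add0r.
Qed.

Lemma momentum_hom c x y (k : R) w : cim c x -> y != 0 -> 0 < k ->
  'D_(0, w) (F c) (x, k *: y) = 'D_(0, w) (F c) (x, y).
Proof.
move=> cx y0 k0; rewrite !D_slice2.
have ky0 : k *: y != 0 by rewrite scaler_eq0 negb_or y0 gt_eqF.
have sF := sm_diff (sm_slice2 (findim_rV n) (findim_rV n) (metric_sm cx y0)).
have sF' := sm_diff (sm_slice2 (findim_rV n) (findim_rV n) (metric_sm cx ky0)).
have kn0 : k != 0 by rewrite gt_eqF.
apply: (mulfI kn0).
have dk : differentiable (fun y : 'rV[R]_n => k *: y) y.
  by apply: differentiableZ.
transitivity ('D_w (fun b => F c (x, k *: b)) y).
  rewrite (@D_comp _ _ _ _ (fun b => F c (x, b)) (fun y => k *: y) _ _ dk sF').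
  have -> : 'D_w (fun y : 'rV[R]_n => k *: y) y = k *: w.
    by rewrite D_scale_cst ?derive_id.
  by rewrite D_scale_dir.
rewrite (@D_ext _ _ _ _ (fun b => k *: F c (x, b))); first exact: D_scale_cst.
by apply: nearT => b; rewrite metric_hom // ltW.
Qed.

Lemma position_hom c x y (k : R) w : cim c x -> y != 0 -> 0 < k ->
  'D_(w, 0) (F c) (x, k *: y) = k * 'D_(w, 0) (F c) (x, y).
Proof.
move=> cx y0 k0; rewrite !D_slice1.
have sF := sm_diff (sm_slice1 (findim_rV n) (findim_rV n) (metric_sm cx y0)).
rewrite (@D_ext _ _ _ _ (fun b => k *: F c (b, y))); first exact: D_scale_cst.
by apply: nearS (near_cim cx) => b cb; rewrite metric_hom // ltW.
Qed.

Lemma energy_sm c x y : cim c x -> y != 0 -> sm (energy F c) (x, y).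
Proof.
move=> cx y0; have sF := metric_sm cx y0.
apply: sm_mul; last exact: sm_cst.
apply: (@sm_ext _ _ _ (fun z => F c z * F c z)); last exact: sm_mul.
by apply: nearT => z; rewrite expr2.
Qed.

Lemma D_energy c x y z : cim c x -> y != 0 ->
  'D_z (energy F c) (x, y) = F c (x, y) * 'D_z (F c) (x, y).
Proof.
move=> cx y0; have dF := sm_diff (metric_sm cx y0).
rewrite (@D_ext _ _ _ _ (fun z => (F c z * F c z) * 2^-1)); last first.
  by apply: nearT => u; rewrite /energy expr2.
have dFF : differentiable (fun z => F c z * F c z) (x, y) by exact: differentiableM.
have d2 : differentiable (fun _ : 'rV[R]_n * 'rV[R]_n => 2^-1 : R) (x, y) by exact: differentiable_cst.
rewrite (D_mul _ dFF d2) (D_mul _ dF dF).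
have -> : 'D_z (fun _ : 'rV[R]_n * 'rV[R]_n => 2^-1 : R) (x, y) = 0 by exact: derive_cst.
by field.
Qed.

(** At constant speed [sigma] both sides of the equation for [F ^ 2 / 2] are [sigma] times those for
    [F]. *)
Lemma EL_energy c (x : R -> 'rV[R]_n) t (sigma : R) : sm x t ->
  cim c (x t) -> 'D_1 x t != 0 -> 0 < sigma ->
  (\near t, F c (x t, 'D_1 x t) = sigma) ->
  EL (energy F c) x t <-> EL (F c) x t.
Proof.
move=> sx cx x0 s0 Fs.
have sF := metric_sm cx x0; have sx' := sm_D (1 : R) sx.
have nz : \near t, cim c (x t) /\ 'D_1 x t != 0.
  apply: nearI; first exact: (sm_near_im sx (near_cim cx)).
  exact: (sm_near_im sx' (near_neq0 x0)).
have sn0 : sigma != 0 by rewrite gt_eqF.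
have E w : 'D_1 (fun u => 'D_(0, w) (energy F c) (x u, 'D_1 x u)) t =
    sigma * 'D_1 (fun u => 'D_(0, w) (F c) (x u, 'D_1 x u)) t.
  rewrite (@D_ext _ _ _ _ (fun u => sigma *: 'D_(0, w) (F c) (x u, 'D_1 x u))).
    by apply: D_scale_cst; exact/sm_diff/sm_momentum.
  by apply: nearS (nearI nz Fs) => u [[cu u0] Fu]; rewrite D_energy // Fu.
have Ft := nbhs_singleton Fs.
have E' w : 'D_(w, 0) (energy F c) (x t, 'D_1 x t) =
    sigma * 'D_(w, 0) (F c) (x t, 'D_1 x t) by rewrite D_energy // Ft.
split=> H w; first by apply: (mulfI sn0); rewrite -E -E' (H w).
by rewrite E E' (H w).
Qed.

(** Tested on the velocity itself, the equation reads [(2 e)' = e'] for the energy [e], by Euler's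
    identity; so [e' = 0]. *)
Lemma EL_speed c (x : R -> 'rV[R]_n) t : sm x t -> cim c (x t) -> 'D_1 x t != 0 ->
  EL (energy F c) x t -> 'D_1 (fun u => F c (x u, 'D_1 x u)) t = 0.
Proof.
move=> sx cx x0 H; have sx' := sm_D (1 : R) sx.
have sE := energy_sm cx x0; have sF := metric_sm cx x0.
have sz := D_sm_curve sx.
have nz : \near t, cim c (x t) /\ 'D_1 x t != 0.
  apply: nearI; first exact: (sm_near_im sx (near_cim cx)).
  exact: (sm_near_im sx' (near_neq0 x0)).
have := EL_moving sx sE H sx'.
have dz : 'D_1 (fun u => (x u, 'D_1 x u)) t = ('D_1 x t, 'D_1 (fun u => 'D_1 x u) t).
  exact: (D_pair _ (sm_diff sx) (sm_diff sx')).
rewrite -dz -(@D_comp _ _ _ _ (energy F c) (fun u => (x u, 'D_1 x u)) _ _ (sm_diff sz) (sm_diff sE)).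
set e := fun u => energy F c (x u, 'D_1 x u).
have se : sm e t by exact: (@sm_comp _ _ _ _ (energy F c) (fun u => (x u, 'D_1 x u))).
rewrite (@D_ext _ _ _ _ (fun u => 2 *: e u)); last first.
  apply: nearS nz => u [cu u0]; rewrite D_energy // euler // /e /energy.
  by rewrite -[_ *: _]/(_ * _); field.
rewrite (D_scale_cst 2 _ (sm_diff se)) -[_ *: _]/(_ * _) => e2.
have e0 : 'D_1 e t = 0 by lra.
have : 'D_1 e t = F c (x t, 'D_1 x t) * 'D_1 (fun u => F c (x u, 'D_1 x u)) t.
  rewrite /e (@D_comp _ _ _ _ (energy F c) (fun u => (x u, 'D_1 x u)) _ _ (sm_diff sz) (sm_diff sE)).
  rewrite D_energy //.
  by rewrite (@D_comp _ _ _ _ (F c) (fun u => (x u, 'D_1 x u)) _ _ (sm_diff sz) (sm_diff sF)).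
rewrite e0 => /esym/eqP; rewrite mulf_eq0 gt_eqF ?metric_pos //=.
by move/eqP.
Qed.

End Homogeneity.

Section Geodesics.
Context {R : realType} {n : nat} {M : manifold R n}.
Variables (F : chart M -> 'rV[R]_n * 'rV[R]_n -> R).
Hypothesis (mF : metric F).
Implicit Types (c d : chart M) (g : R -> M).

Definition ccoord c g (t : R) : 'rV[R]_n := coord c (g t).

Lemma vel_ccoord c g : vel c g = fun t => 'D_1 (ccoord c g) t.
Proof. by apply/funext => t; exact: velE. Qed.

Lemma geodesicP (I : set R) g : open I -> geodesic F I g <->
  (forall t, I t -> smap g t) /\
  (forall c t, I t -> dom c (g t) -> 'D_1 (ccoord c g) t != 0 /\
     EL (energy F c) (ccoord c g) t).
Proof.
move=> oI; split=> [[/(smooth_mapP _ oI) sg H]|[sg H]].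
  split=> // c t It ct; have [v0 E] := H c t It ct.
  rewrite vel_ccoord in v0; split=> //.
  apply: EL_basis; first exact: smap_coord (sg t It) ct.
    by apply: energy_sm => //; exact: cim_coord.
  by move=> i; have := E i; rewrite derive1E vel_ccoord.
split; first by apply/smooth_mapP.
move=> c t It ct; have [v0 E] := H c t It ct; rewrite vel_ccoord; split=> // i.
by rewrite derive1E; exact: E.
Qed.

Lemma speed_ccoord g t c : smap g t -> dom c (g t) ->
  speed F g t = F c (ccoord c g t, 'D_1 (ccoord c g) t).
Proof. by move=> sg ct; rewrite (speedE mF sg ct) vel_ccoord. Qed.

Lemma near_speed g t c : smap g t -> dom c (g t) ->
  \near t, speed F g t = F c (ccoord c g t, 'D_1 (ccoord c g) t).
Proof.
move=> sg ct; have := nearI (smap_near sg) (near_dom (smap_cont sg) ct).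
by apply: nearS => u [su cu]; exact: speed_ccoord.
Qed.

Lemma geodesic_speed (I : set R) g : open_itv I -> geodesic F I g ->
  forall a b, I a -> I b -> speed F g a = speed F g b.
Proof.
move=> [oI iI] /(geodesicP _ oI)[sg H]; apply: (derive0_constant iI) => // t It.
have ct := chart_atP (g t); set c := chart_at (g t) in ct.
have [v0 E] := H c t It ct; have sx := smap_coord (sg t It) ct; have cx := cim_coord ct.
have D0 := EL_speed mF sx cx v0 E.
apply: (@near_eq_is_derive _ _ _ (fun u => F c (ccoord c g u, 'D_1 (ccoord c g) u))).
  by apply: nearS (near_speed (sg t It) ct) => u ->.
apply: DeriveDef; last exact: D0.
apply/diff_derivable/sm_diff.
apply: (@sm_comp _ _ _ _ (F c) (fun u => (ccoord c g u, 'D_1 (ccoord c g) u))) => //.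
  exact: D_sm_curve.
exact: metric_sm.
Qed.

Lemma geodesic_speed_gt0 (I : set R) g t : open I -> geodesic F I g -> I t ->
  0 < speed F g t.
Proof.
move=> oI /(geodesicP _ oI)[sg H] It; have ct := chart_atP (g t).
rewrite (speed_ccoord (sg t It) ct); have [v0 _] := H _ t It ct.
by apply: metric_pos => //; exact: cim_coord.
Qed.

(** At unit speed the Euler-Lagrange equation can be written for [F] itself, which is the form in
    which the momenta of two metrics are compared. *)
Lemma unit_geodesicP (I : set R) g : open I -> unit_geodesic F I g <->
  (forall t, I t -> [/\ smap g t, speed F g t = 1 &
     exists2 c, dom c (g t) & forall d, dom d (g t) -> EL (F d) (ccoord d g) t]).
Proof.
move=> oI; split=> [[/(geodesicP _ oI)[sg H] S1] t It|H].
  split; [exact: sg|exact: S1|].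
  exists (chart_at (g t)); [exact: chart_atP|move=> d dt].
  have [v0 E] := H d t It dt.
  have nI : nbhs t I by exact: open_nbhs_nbhs.
  apply: (EL_energy (sigma := 1) mF _ _ v0 _ _).1 => //.
  - exact: smap_coord (sg t It) dt.
  - exact: cim_coord.
  - by apply: nearS (nearI nI (near_speed (sg t It) dt)) => u [Iu <-]; exact: S1.
split; last by move=> t /H[].
apply/geodesicP => //; split=> [t /H[]//|d t It dt].
have [sg S1 [_ _ /(_ d dt) E]] := H t It.
have nI : nbhs t I by exact: open_nbhs_nbhs.
have v0 : 'D_1 (ccoord d g) t != 0.
  apply: (metric_neq0 mF (cim_coord dt)); rewrite -[coord d _]/(ccoord d g t).
  by rewrite -speed_ccoord // S1 oner_eq0.
split=> //; apply: (EL_energy (sigma := 1) mF _ _ v0 _ _).2 => //.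
- exact: smap_coord dt.
- exact: cim_coord.
- by apply: nearS (nearI nI (near_speed sg dt)) => u [Iu <-]; case: (H u Iu).
Qed.

End Geodesics.

(** * Geodesics in a wind *)

Lemma EL_ext (R : realType) n (L : 'rV[R]_n * 'rV[R]_n -> R) (x y : R -> 'rV[R]_n) t :
  (\near t, x t = y t) -> EL L x t -> EL L y t.
Proof.
move=> xy H w.
have xy' : \near t, 'D_1 x t = 'D_1 y t.
  by apply: nearS (near_near xy) => s xys; exact: D_ext.
rewrite -(nbhs_singleton xy) -(nbhs_singleton xy') -(H w); apply: D_ext.
by apply: nearS (nearI xy xy') => s [-> ->].
Qed.

Section LocalFlows.
Context {R : realType} {n : nat} {M : manifold R n}.
Implicit Types (c d : chart M).

(** Paired with [zermelo_sub], it gives the reversed navigation problem. *)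
Lemma local_flow_opp (U : chart M -> 'rV[R]_n -> 'rV[R]_n) (D : set (R * M))
    (psi : R -> M -> M) : local_flow U D psi ->
  local_flow (fun c x => - U c x) [set z | D (- z.1, z.2)] (fun t => psi (- t)).
Proof.
move=> [fo fs fe f0 fi].
have so (t : R) (x : 'rV[R]_n) : sm (fun z : R * 'rV[R]_n => (- z.1, z.2)) (t, x).
  by apply: sm_pair; [apply: sm_opp; exact/sm_fst/sm_id|exact/sm_snd/sm_id].
split.
- move=> c t x cx /= Dx; exact: (sm_near_im (so t x) (fo c (- t) x cx Dx)).
- move=> c t x cx /= Dx.
  exact: (@smap_comp _ _ _ _ (R * 'rV[R]_n)%type (fun z => psi z.1 (param c z.2)) (fun z => (- z.1, z.2)) (t, x) _ (so t x) (fs c (- t) x cx Dx)).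
- move=> c d t x cx /= Dx dx.
  have sP := smap_coord (fs c (- t) x cx Dx) dx.
  rewrite (@D_comp _ _ _ _ (fun z : R * 'rV[R]_n => coord d (psi z.1 (param c z.2)))
    (fun z => (- z.1, z.2)) (t, x) (1, 0) (sm_diff (so t x)) (sm_diff sP)).
  have d1 : differentiable (fun z : R * 'rV[R]_n => - z.1) (t, x) by exact/sm_diff/sm_opp/sm_fst/sm_id.
  have d2 : differentiable (fun z : R * 'rV[R]_n => z.2) (t, x) by exact/sm_diff/sm_snd/sm_id.
  rewrite (D_pair _ d1 d2) !D_slice1.
  have -> : 'D_1 (fun s : R => - s) t = - 1 by rewrite [LHS]deriveN ?derive_id.
  have -> : 'D_1 (fun _ : R => x) t = 0 by exact: derive_cst.
  have -> : (- 1, 0) = - (1, 0) :> R * 'rV[R]_n by congr pair; rewrite /= ?oppr0.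
  by rewrite (D_opp_dir _ (sm_diff sP)) fe.
- by move=> p /=; rewrite oppr0; exact: f0.
- by move=> t p /= /fi; rewrite opprK.
Qed.

End LocalFlows.

Section ZermeloGeodesics.
Context {R : realType} {n : nat} {M : manifold R n}.
Variables (G G' : chart M -> 'rV[R]_n * 'rV[R]_n -> R).
Variables (U : chart M -> 'rV[R]_n -> 'rV[R]_n) (D : set (R * M)) (psi : R -> M -> M).
Hypotheses (mG : metric G) (mG' : metric G') (vU : vector_field U).
Hypothesis (rel : forall c x y, cim c x ->
  G' c (x, y) = 1 <-> G c (x, y - U c x) = 1).
Hypothesis (fl : local_flow U D psi).
Hypothesis (inv : forall c d x t y, cim c x -> D (t, param c x) ->
  dom d (psi t (param c x)) ->
  G d (coord d (psi t (param c x)), push psi c x y d t) = G c (x, y)).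
Implicit Types (c d : chart M) (x y u : 'rV[R]_n).

(** Spread over all [y != 0] by homogeneity, the relation between the indicatrices can be
    differentiated in every direction. *)
Lemma indicatrix_hom c x y : cim c x -> y != 0 ->
  G c (x, y - G' c (x, y) *: U c x) = G' c (x, y).
Proof.
move=> cx y0; have k0 := metric_pos mG' cx y0; set k := G' c (x, y) in k0 *.
have kn0 : k != 0 by rewrite gt_eqF.
have : G' c (x, k^-1 *: y) = 1 by rewrite metric_hom // ?invr_ge0 ?ltW // mulVf.
rewrite rel // => E.
have -> : y - k *: U c x = k *: (k^-1 *: y - U c x).
  by rewrite scalerBr scalerA mulfV // scale1r.
by rewrite metric_hom ?ltW // E mulr1.
Qed.

Lemma U_sm c x : cim c x -> sm (U c) x.
Proof. exact: vector_field_sm. Qed.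

(* Implicit differentiation of [indicatrix_hom] where [G' = 1]. *)
Lemma D_zermelo c x y (a b : 'rV[R]_n) : cim c x -> G' c (x, y) = 1 ->
  let u := y - U c x in
  'D_(a, b) (G' c) (x, y) * (1 + 'D_(0, U c x) (G c) (x, u)) =
  'D_(a, b - 'D_a (U c) x) (G c) (x, u).
Proof.
move=> cx G1 u.
have y0 : y != 0 by apply: (metric_neq0 mG' cx); rewrite G1 oner_eq0.
have Gu : G c (x, u) = 1 by apply/(rel _ cx).
have u0 : u != 0 by apply: (metric_neq0 mG cx); rewrite Gu oner_eq0.
have sG := metric_sm mG cx u0; have sG' := metric_sm mG' cx y0.
have s1 : sm (fun z : 'rV[R]_n * 'rV[R]_n => z.1) (x, y) by exact/sm_fst/sm_id.
have s2 : sm (fun z : 'rV[R]_n * 'rV[R]_n => z.2) (x, y) by exact/sm_snd/sm_id.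
have sU : sm (fun z : 'rV[R]_n * 'rV[R]_n => U c z.1) (x, y).
  by apply: (@sm_comp _ _ _ _ (U c) (fun z => z.1)) => //; exact: U_sm.
have sGU : sm (fun z => G' c z *: U c z.1) (x, y) by exact: sm_scale.
have sm2 : sm (fun z => z.2 - G' c z *: U c z.1) (x, y) by exact: sm_sub.
have sm1 : sm (fun z => (z.1, z.2 - G' c z *: U c z.1)) (x, y) by exact: sm_pair.
have mE : (x, y - G' c (x, y) *: U c x) = (x, u) by rewrite G1 scale1r.
have key : \forall z \near (x, y), G' c z = G c (z.1, z.2 - G' c z *: U c z.1).
  have n1 := sm_near_im s1 (near_cim cx); have n2 := sm_near_im s2 (near_neq0 y0).
  by apply: nearS (nearI n1 n2) => -[a' b'] [/= ca' b0']; rewrite indicatrix_hom.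
have D1 : 'D_(a, b) (fun z : 'rV[R]_n * 'rV[R]_n => z.1) (x, y) = a.
  by apply: (@D_clin _ _ _ fst); exact: continuous_fst.
have D2 : 'D_(a, b) (fun z : 'rV[R]_n * 'rV[R]_n => z.2) (x, y) = b.
  by apply: (@D_clin _ _ _ snd); exact: continuous_snd.
have DU : 'D_(a, b) (fun z : 'rV[R]_n * 'rV[R]_n => U c z.1) (x, y) = 'D_a (U c) x.
  apply: (etrans (@D_comp _ _ _ _ (U c) (fun z : 'rV[R]_n * 'rV[R]_n => z.1) _ _ (sm_diff s1) (sm_diff (U_sm cx)))).
  by rewrite D1.
have E : 'D_(a, b) (G' c) (x, y) =
    'D_(a, b - ('D_a (U c) x + 'D_(a, b) (G' c) (x, y) *: U c x)) (G c) (x, u).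
  rewrite {1}(D_ext (a, b) key).
  have sG1 : sm (G c) (x, y - G' c (x, y) *: U c x) by rewrite mE.
  rewrite (@D_comp _ _ _ _ (G c) (fun z => (z.1, z.2 - G' c z *: U c z.1)) _ _ (sm_diff sm1) (sm_diff sG1)).
  rewrite /= mE; congr ('D_ _ (G c) (x, u)).
  rewrite (D_pair _ (sm_diff s1) (sm_diff sm2)) D1; congr pair.
  rewrite [LHS]deriveB; [|exact/diff_derivable/sm_diff|exact/diff_derivable/sm_diff].
  by rewrite (D_scale _ (sm_diff sG') (sm_diff sU)) G1 scale1r D2 DU.
rewrite mulrDr mulr1 {1}E.
have dG := sm_diff sG.
have -> : (a, b - ('D_a (U c) x + 'D_(a, b) (G' c) (x, y) *: U c x)) =
    (a, b - 'D_a (U c) x) - 'D_(a, b) (G' c) (x, y) *: (0, U c x).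
  by congr pair; rewrite /= ?scaler0 ?subr0 // opprD addrA.
rewrite (D_sub_dir _ _ dG) (D_scale_dir _ _ dG) -[_ *: _]/(_ * _).
by rewrite subrK.
Qed.

(** In the direction [(0, u)] the right side of [D_zermelo] is [G (x, u) = 1] by Euler's identity,
    so neither factor on the left vanishes. *)
Lemma zermelo_denominator c x u : cim c x -> G c (x, u) = 1 ->
  1 + 'D_(0, U c x) (G c) (x, u) != 0.
Proof.
move=> cx Gu.
have G1 : G' c (x, u + U c x) = 1 by apply/(rel _ cx); rewrite addrK.
have := D_zermelo 0 u cx G1; rewrite /= addrK derive0 subr0.
have u0 : u != 0 by apply: (metric_neq0 mG cx); rewrite Gu oner_eq0.
rewrite (euler mG cx u0) Gu => E.
by apply/eqP => m0; move: E; rewrite m0 mulr0 => /eqP; rewrite eq_sym oner_eq0.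
Qed.

(** Derivative at time 0 of the invariance of [G] under the flow: the complete lift of [U] to the
    tangent bundle annihilates [G]. *)
Lemma infinitesimal_invariance c x u : cim c x -> u != 0 ->
  'D_(U c x, 'D_u (U c) x) (G c) (x, u) = 0.
Proof.
move=> cx u0.
have [D0 p0] := lflow0 fl (param c x).
have dc : dom c (psi 0 (param c x)) by rewrite p0; exact: dom_param.
have ss := lflow_smooth fl cx D0.
have sP := smap_coord ss dc.
set Phi := fun z : R * 'rV[R]_n => coord c (psi z.1 (param c z.2)) in sP.
have nfl := lflow_open fl cx D0.
have nd := near_dom (smap_cont ss) dc.
have s0 : sm (fun s : R => (s, x)) 0 by apply: sm_pair; [exact: sm_id|exact: sm_cst].
have s0' y : sm (fun y => (0 : R, y)) y by apply: sm_pair; [exact: sm_cst|exact: sm_id].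
have sPx : sm (fun s => Phi (s, x)) 0 by exact: (@sm_comp _ _ _ _ Phi (fun s => (s, x))).
have sPu : sm (fun s => 'D_(0, u) Phi (s, x)) 0.
  by apply: (@sm_comp _ _ _ _ (fun z => 'D_(0, u) Phi z) (fun s => (s, x))) => //; exact: sm_D.
have P0 y : cim c y -> Phi (0, y) = y.
  by move=> cy; rewrite /Phi /= (lflow0 fl _).2 paramK.
have Pu0 : 'D_(0, u) Phi (0, x) = u.
  rewrite D_slice2 (@D_ext _ _ _ _ (fun y => y)) ?derive_id //.
  by apply: nearS (near_cim cx) => y; exact: P0.
have ode : \forall z \near ((0 : R), x), 'D_(1, 0) Phi z = U c (Phi z).
  apply: nearS (nearI nfl nd) => -[s y] [[cy Dy] dy].
  exact: (lflow_ode fl).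
have D1 : 'D_1 (fun s => Phi (s, x)) 0 = U c x.
  rewrite -D_slice1 (nbhs_singleton ode); congr (U c _).
  by rewrite P0.
have D2 : 'D_1 (fun s => 'D_(0, u) Phi (s, x)) 0 = 'D_u (U c) x.
  rewrite -(@D_slice1 _ _ _ _ (fun z => 'D_(0, u) Phi z)) (Schwarz _ _ (findim_rV n) sP).
  rewrite (D_ext _ ode).
  have sUP : sm (U c) (Phi (0, x)) by rewrite P0 //; exact: U_sm.
  by rewrite (@D_comp _ _ _ _ (U c) Phi _ _ (sm_diff sP) (sm_diff sUP)) Pu0 P0.
have sG := metric_sm mG cx u0.
have sG' : sm (G c) (Phi (0, x), 'D_(0, u) Phi (0, x)) by rewrite Pu0 P0.
have sz : sm (fun s => (Phi (s, x), 'D_(0, u) Phi (s, x))) 0 by exact: sm_pair.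
have := @D_comp _ _ _ _ (G c) (fun s => (Phi (s, x), 'D_(0, u) Phi (s, x))) 0 1 (sm_diff sz) (sm_diff sG').
rewrite (D_pair _ (sm_diff sPx) (sm_diff sPu)) D1 D2 Pu0 P0 // => <-.
rewrite (@D_ext _ _ _ _ (fun _ => G c (x, u))); first exact: derive_cst.
apply: nearS (nearI (sm_near_im s0 nfl) (sm_near_im s0 nd)) => s [[_ Ds] ds].
by rewrite D_slice2; exact: inv.
Qed.

Section Curve.
Variables (rho : R -> M) (t0 : R) (d : chart M).
Hypothesis (geo : \forall t \near t0, [/\ smap rho t, speed G rho t = 1 &
  forall c, dom c (rho t) -> EL (G c) (ccoord c rho) t]).
Hypothesis (D0 : D (t0, rho t0)).
Hypothesis (dd : dom d (psi t0 (rho t0))).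
Let c := chart_at (rho t0).
Let x := ccoord c rho.
Let Phi := fun z : R * 'rV[R]_n => coord d (psi z.1 (param c z.2)).
Let X t := Phi (t, x t).
Let vrho t := 'D_(0, 'D_1 x t) Phi (t, x t).

Let near_good : \forall t \near t0, [/\ dom c (rho t), smap rho t,
  D (t, param c (x t)), dom d (psi t (param c (x t))) & psi t (rho t) = psi t (param c (x t))].
Proof.
have [sr S1 _] := nbhs_singleton geo.
have dc : dom c (rho t0) by exact: chart_atP.
have Dx : D (t0, param c (x t0)) by rewrite /x /ccoord coordK.
have cx := cim_coord dc.
have sx := smap_coord sr dc.
have sz : sm (fun t => (t, x t)) t0 by apply: sm_pair => //; exact: sm_id.
have ss := lflow_smooth fl cx Dx.
have dx : dom d (psi t0 (param c (x t0))) by rewrite /x /ccoord coordK.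
have n1 := sm_near_im sz (lflow_open fl cx Dx).
have n2 := sm_near_im sz (near_dom (smap_cont ss) dx).
apply: nearS (nearI (nearI (smap_near sr) (near_dom (smap_cont sr) dc)) (nearI n1 n2)).
by move=> t [[st ct] [[_ Dt] dt]]; split => //; rewrite /x /ccoord coordK.
Qed.

(** Under these conditions the coordinate expressions [x], [Phi] and [X] describe the curves at time
    [t]. The lemmas assume them near [t], so that their conclusions can be differentiated. *)
Definition good t := [/\ dom c (rho t), smap rho t,
  D (t, param c (x t)), dom d (psi t (param c (x t))) & psi t (rho t) = psi t (param c (x t))]
  /\ (speed G rho t = 1 /\ EL (G c) x t).

Let near_good' : \forall t \near t0, good t.
Proof.
apply: nearS (nearI near_good geo) => t [[ct st Dt dt pt] [_ S1 E]].
by split=> //; split=> //; exact: E.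
Qed.

Section AtGoodTime.
Variable (t : R).
Hypothesis (gt : \near t, good t).

Let g0 : good t := nbhs_singleton gt.

Lemma good_sm : [/\ cim c (x t), sm x t, sm Phi (t, x t) & cim d (X t)].
Proof.
have [[ct st Dt dt pt] _] := g0.
have cx := cim_coord ct.
split=> //; first exact: smap_coord.
  exact: smap_coord (lflow_smooth fl cx Dt) dt.
exact: cim_coord.
Qed.

Lemma good_X : \near t, ccoord d (fun t => psi t (rho t)) t = X t.
Proof. by apply: nearS gt => s [[_ _ _ _ E] _]; rewrite /ccoord E. Qed.

Lemma good_ode : \forall z \near (t, x t), 'D_(1, 0) Phi z = U d (Phi z).
Proof.
have [[ct st Dt dt pt] _] := g0; have [cx _ _ _] := good_sm.
have ss := lflow_smooth fl cx Dt.
apply: nearS (nearI (lflow_open fl cx Dt) (near_dom (smap_cont ss) dt)) => -[s y] [[cy Dy] dy].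
exact: (lflow_ode fl).
Qed.

Lemma good_vel : sm X t /\ 'D_1 X t = vrho t + U d (X t).
Proof.
have [cx sx sP cX] := good_sm.
have sz : sm (fun t => (t, x t)) t by apply: sm_pair => //; exact: sm_id.
split; first exact: (@sm_comp _ _ _ _ Phi (fun t => (t, x t))).
rewrite (@D_comp _ _ _ _ Phi (fun t => (t, x t)) _ _ (sm_diff sz) (sm_diff sP)).
have -> : 'D_1 (fun t => (t, x t)) t = (1, 'D_1 x t).
  have di : differentiable (fun t : R => t) t by [].
  by rewrite (D_pair _ di (sm_diff sx)); congr pair; exact: derive_id.
rewrite (D_pair_dir _ _ (sm_diff sP)) (nbhs_singleton good_ode).
by rewrite addrC.
Qed.

Lemma good_inv y : G d (X t, 'D_(0, y) Phi (t, x t)) = G c (x t, y).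
Proof.
have [[ct st Dt dt pt] _] := g0; have [cx sx sP cX] := good_sm.
by rewrite D_slice2; exact: inv.
Qed.

Lemma good_unit : [/\ G d (X t, vrho t) = 1, vrho t != 0, 'D_1 x t != 0,
  G' d (X t, 'D_1 X t) = 1 & 'D_1 X t != 0].
Proof.
have [[ct st Dt dt pt] [S1 _]] := g0; have [cx sx sP cX] := good_sm.
have [sX EX] := good_vel.
have G1 : G d (X t, vrho t) = 1.
  by rewrite good_inv; apply: (etrans _ S1); exact/esym/(speed_ccoord mG st ct).
have G2 : G' d (X t, 'D_1 X t) = 1 by apply/(rel _ cX); rewrite EX addrK.
split=> //.
- by apply: (metric_neq0 mG cX); rewrite G1 oner_eq0.
- by apply: (metric_neq0 mG cx); rewrite -good_inv G1 oner_eq0.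
- by apply: (metric_neq0 mG' cX); rewrite G2 oner_eq0.
Qed.

(** The flow preserves [G] and its differential is linear in the fibre, so the fibre derivatives of
    [G] correspond at the two points. *)
Lemma good_momentum v : 'D_(0, v) (G c) (x t, 'D_1 x t) =
  'D_(0, 'D_(0, v) Phi (t, x t)) (G d) (X t, vrho t).
Proof.
have [cx sx sP cX] := good_sm; have [G1 v0 x0 _ _] := good_unit.
have sG := metric_sm mG cX v0.
rewrite (D_slice2 (G c)) (D_slice2 (G d)).
rewrite (@D_ext _ _ _ _ (fun y => G d (X t, 'D_(0, y) Phi (t, x t)))); last first.
  by apply: nearT => y; rewrite good_inv.
have lE (y : 'rV[R]_n) : differentiable (fun y => 'D_(0, y) Phi (t, x t)) y /\
    'D_v (fun y => 'D_(0, y) Phi (t, x t)) y = 'D_(0, v) Phi (t, x t).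
  have s1 : sm (fun _ : 'rV[R]_n => (t, x t)) y by exact: sm_cst.
  have s2 : sm (fun y : 'rV[R]_n => (0 : R, y)) y by apply: sm_pair; [exact: sm_cst|exact: sm_id].
  split; first exact/sm_diff/(@sm_Ddir _ _ _ _ Phi (fun=> (t, x t)) (fun y => (0, y))).
  rewrite (@D_Ddir _ _ _ _ Phi (fun=> (t, x t)) (fun y => (0, y)) y v _ s1 s2 sP) //.
  have -> : 'D_v (fun _ : 'rV[R]_n => (t, x t)) y = 0 by exact: derive_cst.
  rewrite derive0 addr0; congr ('D_ _ Phi (t, x t)).
  have dc : differentiable (fun _ : 'rV[R]_n => 0 : R) y by exact: differentiable_cst.
  have di : differentiable (fun y : 'rV[R]_n => y) y by [].
  by rewrite (D_pair _ dc di); congr pair; [exact: derive_cst|exact: derive_id].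
have sG2 := sm_slice2 (findim_rV n) (findim_rV n) sG.
have [dl El] := lE ('D_1 x t).
rewrite (@D_comp _ _ _ _ (fun w => G d (X t, w)) (fun y => 'D_(0, y) Phi (t, x t)) _ _ dl (sm_diff sG2)).
by rewrite El.
Qed.

End AtGoodTime.

Section MomentumEquation.
Variable (t : R).
Hypothesis (gt : \near t, good t).

Let g0 : good t := nbhs_singleton gt.

(* The first variation formula for the variation of [rho] obtained by pulling
   [X + e w] back along the flow. *)
Lemma good_momentum_D w : 'D_1 (fun s => 'D_(0, w) (G d) (X s, vrho s)) t =
  'D_(w, - 'D_w (U d) (X t)) (G d) (X t, vrho t).
Proof.
have [[ct st Dt dt pt] [_ ELt]] := g0; have [cx sx sP cX] := good_sm gt.
have [G1 v0 x0 G2 X0] := good_unit gt; have [sX EX] := good_vel gt.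
have Dr : D (t, rho t) by rewrite -(coordK ct).
have [Di pi] := lflow_inv fl Dr.
have pX : param d (X t) = psi t (rho t) by rewrite pt /X /Phi coordK.
pose Psi := fun z : R * 'rV[R]_n => coord c (psi z.1 (param d z.2)).
have Di' : D (- t, param d (X t)) by rewrite pX.
have cp : dom c (psi (- t) (param d (X t))) by rewrite pX pi.
have ssP := lflow_smooth fl cX Di'.
have sPsi : sm Psi (- t, X t) by exact: smap_coord ssP cp.
pose Xe := fun z : R * R => X z.2 + z.1 *: w.
have sz1 z : sm (fun z : R * R => z.1) z by exact/sm_fst/sm_id.
have sz2 z : sm (fun z : R * R => z.2) z by exact/sm_snd/sm_id.
have smXe z : sm X z.2 -> sm Xe z.
  move=> sXz; apply: sm_add; first exact: (@sm_comp _ _ _ _ X (fun z : R * R => z.2)).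
  by apply: sm_scale => //; exact: sm_cst.
have Xe0 s : Xe (0, s) = X s by rewrite /Xe /= scale0r addr0.
pose m := fun z : R * R => (- z.2, Xe z).
have sm_m : sm m (0, t).
  by apply: sm_pair; [apply: sm_opp|apply: smXe].
have m0 : m (0, t) = (- t, X t) by rewrite /m Xe0.
pose Y := fun z => Psi (m z).
have sY : sm Y (0, t) by apply: (@sm_comp _ _ _ _ Psi m) => //; rewrite m0.
have s0 s : sm (fun s : R => ((0 : R), s)) s by apply: sm_pair; [exact: sm_cst|exact: sm_id].
have Y0 : Y (0, t) = x t by rewrite /Y m0 /Psi /= pX pi.
have Y0n : \near t, Y (0, t) = x t.
  apply: nearS gt => s [[cs ss Ds ds ps] _].
  rewrite /Y /Psi /m /= Xe0.
  have -> : param d (X s) = psi s (rho s) by rewrite ps /X /Phi coordK.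
  by rewrite (lflow_inv fl _).2 // -(coordK cs).
have nPsi : \forall z \near ((0 : R), t), [/\ cim d (Xe z), D (- z.2, param d (Xe z)) &
    dom c (psi (- z.2) (param d (Xe z)))].
  have n1 := lflow_open fl cX Di'; have n2 := near_dom (smap_cont ssP) cp.
  rewrite -m0 in n1 n2; apply: nearS (nearI (sm_near_im sm_m n1) (sm_near_im sm_m n2)).
  by move=> z [[]].
have PhiY : \forall z \near ((0 : R), t), Phi (z.2, Y z) = Xe z /\
    [/\ D (z.2, param c (Y z)), cim c (Y z), cim d (Xe z) &
        psi z.2 (param c (Y z)) = param d (Xe z)].
  apply: nearS nPsi => z [cz Dz dz].
  have [Dz' pz] := lflow_inv fl Dz; rewrite opprK in Dz' pz.
  rewrite /Phi /Y /Psi /m /= coordK // pz paramK //; split=> //.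
  by split=> //; exact: cim_coord.
have gYt := near_near gt.
have FV := first_variation sx (metric_sm mG cx x0) ELt sY Y0n.
(* The pulled back variation field is sent to [w] by the differential of the flow, so its pairing
   with the momentum along [rho] is that of [w] along [X]. *)
have lhs : \near t, 'D_(0, 'D_(1, 0) Y (0, t)) (G c) (x t, 'D_1 x t) =
    'D_(0, w) (G d) (X t, vrho t).
  have n1 := sm_near_im (s0 t) (near_near PhiY); have n2 := sm_near_im (s0 t) (sm_near sY).
  apply: nearS (nearI (nearI gYt (near_near Y0n)) (nearI n1 n2)) => s [[gs Ys] [PYs sYs]].
  have [_ sxs sPs _] := good_sm gs; have [sXs _] := good_vel gs.
  rewrite (good_momentum gs); congr ('D_(0, _) (G d) _).
  have Y0s : Y (0, s) = x s by exact: nbhs_singleton Ys.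
  have sm2 : sm (fun z => (z.2, Y z)) (0, s) by exact: sm_pair.
  have sPs' : sm Phi ((0 : R, s).2, Y (0, s)) by rewrite Y0s.
  have <- : 'D_(1, 0) Xe (0, s) = w.
    rewrite D_slice1 /Xe /=.
    have := @D_line _ _ _ (fun y : 'rV[R]_n => y) (X s) w 0.
    by rewrite scale0r addr0 => -[//|_ ->]; rewrite derive_id.
  have <- : 'D_(1, 0) (fun z => Phi (z.2, Y z)) (0, s) = 'D_(1, 0) Xe (0, s).
    by apply: D_ext; apply: nearS PYs => z [].
  rewrite (@D_comp _ _ _ _ Phi (fun z => (z.2, Y z)) _ _ (sm_diff sm2) (sm_diff sPs')) /= Y0s.
  congr ('D_ _ Phi _); rewrite (D_pair _ (sm_diff (sz2 _)) (sm_diff sYs)); congr pair.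
  by rewrite D_clin //; exact: continuous_snd.
rewrite -(D_ext _ lhs) FV.
(* By invariance the Lagrangian of the pulled back curves is [G] on the velocity of [X + e w] minus
   the wind there. *)
have rhs : \forall z \near ((0 : R), t), G c (Y z, 'D_(0, 1) Y z) =
    G d (Xe z, 'D_1 X z.2 - U d (Xe z)).
  have n1 := near_near PhiY; have n2 := sm_near sY.
  have n3 := sm_near_im (sz2 (0, t)) (sm_near sX).
  apply: nearS (nearI n1 (nearI n2 n3)) => z [PYz [sYz sXz]].
  have [PYz0 [Dz cz cXz pz]] := nbhs_singleton PYz.
  have dz : dom d (psi z.2 (param c (Y z))) by rewrite pz; exact: dom_param.
  have ssz := lflow_smooth fl cz Dz.
  have sPz : sm Phi (z.2, Y z) by exact: smap_coord ssz dz.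
  have odez : 'D_(1, 0) Phi (z.2, Y z) = U d (Xe z).
    by rewrite -PYz0; exact: (lflow_ode fl).
  have sm2 : sm (fun z => (z.2, Y z)) z by exact: sm_pair.
  have E : 'D_(0, 1) Xe z = U d (Xe z) + 'D_(0, 'D_(0, 1) Y z) Phi (z.2, Y z).
    have <- : 'D_(0, 1) (fun z => Phi (z.2, Y z)) z = 'D_(0, 1) Xe z.
      by apply: D_ext; apply: nearS PYz => y [].
    rewrite (@D_comp _ _ _ _ Phi (fun z => (z.2, Y z)) _ _ (sm_diff sm2) (sm_diff sPz)).
    rewrite (D_pair _ (sm_diff (sz2 _)) (sm_diff sYz)).
    rewrite (D_pair_dir _ _ (sm_diff sPz)).
    have -> : 'D_(0, 1) (fun z : R * R => z.2) z = 1.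
      by rewrite D_clin //; exact: continuous_snd.
    by rewrite odez.
  have E' : 'D_(0, 1) Xe z = 'D_1 X z.2.
    have sXw : sm (fun z : R * R => X z.2) z by exact: (@sm_comp _ _ _ _ X (fun z : R * R => z.2)).
    have dw : differentiable (fun z : R * R => z.1 *: w) z.
      by apply: sm_diff; apply: sm_scale => //; exact: sm_cst.
    rewrite [LHS]deriveD; [|exact/diff_derivable/sm_diff|exact/diff_derivable].
    rewrite (@D_comp _ _ _ _ X (fun z : R * R => z.2) _ _ (sm_diff (sz2 z)) (sm_diff sXz)).
    have -> : 'D_(0, 1) (fun z : R * R => z.2) z = 1.
      by rewrite D_clin //; exact: continuous_snd.
    have dcw : differentiable (fun _ : R * R => w) z by exact: differentiable_cst.
    rewrite (D_scale _ (sm_diff (sz1 z)) dcw).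
    have -> : 'D_(0, 1) (fun z : R * R => z.1) z = 0.
      by rewrite D_clin //; exact: continuous_fst.
    have -> : 'D_(0, 1) (fun _ : R * R => w) z = 0 by exact: derive_cst.
    by rewrite scaler0 scale0r !addr0.
  rewrite -E' E addrC addKr -PYz0.
  rewrite (D_slice2 Phi); apply/esym; exact: inv.
rewrite (D_ext _ rhs).
have sXe0 := smXe (0, t) sX.
have sX'z : sm (fun z : R * R => 'D_1 X z.2) (0, t).
  by apply: (@sm_comp _ _ _ _ (fun s => 'D_1 X s) (fun z : R * R => z.2)) => //; exact: sm_D.
have sU : sm (U d) (Xe (0, t)) by rewrite Xe0; exact: U_sm.
have sUX : sm (fun z => U d (Xe z)) (0, t) by exact: (@sm_comp _ _ _ _ (U d) Xe).
have su : sm (fun z : R * R => 'D_1 X z.2 - U d (Xe z)) (0, t) by exact: sm_sub.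
have smz : sm (fun z : R * R => (Xe z, 'D_1 X z.2 - U d (Xe z))) (0, t) by exact: sm_pair.
have uE : 'D_1 X t - U d (X t) = vrho t by rewrite EX addrK.
have pE : (Xe (0, t), 'D_1 X ((0 : R), t).2 - U d (Xe (0, t))) = (X t, vrho t).
  by rewrite Xe0 uE.
have sG : sm (G d) (Xe (0, t), 'D_1 X ((0 : R), t).2 - U d (Xe (0, t))).
  by rewrite pE; exact: (metric_sm mG cX v0).
rewrite (@D_comp _ _ _ _ (G d) (fun z : R * R => (Xe z, 'D_1 X z.2 - U d (Xe z))) _ _ (sm_diff smz) (sm_diff sG)).
have DX : 'D_(1, 0) Xe (0, t) = w.
  rewrite D_slice1 /Xe /=.
  have := @D_line _ _ _ (fun y : 'rV[R]_n => y) (X t) w 0.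
  by rewrite scale0r addr0 => -[//|_ ->]; rewrite derive_id.
have DUX : 'D_(1, 0) (fun z => U d (Xe z)) (0, t) = 'D_w (U d) (X t).
  apply: (etrans (@D_comp _ _ _ _ (U d) Xe _ _ (sm_diff sXe0) (sm_diff sU))).
  by rewrite DX Xe0.
have Du : 'D_(1, 0) (fun z : R * R => 'D_1 X z.2 - U d (Xe z)) (0, t) = - 'D_w (U d) (X t).
  rewrite [LHS]deriveB; [|exact/diff_derivable/sm_diff|exact/diff_derivable/sm_diff].
  rewrite DUX D_slice1.
  have -> : 'D_1 (fun _ : R => 'D_1 X t) 0 = 0 by exact: derive_cst.
  by rewrite sub0r.
rewrite (D_pair _ (sm_diff sXe0) (sm_diff su)) DX Du.
by rewrite -[in RHS]pE.
Qed.

End MomentumEquation.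

Lemma zermelo_EL t : (\near t, good t) -> EL (G' d) X t.
Proof.
move=> gt w; have [cx sx sP cX] := good_sm gt.
have [G1 v0 x0 G2 X0] := good_unit gt; have [sX EX] := good_vel gt.
have gn := near_near gt.
have sUX : sm (fun s => U d (X s)) t.
  by apply: (@sm_comp _ _ _ _ (U d) X) => //; exact: U_sm.
have vE : \near t, 'D_1 X t - U d (X t) = vrho t.
  by apply: nearS gn => s gs; rewrite (good_vel gs).2 addrK.
have sv : sm vrho t by apply: sm_ext vE _; apply: sm_sub => //; exact: sm_D.
have sg : sm (fun s => (X s, vrho s)) t by exact: sm_pair.
have sG := metric_sm mG cX v0.
have sp v : sm (fun s => 'D_(0, v) (G d) (X s, vrho s)) t.
  apply: (@sm_comp _ _ _ _ (fun z => 'D_(0, v) (G d) z) (fun s => (X s, vrho s))) => //.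
  exact: sm_D.
have sW : sm (fun s => (0 : 'rV[R]_n, U d (X s))) t by apply: sm_pair => //; exact: sm_cst.
(* Noether's first integral: the momentum paired with the symmetry [U]. *)
pose mu s := 'D_(0, U d (X s)) (G d) (X s, vrho s).
have smu : sm mu t by exact: (@sm_Ddir _ _ _ _ (G d) (fun s => (X s, vrho s)) (fun s => (0, U d (X s)))).
have dmu : 'D_1 mu t = 0.
  (* The motion of [U] contributes its derivative along ['D_1 X], and [good_momentum_D] at [U]
     subtracts its derivative along [U]. The remainder is its derivative along [vrho], as in
     [infinitesimal_invariance]. *)
  rewrite /mu (@D_Ddir _ _ _ _ (G d) (fun s => (X s, vrho s)) (fun s => (0, U d (X s))) t _ _ sg sW sG) //.
  have d0 : differentiable (fun _ : R => (0 : 'rV[R]_n)) t by exact: differentiable_cst.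
  rewrite (D_pair _ d0 (sm_diff sUX)).
  have -> : 'D_1 (fun _ : R => (0 : 'rV[R]_n)) t = 0 by exact: derive_cst.
  rewrite (@D_comp _ _ _ _ (U d) X _ _ (sm_diff sX) (sm_diff (U_sm cX))).
  have := @D_comp _ _ _ _ (fun z => 'D_(0, U d (X t)) (G d) z) (fun s => (X s, vrho s)) t 1
    (sm_diff sg) (sm_diff (sm_D _ sG)).
  rewrite (good_momentum_D gt) => <-.
  rewrite -(D_add_dir _ _ (sm_diff sG)).
  rewrite -[RHS](infinitesimal_invariance cX v0); congr ('D_ _ (G d) _).
  congr pair; rewrite /= ?add0r // -(nbhs_singleton vE).
  by rewrite (D_sub_dir _ _ (sm_diff (U_sm cX))).
have mu0 : 1 + mu t != 0 by exact: (zermelo_denominator cX G1).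
have uE : 'D_1 X t - U d (X t) = vrho t := nbhs_singleton vE.
have s1mu : sm (fun s => 1 + mu s) t by apply: sm_add => //; exact: sm_cst.
have near_mu := sm_near_im s1mu (near_neq0 mu0).
(* [D_zermelo] on vertical directions; on [(w, 0)] it gives the same factor for the position
   derivative, below. *)
have E : \near t, 'D_(0, w) (G' d) (X t, 'D_1 X t) =
    'D_(0, w) (G d) (X t, vrho t) * (1 + mu t)^-1.
  apply: nearS (nearI gn (nearI vE near_mu)) => s [gs [us ms]].
  have [_ _ _ cXs] := good_sm gs; have [_ _ _ G2s _] := good_unit gs.
  have := D_zermelo 0 w cXs G2s; rewrite /= us derive0 subr0 => <-.
  by rewrite mulfK.
rewrite (D_ext _ E).
have si : sm (fun s => (1 + mu s)^-1) t by exact: sm_inv.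
rewrite (D_mul _ (sm_diff (sp w)) (sm_diff si)) (D_inv _ (sm_diff s1mu) mu0).
have -> : 'D_1 (fun s => 1 + mu s) t = 0.
  rewrite [LHS]deriveD; [|exact: derivable_cst|exact/diff_derivable/sm_diff].
  by rewrite dmu derive_cst addr0.
rewrite mul0r oppr0 mulr0 add0r (good_momentum_D gt).
have := D_zermelo w 0 cX G2; rewrite /= uE sub0r => <-.
by rewrite mulfK.
Qed.

Lemma zermelo_geodesic_at : [/\ smap (fun t => psi t (rho t)) t0,
  speed G' (fun t => psi t (rho t)) t0 = 1 &
  EL (G' d) (ccoord d (fun t => psi t (rho t))) t0].
Proof.
have gt := near_good'.
have [cx sx sP cX] := good_sm gt.
have [G1 v0 x0 G2 X0] := good_unit gt; have [sX EX] := good_vel gt.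
have nX := good_X gt.
have sPs : smap (fun t => psi t (rho t)) t0.
  apply: (@smap_ext _ _ _ _ (fun t => param d (X t))); last exact: smap_param.
  apply: nearS gt => s [[cs ss Ds ds ps] _].
  by rewrite ps /X /Phi coordK.
have DX : \near t0, 'D_1 X t0 = 'D_1 (ccoord d (fun t => psi t (rho t))) t0.
  by apply: nearS (near_near nX) => s nXs; apply: D_ext; apply: nearS nXs => u.
split=> //.
- rewrite (speed_ccoord mG' sPs dd) -(nbhs_singleton DX).
  by rewrite (nbhs_singleton nX).
- by apply: EL_ext (zermelo_EL gt); apply: nearS nX => s.
Qed.

End Curve.

Theorem zermelo_geodesic (I : set R) (rho : R -> M) : open I ->
  unit_geodesic G I rho -> (forall t, I t -> D (t, rho t)) ->
  unit_geodesic G' I (fun t => psi t (rho t)).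
Proof.
move=> oI /(unit_geodesicP mG _ oI) H Dr; apply/(unit_geodesicP mG' _ oI) => t It.
have geo : \forall t \near t, [/\ smap rho t, speed G rho t = 1 &
    forall c, dom c (rho t) -> EL (G c) (ccoord c rho) t].
  have nI : nbhs t I by exact: open_nbhs_nbhs.
  by apply: nearS nI => s /H[ss S1 [_ _ E]].
have Z d := zermelo_geodesic_at (d := d) geo (Dr t It).
have dt := chart_atP (psi t (rho t)).
have [sP S1 _] := Z _ dt; split=> //.
by exists (chart_at (psi t (rho t))) => // d dd; have [_ _] := Z d dd.
Qed.

End ZermeloGeodesics.

(** * Exact changes of metric *)

Section InverseFamilies.
Context {R : realType}.

(** The positive derivative makes [T (e, .)] strictly increasing, which gives continuity of [S],
    from which smoothness follows. *)
Lemma inverse_family (T S : R * R -> R) (z0 : R * R) (J : set R) : open_itv J ->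
  (\forall z \near z0, [/\ J (S z), T (z.1, S z) = z.2 &
     forall s, J s -> sm T (z.1, s) /\ 0 < 'D_(0, 1) T (z.1, s)]) -> sm S z0.
Proof.
move=> [oJ iJ] H.
have mono (e : R) : (forall s, J s -> sm T (e, s) /\ 0 < 'D_(0, 1) T (e, s)) ->
    forall a b, J a -> J b -> (T (e, a) < T (e, b)) = (a < b).
  move=> He; apply: (derive_gt0_lt (dg := fun s => 'D_(0, 1) T (e, s)) iJ) => s Js.
    have [sT _] := He s Js; rewrite D_slice2; apply: DeriveDef => //.
    exact/diff_derivable/sm_diff/sm_slice2.
  by have [] := He s Js.
have C : \near z0, {for z0, continuous S}.
  apply: nearS (near_near H) => z Hz; have [Jz Tz Dz] := nbhs_singleton Hz.
  apply: (@inverse_continuous _ T S z J) => // [s Js|].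
    by have [/sm_cont] := Dz s Js.
  by apply: nearS Hz => y [Jy Ty Dy]; split=> //; exact: mono.
apply: (@inverse_sm _ T); apply: nearS (nearI H C) => z [[Jz Tz Dz] Cz].
by have [sT T0] := Dz _ Jz.
Qed.

Lemma sm_fst_cst (s : R -> R) t (z : R * R) : sm (fun z : R * R => s z.2) (z.1, t) -> sm s t.
Proof.
move=> H; apply: (@sm_comp _ _ _ _ (fun z : R * R => s z.2) (fun t => (z.1, t))) => //.
by apply: sm_pair; [exact: sm_cst|exact: sm_id].
Qed.

Lemma inverse_sm1 (T s : R -> R) (I J : set R) : open_itv J -> open I ->
  (forall u, J u -> sm T u /\ 0 < 'D_1 T u) ->
  (forall t, I t -> J (s t) /\ T (s t) = t) -> forall t, I t -> sm s t.
Proof.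
move=> oJ oI HT Hs t It; apply: (@sm_fst_cst s t (0, 0)) => /=.
apply: (@inverse_family (fun z => T z.2) _ _ J) => //.
have nI : nbhs t I by exact: open_nbhs_nbhs.
have := @continuous_snd _ _ _ ((0 : R), t) _ nI; apply: nearS => z /Hs[Js Ts].
split=> // u /HT[sT T0]; split.
  by apply: (@sm_comp _ _ _ _ T (fun z : R * R => z.2)) => //; exact/sm_snd/sm_id.
by rewrite D_slice2.
Qed.

Lemma open_itv_between (J : set R) a b : open_itv J -> J a -> J b ->
  `[a, b] `<=` J.
Proof. by move=> [_ iJ] Ja Jb x /=; rewrite in_itv /=; exact: iJ. Qed.

Lemma IVT_sm (T : R -> R) a b v : a <= b ->
  (forall u, a <= u <= b -> sm T u) -> T a <= v <= T b ->
  exists2 u, a <= u <= b & T u = v.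
Proof.
move=> ab sT /andP[av vb]; have [||u] := @IVT R T a b v ab.
- apply: continuous_in_subspaceT => x /set_mem /=; rewrite in_itv /= => xab.
  exact/sm_cont/sT.
- by rewrite minEle maxEle (le_trans av vb) av.
- by rewrite in_itv /= => uab <-; exists u.
Qed.

(** Intermediate values make the image an interval, and strict monotonicity surrounds each of its
    points by values from both sides. *)
Lemma open_itv_image (T : R -> R) (J : set R) : open_itv J ->
  (forall u, J u -> sm T u /\ 0 < 'D_1 T u) -> open_itv (T @` J).
Proof.
move=> oJ HT; have [oJ' iJ] := oJ.
have mono a b : J a -> J b -> (T a < T b) = (a < b).
  apply: (derive_gt0_lt (dg := fun s => 'D_1 T s) iJ) => s /HT[sT T0] //.
  by apply: DeriveDef => //; exact/diff_derivable/sm_diff.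
have iT : is_interval (T @` J).
  move=> _ _ [a Ja <-] [b Jb <-] v avb; have [av vb] := andP avb.
  have ab : a <= b.
    by rewrite leNgt -mono // -leNgt (le_trans av vb).
  have [|u uab <-] := @IVT_sm T a b v ab _ avb; last first.
    by exists u => //; exact: iJ uab.
  by move=> u uab; have [] := HT u (iJ _ _ Ja Jb _ uab).
split=> //; rewrite openE => _ [u Ju <-].
have /nbhs_ballP[d /= d0 Hd] : nbhs u J by exact: open_nbhs_nbhs.
have d20 : 0 < d / 2 by rewrite divr_gt0.
have dd : d / 2 < d by rewrite ltr_pdivrMr // ltr_pMr // ltr1n.
have Jm : J (u - d / 2) by apply: Hd; rewrite /ball /= opprB addrCA subrr addr0 gtr0_norm.
have Jp : J (u + d / 2) by apply: Hd; rewrite /ball /= opprD addNKr normrN gtr0_norm.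
have lo : T (u - d / 2) < T u by rewrite mono // gtrDl oppr_lt0.
have hi : T u < T (u + d / 2) by rewrite mono // ltrDl.
apply: nearS (nearI (lt_nbhsr lo) (lt_nbhsl hi)) => v [lv vh].
by apply: (iT (T (u - d / 2)) (T (u + d / 2))); [exists (u - d / 2)|exists (u + d / 2)|rewrite !ltW].
Qed.

End InverseFamilies.

(** * Integrals and primitives *)

Section Integrals.
Context {R : realType}.

Lemma Rintegral_D (G g : R -> R) a b : a <= b ->
  (forall x, a <= x <= b -> [/\ differentiable G x, 'D_1 G x = g x &
     {for x, continuous g}]) ->
  (\int[@lebesgue_measure R]_(x in `[a, b]) g x)%R = G b - G a.
Proof.
move=> ab H; have cG x : a <= x <= b -> {for x, continuous G}.
  by move=> /H[dG _ _]; exact: differentiable_continuous.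
move: ab; rewrite le_eqVlt => /predU1P[<-|ab].
  by rewrite set_itv1 Rintegral_set1 subrr.
rewrite /Rintegral (@continuous_FTC2 R g G a b ab) ?fineB //=.
- apply: continuous_in_subspaceT => x /set_mem /=; rewrite in_itv /= => xab.
  by have [] := H x xab.
- split.
  + move=> x; rewrite in_itv /= => /andP[ax xb].
    by have [|dG _ _] := H x; [rewrite !ltW|exact: diff_derivable].
  + by apply: cvg_at_right_filter; apply: cG; rewrite lexx ltW.
  + by apply: cvg_at_left_filter; apply: cG; rewrite lexx ltW.
- move=> x; rewrite in_itv /= => /andP[ax xb].
  by have [|_ <- _] := H x; [rewrite !ltW|rewrite derive1E].
Qed.

Lemma integral0_D (G g : R -> R) (J : set R) s : is_interval J -> J 0 -> J s ->
  (forall x, J x -> [/\ differentiable G x, 'D_1 G x = g x &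
     {for x, continuous g}]) -> integral0 g s = G s - G 0.
Proof.
move=> iJ J0 Js H; rewrite /integral0; case: (leP 0 s) => s0.
  by apply: Rintegral_D => // x x0s; apply: H; exact: iJ x0s.
rewrite (@Rintegral_D G) ?opprB // ?ltW // => x xs0.
by apply: H; exact: (iJ _ _ Js J0).
Qed.

Lemma primitive (g : R -> R) (a b : R) : a < b ->
  (forall x, a <= x <= b -> {for x, continuous g}) ->
  exists G : R -> R, forall x, a < x < b -> differentiable G x /\ 'D_1 G x = g x.
Proof.
move=> ab cg.
have ig : (@lebesgue_measure R).-integrable `[a, b] (EFin \o g).
  apply: continuous_compact_integrable; first exact: segment_compact.
  by apply: continuous_in_subspaceT => x /set_mem /=; rewrite in_itv /= => /cg.
exists (fun x => (\int[@lebesgue_measure R]_(t in `[a, x]) g t)%R) => x /andP[ax xb].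
have cx : {for x, continuous g} by apply: cg; rewrite !ltW.
have [dG EG] := continuous_FTC1_closed xb ig ax cx.
by split; [exact/derivable1_diffP|rewrite -derive1E].
Qed.

Lemma primitive_sm (G g : R -> R) (a b : R) : (forall x, a < x < b -> sm g x) ->
  (forall x, a < x < b -> differentiable G x /\ 'D_1 G x = g x) ->
  forall x, a < x < b -> sm G x.
Proof.
move=> sg HG x xab; exists [set x | a < x < b].
  split=> //; rewrite openE => y /= /andP[ay yb].
  by apply: nearS (nearI (lt_nbhsr ay) (lt_nbhsl yb)) => z [az zb] /=; rewrite az zb.
have o : open [set x | a < x < b].
  rewrite openE => y /= /andP[ay yb].
  by apply: nearS (nearI (lt_nbhsr ay) (lt_nbhsl yb)) => z [az zb] /=; rewrite az zb.
case=> [|k]; first by move=> y /HG[/differentiable_continuous].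
split=> [y /HG[]//|v].
have H : Ck k [set x | a < x < b] (fun x => v *: g x).
  apply: Ck_scale => //; first exact: Ck_cst.
  apply/Ck_pt => y /sg[V [oV Vy] HV].
  by apply: Ck_subset (HV k) => _ ->.
apply: (Ck_ext o _ H) => y /HG[dG <-].
by rewrite -D_scale_dir // -[v *: 1]/(v * 1) mulr1.
Qed.

End Integrals.

(** * Extremals of a metric changed by an exact form *)

Section Reparametrization.
Context {R : realType} {n : nat} {M : manifold R n}.
Variables (F F' : chart M -> 'rV[R]_n * 'rV[R]_n -> R) (f : M -> R).
Hypotheses (mF : metric F) (mF' : metric F') (sf : smooth_fun f).
Hypothesis (FF' : forall c x y, cim c x ->
  F' c (x, y) = F c (x, y) + 'D_y (fun x => f (param c x)) x).
Implicit Types (c d : chart M).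

Lemma D_F' c x y (a b : 'rV[R]_n) : cim c x -> y != 0 ->
  'D_(a, b) (F' c) (x, y) = 'D_(a, b) (F c) (x, y) +
     ('D_b (fun x => f (param c x)) x + 'D_a (fun z => 'D_y (fun x => f (param c x)) z) x).
Proof.
move=> cx y0; have sfc := smooth_fun_sm sf cx.
have s1 : sm (fun z : 'rV[R]_n * 'rV[R]_n => z.1) (x, y) by exact/sm_fst/sm_id.
have s2 : sm (fun z : 'rV[R]_n * 'rV[R]_n => z.2) (x, y) by exact/sm_snd/sm_id.
have sb : sm (fun z : 'rV[R]_n * 'rV[R]_n => 'D_(z.2) (fun x => f (param c x)) z.1) (x, y).
  exact: (@sm_Ddir _ _ _ _ (fun x => f (param c x)) (fun z => z.1) (fun z => z.2)).
rewrite (@D_ext _ _ _ _ (fun z => F c z + 'D_(z.2) (fun x => f (param c x)) z.1)); last first.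
  apply: nearS (@continuous_fst _ _ _ (x, y) _ (near_cim cx)) => -[z w] /= cz.
  exact: FF'.
have dF := sm_diff (metric_sm mF cx y0).
rewrite [LHS]deriveD; [|exact/diff_derivable|exact/diff_derivable/sm_diff].
congr (_ + _).
apply: (etrans (@D_Ddir _ _ _ _ (fun x => f (param c x)) (fun z => z.1) (fun z => z.2)
  (x, y) (a, b) (findim_rV n) s1 s2 sfc)) => /=.
have -> : 'D_(a, b) (fun z : 'rV[R]_n * 'rV[R]_n => z.1) (x, y) = a.
  by apply: (@D_clin _ _ _ fst); exact: continuous_fst.
have -> : 'D_(a, b) (fun z : 'rV[R]_n * 'rV[R]_n => z.2) (x, y) = b.
  by apply: (@D_clin _ _ _ snd); exact: continuous_snd.
by [].
Qed.

Lemma D_F'_vert c x y (b : 'rV[R]_n) : cim c x -> y != 0 ->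
  'D_(0, b) (F' c) (x, y) = 'D_(0, b) (F c) (x, y) + 'D_b (fun x => f (param c x)) x.
Proof.
move=> cx y0; apply: (etrans (D_F' 0 b cx y0)); congr (_ + _).
have -> : 'D_0 (fun z => 'D_y (fun x => f (param c x)) z) x = 0 by exact: derive0.
by rewrite addr0.
Qed.

Lemma D_F'_hor c x y (a : 'rV[R]_n) : cim c x -> y != 0 ->
  'D_(a, 0) (F' c) (x, y) = 'D_(a, 0) (F c) (x, y) +
     'D_a (fun z => 'D_y (fun x => f (param c x)) z) x.
Proof.
move=> cx y0; apply: (etrans (D_F' a 0 cx y0)); congr (_ + _).
have -> : 'D_0 (fun x => f (param c x)) x = 0 by exact: derive0.
by rewrite add0r.
Qed.

Lemma ccoord_comp_D c (g : R -> M) (s : R -> R) t : smap g (s t) -> sm s t ->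
  dom c (g (s t)) ->
  'D_1 (ccoord c (fun t => g (s t))) t = 'D_1 s t *: 'D_1 (ccoord c g) (s t).
Proof.
move=> sg ss ct; have sx := smap_coord sg ct.
rewrite (@D_comp _ _ _ _ (ccoord c g) s _ _ (sm_diff ss) (sm_diff sx)).
by rewrite -(D_scale_dir _ _ (sm_diff sx)) -[_ *: 1]/(_ * 1) mulr1.
Qed.

(** The momentum of [F] has degree 0 in the velocity and its position derivative degree 1, so both
    sides scale by ['D_1 s t]; the exact term satisfies its Euler-Lagrange equation along any
    curve. *)
Lemma reparam_EL c (g : R -> M) (s : R -> R) t : smap g (s t) -> sm s t ->
  0 < 'D_1 s t -> dom c (g (s t)) -> 'D_1 (ccoord c g) (s t) != 0 ->
  EL (F c) (ccoord c g) (s t) -> EL (F' c) (ccoord c (fun t => g (s t))) t.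
Proof.
move=> sg ss s0 ct v0 H w.
pose y := ccoord c g; pose x := ccoord c (fun t => g (s t)).
have sy : sm y (s t) := smap_coord sg ct.
have cy : cim c (y (s t)) by exact: cim_coord.
have sy' := sm_D (1 : R) sy.
have ss' := sm_D (1 : R) ss.
have n1 : \near t, [/\ smap g (s t), sm s t, 0 < 'D_1 s t, dom c (g (s t)) & 'D_1 y (s t) != 0].
  have a1 := sm_near_im ss (smap_near sg).
  have a2 := sm_near_im ss (near_dom (smap_cont sg) ct).
  have a3 := sm_near_im ss (sm_near_im sy' (near_neq0 v0)).
  have a4 := sm_near_im ss' (lt_nbhsr s0).
  have := nearI (nearI a1 a2) (nearI (nearI a3 a4) (sm_near ss)).
  by apply: nearS => u [[? ?] [[? ?] ?]].
have sx : sm x t by exact: (@sm_comp _ _ _ _ y s).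
have xE u : x u = y (s u) by [].
have sfc := smooth_fun_sm sf cy.
have xD : 'D_1 x t = 'D_1 s t *: 'D_1 y (s t) by exact: ccoord_comp_D.
have ky0 : 'D_1 x t != 0 by rewrite xD scaler_eq0 negb_or v0 gt_eqF.
have dw z := sm_D w (z : sm (fun x => f (param c x)) (y (s t))).
have E : \near t, 'D_(0, w) (F' c) (x t, 'D_1 x t) =
    'D_(0, w) (F c) (y (s t), 'D_1 y (s t)) + 'D_w (fun x => f (param c x)) (x t).
  apply: nearS n1 => u [sgu su s0u cu v0u].
  have xDu : 'D_1 x u = 'D_1 s u *: 'D_1 y (s u) by exact: ccoord_comp_D.
  have xu0 : 'D_1 x u != 0 by rewrite xDu scaler_eq0 negb_or v0u gt_eqF.
  have cxu : cim c (x u) by exact: (cim_coord cu).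
  rewrite (D_F'_vert w cxu xu0) xDu (momentum_hom mF w cxu v0u s0u).
  by rewrite xE.
have sp : sm (fun u => 'D_(0, w) (F c) (y u, 'D_1 y u)) (s t).
  exact: (sm_momentum w sy (metric_sm mF cy v0)).
have sp' : sm (fun u => 'D_(0, w) (F c) (y (s u), 'D_1 y (s u))) t.
  exact: (@sm_comp _ _ _ _ (fun u => 'D_(0, w) (F c) (y u, 'D_1 y u)) s).
have sb : sm (fun u => 'D_w (fun x => f (param c x)) (x u)) t.
  by apply: (@sm_comp _ _ _ _ (fun z => 'D_w (fun x => f (param c x)) z) x) => //; exact: dw.
rewrite (D_ext _ E) [LHS]deriveD; [|exact/diff_derivable/sm_diff|exact/diff_derivable/sm_diff].
have p1 : 'D_1 (fun u => 'D_(0, w) (F c) (y (s u), 'D_1 y (s u))) t =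
    'D_1 s t * 'D_(w, 0) (F c) (y (s t), 'D_1 y (s t)).
  rewrite (@D_comp _ _ _ _ (fun u => 'D_(0, w) (F c) (y u, 'D_1 y u)) s _ _ (sm_diff ss) (sm_diff sp)).
  rewrite -(H w) -[RHS](D_scale_dir _ _ (sm_diff sp)).
  by rewrite -['D_1 s t *: 1]/('D_1 s t * 1) mulr1.
(* Symmetry of the second derivatives of [f]: the time derivative of [df (w)] is the derivative
   along [w] of [df] on the velocity. *)
have p2 : 'D_1 (fun u => 'D_w (fun x => f (param c x)) (x u)) t =
    'D_w (fun z => 'D_('D_1 x t) (fun x => f (param c x)) z) (x t).
  rewrite -(Schwarz _ _ (findim_R) sfc).
  exact: (@D_comp _ _ _ _ (fun z => 'D_w (fun x => f (param c x)) z) x _ _ (sm_diff sx) (sm_diff (dw sfc))).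
have cx : cim c (x t) by exact: (cim_coord ct).
have v0x : 'D_1 y (s t) != 0 by exact: v0.
rewrite (D_F'_hor w cx ky0) p1 p2; congr (_ + _).
by rewrite xD (position_hom mF w cx v0x s0) xE.
Qed.

Lemma arc_length_D (g : R -> M) t : smap g t ->
  sm (fun u => f (g u)) t /\ speed F' g t = speed F g t + 'D_1 (fun u => f (g u)) t.
Proof.
move=> sg; have ct := chart_atP (g t); set c := chart_at (g t) in ct.
split; first exact: smooth_fun_smap.
rewrite (speed_ccoord mF' sg ct) (speed_ccoord mF sg ct) FF'; last exact: cim_coord.
by rewrite (D_smooth_fun _ sf sg ct).
Qed.

Lemma reparam_speed (g : R -> M) (s : R -> R) t : smap g (s t) -> sm s t ->
  0 < 'D_1 s t -> speed F' (fun t => g (s t)) t = 'D_1 s t * speed F' g (s t).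
Proof.
move=> sg ss s0; have ct := chart_atP (g (s t)); set c := chart_at _ in ct.
have sgs : smap (fun t => g (s t)) t by exact: (@smap_comp _ _ _ _ _ g s).
rewrite (speed_ccoord mF' sg ct) (@speed_ccoord _ _ _ _ mF' (fun t => g (s t)) t c sgs ct).
by rewrite ccoord_comp_D // (metric_hom mF') ?ltW //; exact: cim_coord.
Qed.

(* [cc * u + f (g u)] is, up to a constant, the F'-arc length along [g]. *)
Lemma reparam_geodesic (I J : set R) (g : R -> M) (s : R -> R) (cc k : R) :
  open J -> geodesic F J g -> (forall u, J u -> speed F g u = cc) ->
  open I -> (forall t, I t -> [/\ J (s t), sm s t & cc * s t + f (g (s t)) - k = t]) ->
  unit_geodesic F' I (fun t => g (s t)).
Proof.
move=> oJ gg Scc oI Hs; have [sg Hg] := (geodesicP mF _ oJ).1 gg.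
apply/(unit_geodesicP mF' _ oI) => t It.
have [Jt st Tt] := Hs t It; have sgt := sg _ Jt.
have [sfg SE] := arc_length_D sgt.
have cc0 : 0 < cc by rewrite -(Scc _ Jt); exact: (geodesic_speed_gt0 mF oJ gg Jt).
have ct := chart_atP (g (s t)); set c := chart_at _ in ct.
have [v0 _] := Hg c _ Jt ct.
have F'0 : 0 < speed F' g (s t).
  by rewrite (speed_ccoord mF' sgt ct); apply: metric_pos => //; exact: cim_coord.
have nI : nbhs t I by exact: open_nbhs_nbhs.
(* Differentiating [cc * s t + f (g (s t)) - k = t] and using [F' = F + df] along [g]. *)
have one : 'D_1 s t * speed F' g (s t) = 1.
  have sfs : sm (fun u => f (g (s u))) t by exact: (@sm_comp _ _ _ _ (fun u => f (g u)) s).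
  have sl : sm (fun u => cc *: s u) t by apply: sm_scale => //; exact: sm_cst.
  have slf : sm (fun u => cc *: s u + f (g (s u))) t by exact: sm_add.
  have one : 'D_1 (fun u => cc *: s u + f (g (s u)) - k) t = 1.
    rewrite (@D_ext _ _ _ _ (fun u => u)); first exact: derive_id.
    by apply: nearS nI => u /Hs[].
  apply: (etrans _ one).
  rewrite [RHS]deriveB; [|exact/diff_derivable/sm_diff|exact: derivable_cst].
  rewrite derive_cst subr0 [RHS]deriveD; [|exact/diff_derivable/sm_diff|exact/diff_derivable/sm_diff].
  rewrite (D_scale_cst cc _ (sm_diff st)) SE Scc // mulrDr mulrC; congr (_ + _).
  have fgs : 'D_1 (fun u => f (g (s u))) t = 'D_1 s t * 'D_1 (fun u => f (g u)) (s t).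
    apply: (etrans (@D_comp _ _ _ _ (fun u => f (g u)) s _ _ (sm_diff st) (sm_diff sfg))).
    by rewrite -[RHS](D_scale_dir _ _ (sm_diff sfg)) -[_ *: 1]/(_ * 1) mulr1.
  by rewrite fgs.
have s0 : 0 < 'D_1 s t by rewrite -(pmulr_lgt0 _ F'0) one ltr01.
split.
- exact: (@smap_comp _ _ _ _ _ g s).
- by rewrite reparam_speed.
- exists c => // d dt; have [w0 E] := Hg d _ Jt dt.
  apply: reparam_EL => //.
  apply: (EL_energy (sigma := cc) mF _ _ w0 cc0 _).1 => //.
  + exact: smap_coord sgt dt.
  + exact: cim_coord.
  + have nJ : nbhs (s t) J by exact: open_nbhs_nbhs.
    by apply: nearS (nearI nJ (near_speed mF sgt dt)) => u [Ju <-]; exact: Scc.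
Qed.

End Reparametrization.

(** * Conjugate points *)

Section Tube.
Context {R : realType}.

(** Compactness of the segment makes the width uniform, also slightly beyond the end points:
    conjugacy asks for one parameter range on one open interval around [[0, l]]. *)
Lemma tube (Om : set (R * R)) (l : R) : 0 <= l ->
  (forall t : R, 0 <= t <= l -> nbhs ((0 : R), t) Om) ->
  exists2 d : R, 0 < d & forall z, `|z.1| < d -> - d < z.2 < l + d -> Om z.
Proof.
move=> l0 H.
have cK : compact (`[0, l] : set R) by exact: segment_compact.
have /compact_near_coveringP nc := cK.
have [|d0 /= d00 Hd] := nc R (0^'+ : set_system R) (fun (d : R) (t : R) =>
  forall z : R * R, `|z.1| < d -> `|z.2 - t| < d -> Om z) _.
  move=> t; rewrite /= in_itv /= => /H/nbhs_ballP[r /= r0 Hr].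
  have r20 : 0 < r / 2 by rewrite divr_gt0.
  exists (ball t (r / 2), [set d | d < r / 2]) => /=.
    by split; [exact: nbhsx_ballx|exact: nbhs_right_lt].
  move=> [t' d] /= [tt' dr] z z1 z2; apply: Hr; split => /=.
    rewrite /ball /= sub0r normrN (lt_trans z1) // (lt_trans dr) //.
    by rewrite ltr_pdivrMr // ltr_pMr // ltr1n.
  rewrite /ball /= in tt' *; rewrite -(subrKA t') (splitr r).
  by rewrite (le_lt_trans (ler_normD _ _)) // ltrD // distrC (lt_trans z2).
pose d := d0 / 2.
have dp : 0 < d by rewrite divr_gt0.
have dd : d < d0 by rewrite ltr_pdivrMr // ltr_pMr // ltr1n.
have key := Hd d _ dp; rewrite /ball /= sub0r normrN gtr0_norm // in key.
exists d => // z z1 /andP[z2 z2'].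
have [zn|zp] := ltP z.2 0.
  apply: (key dd 0) => //; first by rewrite /= in_itv /= lexx.
  by rewrite subr0 ltr0_norm // ltrNl.
have [zl|lz] := leP z.2 l.
  by apply: (key dd z.2) => //; [rewrite /= in_itv /= zp|rewrite subrr normr0].
apply: (key dd l) => //; first by rewrite /= in_itv /= lexx andbT.
by rewrite gtr0_norm ?subr_gt0 // ltrBlDl.
Qed.

End Tube.

Section VariationFields.
Context {R : realType} {n : nat} {M : manifold R n}.
Implicit Types (c d : chart M) (Gam : R -> R -> M).

(** [variation_field] reads every point in its own chart; a fixed chart is what can be
    differentiated in [t]. *)
Definition var_field c Gam (t : R) : 'rV[R]_n :=
  'D_(1, 0) (fun z : R * R => coord c (Gam z.1 z.2)) (0, t).

Lemma variation_fieldE Gam t :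
  variation_field Gam t = var_field (chart_at (Gam 0 t)) Gam t.
Proof. by rewrite /variation_field velE /var_field D_slice1. Qed.

Lemma var_field_chart Gam t c d : smap (fun z : R * R => Gam z.1 z.2) (0, t) ->
  dom c (Gam 0 t) -> dom d (Gam 0 t) ->
  var_field d Gam t = dtrans c d (Gam 0 t) (var_field c Gam t).
Proof. by move=> sG cc dd; exact: (D_chart _ sG cc dd). Qed.

Lemma variation_field0 Gam t c : smap (fun z : R * R => Gam z.1 z.2) (0, t) ->
  dom c (Gam 0 t) -> variation_field Gam t = 0 <-> var_field c Gam t = 0.
Proof.
move=> sG cc; rewrite variation_fieldE (var_field_chart sG cc (chart_atP _)).
have E := dtrans0 (var_field c Gam t) cc (chart_atP (Gam 0 t)).
by split=> [/eqP|/eqP]; [rewrite E => /eqP|rewrite -E => /eqP].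
Qed.

(** The momentum is a covector, because [F] is invariant under changes of charts and their
    differentials are linear. *)
Lemma momentum_chart (F : chart M -> 'rV[R]_n * 'rV[R]_n -> R) c d p y w :
  metric F -> dom c p -> dom d p -> y != 0 ->
  'D_(0, dtrans c d p w) (F d) (coord d p, dtrans c d p y) =
  'D_(0, w) (F c) (coord c p, y).
Proof.
move=> mF dc dd y0; have [_ _ _ T] := mF.
have dy0 : dtrans c d p y != 0 by rewrite dtrans0.
have sF := sm_slice2 (findim_rV n) (findim_rV n) (metric_sm mF (cim_coord dd) dy0).
rewrite (D_slice2 (F d)) (D_slice2 (F c)).
rewrite [RHS](@D_ext _ _ _ _ (fun y => F d (coord d p, dtrans c d p y))); last first.
  by apply: nearT => v; rewrite T.
have sT := transition_sm dc dd.
have s1 : sm (fun _ : 'rV[R]_n => coord c p) y by exact: sm_cst.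
have sD : sm (fun y => dtrans c d p y) y.
  exact: (@sm_Ddir _ _ _ _ (fun x => coord d (param c x)) (fun=> coord c p) (fun y => y) _ (findim_rV n) s1 (sm_id _) sT).
rewrite (@D_comp _ _ _ _ (fun v => F d (coord d p, v)) (fun y => dtrans c d p y) _ _ (sm_diff sD) (sm_diff sF)).
congr ('D_ _ _ _); rewrite /dtrans.
apply/esym; apply: (etrans (@D_Ddir _ _ _ _ (fun x => coord d (param c x)) (fun=> coord c p) (fun y => y) y w (findim_rV n) s1 (sm_id _) sT)).
have -> : 'D_w (fun _ : 'rV[R]_n => coord c p) y = 0 by exact: derive_cst.
have -> : 'D_w (fun y : 'rV[R]_n => y) y = w by exact: derive_id.
by rewrite derive0 addr0.
Qed.

Lemma sm_speed_family (F : chart M -> 'rV[R]_n * 'rV[R]_n -> R) Gam (z : R * R) :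
  metric F -> smap (fun z : R * R => Gam z.1 z.2) z ->
  (forall c, dom c (Gam z.1 z.2) -> 'D_1 (ccoord c (Gam z.1)) z.2 != 0) ->
  sm (fun z => speed F (Gam z.1) z.2) z.
Proof.
move=> mF sG v0; have ct := chart_atP (Gam z.1 z.2); set c := chart_at _ in ct.
have sY := smap_coord sG ct; set Y := (fun z : R * R => coord c (Gam z.1 z.2)) in sY.
have sYt : sm (fun z => 'D_(0, 1) Y z) z := sm_D _ sY.
have vE (y : R * R) : 'D_(0, 1) Y y = 'D_1 (ccoord c (Gam y.1)) y.2.
  by case: y => a b; rewrite D_slice2.
apply: (@sm_ext _ _ _ (fun z => F c (Y z, 'D_(0, 1) Y z))).
  apply: nearS (nearI (smap_near sG) (near_dom (smap_cont sG) ct)) => -[a b] /= [sab cab].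
  rewrite vE; apply/esym/speed_ccoord => //.
  have sp : sm (fun u : R => (a, u)) b by apply: sm_pair; [exact: sm_cst|exact: sm_id].
  exact: (@smap_comp _ _ _ _ _ (fun z : R * R => Gam z.1 z.2) (fun u => (a, u)) b _ sp sab).
apply: (@sm_comp _ _ _ _ (F c) (fun z => (Y z, 'D_(0, 1) Y z))) => //; first exact: sm_pair.
by apply: metric_sm => //; [exact: cim_coord|rewrite vE; exact: v0].
Qed.

End VariationFields.

(* Unit speed geodesics are the ones that the changes of metric preserve. *)
Definition unit_conjugate (R : realType) n (M : manifold R n)
    (F : chart M -> 'rV[R]_n * 'rV[R]_n -> R) (g : R -> M) (l : R) : Prop :=
  exists I (Gam : R -> R -> M) (e0 : R),
  [/\ open_itv I /\ `[0, l] `<=` I,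
      0 < e0 /\ (forall z : R * R, `|z.1| < e0 -> I z.2 ->
        smap (fun z : R * R => Gam z.1 z.2) z),
      (forall e, `|e| < e0 -> unit_geodesic F I (Gam e)) /\
        (forall t, I t -> Gam 0 t = g t),
      variation_field Gam 0 = 0 /\ variation_field Gam l = 0 &
      exists2 t, 0 <= t <= l & variation_field Gam t != 0].

Section Conjugate.
Context {R : realType} {n : nat} {M : manifold R n}.

Lemma unit_geodesic_sub (F : chart M -> 'rV[R]_n * 'rV[R]_n -> R) (I J : set R) g :
  metric F -> open I -> open J -> J `<=` I -> unit_geodesic F I g -> unit_geodesic F J g.
Proof.
move=> mF oI oJ JI /(unit_geodesicP mF _ oI) H; apply/(unit_geodesicP mF _ oJ) => t Jt.
exact: H (JI t Jt).
Qed.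

Lemma strip_open (I : set R) (e0 : R) : open I ->
  open [set z : R * R | `|z.1| < e0 /\ I z.2].
Proof.
move=> oI; rewrite openE => -[a b] /= [a0 Ib].
have na : nbhs a [set a : R | `|a| < e0].
  rewrite ltr_norml in a0; have [a1 a2] := andP a0.
  by apply: nearS (nearI (lt_nbhsr a1) (lt_nbhsl a2)) => x [x1 x2]; rewrite /= ltr_norml x1.
have nb : nbhs b I by exact: open_nbhs_nbhs.
by apply: nearS (nearI (@continuous_fst _ R R (a, b) _ na) (@continuous_snd _ R R (a, b) _ nb)) => z [].
Qed.

Lemma unit_conjugate_conjugate (F : chart M -> 'rV[R]_n * 'rV[R]_n -> R) g l :
  unit_conjugate F g l -> conjugate F g l.
Proof.
move=> [I [Gam [e0 [[oI lI] [e00 sG] [ug g0] vf vf']]]]; exists I, Gam; split=> //.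
exists e0 => //; split=> //; last by move=> e /ug[].
by apply/smooth_mapP => [|z []]; [apply: strip_open; case: oI|exact: sG].
Qed.

Section PushConjugate.
Variables (G G' : chart M -> 'rV[R]_n * 'rV[R]_n -> R).
Variables (U : chart M -> 'rV[R]_n -> 'rV[R]_n) (D : set (R * M)) (psi : R -> M -> M).
Hypotheses (mG : metric G) (mG' : metric G') (vU : vector_field U).
Hypothesis (rel : forall c x y, cim c x ->
  G' c (x, y) = 1 <-> G c (x, y - U c x) = 1).
Hypothesis (fl : local_flow U D psi).
Hypothesis (inv : forall c d x t y, cim c x -> D (t, param c x) ->
  dom d (psi t (param c x)) ->
  G d (coord d (psi t (param c x)), push psi c x y d t) = G c (x, y)).

Lemma smap_flow (E : normedModType R) (tau : E -> R) (s : E -> M) u : findim E ->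
  smap s u -> sm tau u -> D (tau u, s u) ->
  smap (fun v => psi (tau v) (s v)) u /\ \near u, D (tau u, s u).
Proof.
move=> fE ss st Du; have cu := chart_atP (s u); set c := chart_at (s u) in cu.
have cx := cim_coord cu; have sx := smap_coord ss cu.
have Dx : D (tau u, param c (coord c (s u))) by rewrite coordK.
have sz : sm (fun v => (tau v, coord c (s v))) u by exact: sm_pair.
have nc := near_dom (smap_cont ss) cu.
split.
  apply: (@smap_ext _ _ _ _ (fun v => psi (tau v) (param c (coord c (s v))))).
    by apply: nearS nc => v cv; rewrite coordK.
  exact: (@smap_comp _ _ _ _ (R * 'rV[R]_n)%type (fun z => psi z.1 (param c z.2))
    (fun v => (tau v, coord c (s v))) u (findim_prod findim_R (findim_rV n)) sz (lflow_smooth fl cx Dx)).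
have := sm_near_im sz (lflow_open fl cx Dx).
by move=> H; apply: nearS (nearI nc H) => v [cv [_]]; rewrite /= coordK.
Qed.

(** The differential of the inverse flow map is a left inverse, by the chain rule. *)
Lemma push_inj c d x t v : cim c x -> D (t, param c x) ->
  dom d (psi t (param c x)) -> push psi c x v d t = 0 -> v = 0.
Proof.
move=> cx Dt dt p0.
have [Di pi] := lflow_inv fl Dt.
set y := coord d (psi t (param c x)).
have cy : cim d y by exact: cim_coord.
have py : param d y = psi t (param c x) by rewrite /y coordK.
have Di' : D (- t, param d y) by rewrite py.
have cc : dom c (psi (- t) (param d y)) by rewrite py pi; exact: dom_param.
have sx (z : 'rV[R]_n) (s : R) : sm (fun z : 'rV[R]_n => (s, z)) z.
  by apply: sm_pair; [exact: sm_cst|exact: sm_id].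
have ss1 : smap (fun z => psi t (param c z)) x.
  exact: (@smap_comp _ _ _ _ (R * 'rV[R]_n)%type (fun z => psi z.1 (param c z.2)) (fun z => (t, z)) x (findim_prod findim_R (findim_rV n)) (sx x t) (lflow_smooth fl cx Dt)).
have ss2 : smap (fun z => psi (- t) (param d z)) y.
  exact: (@smap_comp _ _ _ _ (R * 'rV[R]_n)%type (fun z => psi z.1 (param d z.2)) (fun z => (- t, z)) y (findim_prod findim_R (findim_rV n)) (sx y (- t)) (lflow_smooth fl cy Di')).
have s1 := smap_coord ss1 dt; have s2 := smap_coord ss2 cc.
have := @D_comp _ _ _ _ (fun z => coord c (psi (- t) (param d z))) (fun z => coord d (psi t (param c z))) x v (sm_diff s1) (sm_diff s2).
rewrite -/(push psi c x v d t) p0 derive0 => <-.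
apply/esym; rewrite -[RHS](derive_id x v); apply: D_ext.
have nD := sm_near_im (sx x t) (lflow_open fl cx Dt).
apply: nearS (nearI nD (near_dom (smap_cont ss1) dt)) => z [[/= cz Dz] dz].
by rewrite coordK // (lflow_inv fl Dz).2 paramK.
Qed.

Lemma push_unit_conjugate (I0 : set R) (rho P : R -> M) l : 0 <= l ->
  open_itv I0 -> `[0, l] `<=` I0 ->
  (forall t, I0 t -> D (t, rho t) /\ P t = psi t (rho t)) ->
  unit_conjugate G rho l -> unit_conjugate G' P l.
Proof.
move=> l0 [oI0 iI0] lI0 HP [I [Gam [e0 [[[oI iI] lI] [e00 sG] [ug g0] [vf0 vfl] [t0 t0l vft]]]]].
pose Gs := fun z : R * R => Gam z.1 z.2.
have n0 (t : R) : I t -> `|((0 : R), t).1| < e0 /\ I ((0 : R), t).2.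
  by move=> It; rewrite /= normr0.
(* A uniform strip on which the family is defined, [P] is known, and the flow can be applied. *)
have [|d d0 Hd] := @tube R [set z | [/\ `|z.1| < e0, I z.2, I0 z.2 & D (z.2, Gam z.1 z.2)]] l l0.
  move=> t tl; have Kt : `[0, l]%classic t by rewrite /= in_itv.
  have It := lI _ Kt; have I0t := lI0 _ Kt; have [a0 b0] := n0 t It.
  have sz2 : sm (fun z : R * R => z.2) (0, t) by exact/sm_snd/sm_id.
  have sGt : smap Gs (0, t) by exact: sG.
  have D0 : D (t, Gam 0 t) by rewrite g0 //; exact: (HP t I0t).1.
  have [_ nD] := @smap_flow (R * R)%type (fun z : R * R => z.2) Gs (0, t) (findim_prod findim_R findim_R) sGt sz2 D0.
  have nst : nbhs ((0 : R), t) [set z : R * R | `|z.1| < e0 /\ I z.2].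
    by apply: open_nbhs_nbhs; split; [exact: strip_open|exact: n0].
  have nst' : nbhs ((0 : R), t) [set z : R * R | `|z.1| < 1 /\ I0 z.2].
    by apply: open_nbhs_nbhs; split; [exact: strip_open|rewrite /= normr0].
  by apply: nearS (nearI nD (nearI nst nst')) => z [? [[? ?] [_ ?]]].
pose I' := [set t | - d < t < l + d].
have oI' : open I'.
  rewrite openE => y /= /andP[ay yb].
  by apply: nearS (nearI (lt_nbhsr ay) (lt_nbhsl yb)) => z [az zb]; rewrite /I' /= az zb.
have iI' : is_interval I'.
  move=> a b /= /andP[a1 a2] /andP[b1 b2] y /andP[ay yb].
  by rewrite /I' /= (lt_le_trans a1) // (le_lt_trans yb).
have lI' : `[0, l] `<=` I'.
  move=> t /=; rewrite in_itv /= => /andP[t1 t2].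
  by rewrite /I' /= (lt_le_trans _ t1) ?oppr_lt0 // (le_lt_trans t2) // ltrDl.
have sP z : `|z.1| < d -> I' z.2 -> smap (fun z : R * R => psi z.2 (Gam z.1 z.2)) z.
  move=> z1 z2; have [ze Iz I0z Dz] := Hd z z1 z2.
  have sz2 : sm (fun z : R * R => z.2) z by exact/sm_snd/sm_id.
  exact: (@smap_flow (R * R)%type (fun z : R * R => z.2) Gs z (findim_prod findim_R findim_R) (sG z ze Iz) sz2 Dz).1.
(* At fixed [t] the family is moved by the single map [psi t], so its variation field is moved by an
   injective differential: zeros are preserved and none is created. *)
have vfE t : I' t -> variation_field (fun e t => psi t (Gam e t)) t = 0 <->
    variation_field Gam t = 0.
  move=> I't; have d0t : `|((0 : R), t).1| < d by rewrite /= normr0.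
  have [ze Iz I0z Dz] := Hd (0, t) d0t I't.
  have sGt : smap Gs (0, t) := sG _ ze Iz.
  have ct := chart_atP (Gam 0 t); set c := chart_at _ in ct.
  have dt := chart_atP (psi t (Gam 0 t)); set d' := chart_at _ in dt.
  rewrite (variation_field0 (sP _ d0t I't) dt) (variation_field0 sGt ct).
  have sY := smap_coord sGt ct; have cx := cim_coord ct.
  have Dx : D (t, param c (coord c (Gam 0 t))) by rewrite coordK.
  have dx : dom d' (psi t (param c (coord c (Gam 0 t)))) by rewrite coordK.
  have sPh := smap_coord (lflow_smooth fl cx Dx) dx.
  have sz2 : sm (fun z : R * R => z.2) (0, t) by exact/sm_snd/sm_id.
  have sm2 : sm (fun z : R * R => (z.2, coord c (Gam z.1 z.2))) (0, t) by exact: sm_pair.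
  have E : var_field d' (fun e t => psi t (Gam e t)) t = push psi c (coord c (Gam 0 t)) (var_field c Gam t) d' t.
    rewrite /var_field (@D_ext _ _ _ _ (fun z : R * R => coord d' (psi z.2 (param c (coord c (Gam z.1 z.2)))))); last first.
      by apply: nearS (near_dom (smap_cont sGt) ct) => z cz; rewrite coordK.
    apply: (etrans (@D_comp _ _ _ _ (fun z : R * 'rV[R]_n => coord d' (psi z.1 (param c z.2))) (fun z : R * R => (z.2, coord c (Gam z.1 z.2))) (0, t) (1, 0) (sm_diff sm2) (sm_diff sPh))).
    rewrite (D_pair _ (sm_diff sz2) (sm_diff sY)).
    have -> : 'D_(1, 0) (fun z : R * R => z.2) (0, t) = 0.
      by apply: (@D_clin _ _ _ snd); exact: continuous_snd.
    by rewrite (D_slice2 (fun z : R * 'rV[R]_n => coord d' (psi z.1 (param c z.2)))).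
  rewrite E; split=> [|->]; first exact: push_inj.
  by rewrite /push derive0.
have ug' e : `|e| < d -> unit_geodesic G' I' (fun t => psi t (Gam e t)).
  move=> ed; have K t (I't : I' t) := Hd (e, t) ed I't.
  have ee0 : `|e| < e0.
    by have [] := K 0 (lI' 0 _) => //; rewrite /= in_itv /= lexx.
  apply: (zermelo_geodesic mG mG' vU rel fl inv oI'); last by move=> t /K[].
  apply: (unit_geodesic_sub mG oI oI') (ug e ee0).
  by move=> t /K[].
have I0' : I' 0 by apply: lI'; rewrite /= in_itv /= lexx.
have Il' : I' l by apply: lI'; rewrite /= in_itv /= lexx andbT.
exists I', (fun e t => psi t (Gam e t)), d; split.
- by split; [split|].
- by split.
- split; first exact: ug'.
  move=> t I't; have [_ It I0t _] := Hd (0, t) (eq_ind_r (fun a => a < d) d0 (normr0 R)) I't.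
  by rewrite g0 // (HP t I0t).2.
- by split; [apply/(vfE 0 I0')|apply/(vfE l Il')].
- have It0 : I' t0 by apply: lI'; rewrite /= in_itv.
  by exists t0; [exact: t0l|apply: contra_neq vft => H; apply/(vfE t0 It0)].
Qed.

End PushConjugate.
End Conjugate.

(** * Momentum of a variation through geodesics *)

Section MomentumOfVariations.
Context {R : realType} {n : nat} {M : manifold R n}.
Variables (F : chart M -> 'rV[R]_n * 'rV[R]_n -> R).
Hypothesis (mF : metric F).
Implicit Types (c d : chart M).

Lemma speed_ext (g g' : R -> M) t : (\near t, g t = g' t) -> speed F g t = speed F g' t.
Proof.
move=> gg; have gt := nbhs_singleton gg; rewrite /speed gt; congr (F _ (_, _)).
rewrite !velE; apply: D_ext.
by apply: nearS gg => u ->.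
Qed.

Variables (I : set R) (Gam : R -> R -> M) (e0 : R).
Hypotheses (oI : open_itv I) (I0 : I 0) (e00 : 0 < e0).
Hypothesis (sG : forall z : R * R, `|z.1| < e0 -> I z.2 ->
  smap (fun z : R * R => Gam z.1 z.2) z).
Hypothesis (gG : forall e, `|e| < e0 -> geodesic F I (Gam e)).

(** Each geodesic of the family has constant speed, so reading it at time 0 gives a function of [e]
    alone. *)
Definition speed0 (e : R) := speed F (Gam e) 0.

Lemma speed0E e t : `|e| < e0 -> I t -> speed F (Gam e) t = speed0 e.
Proof. by move=> ee It; apply: (geodesic_speed mF oI (gG ee)). Qed.

Lemma family_vel e t c : `|e| < e0 -> I t -> dom c (Gam e t) ->
  'D_1 (ccoord c (Gam e)) t != 0.
Proof. by move=> ee It ct; have [_ H] := (geodesicP mF _ oI.1).1 (gG ee); case: (H c t It ct). Qed.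

Lemma near_strip (z : R * R) : `|z.1| < e0 -> I z.2 ->
  \near z, `|z.1| < e0 /\ I z.2.
Proof.
move=> z1 z2; have [oI' _] := oI.
by apply: open_nbhs_nbhs; split; [exact: strip_open|].
Qed.

Lemma speed0_sm e : `|e| < e0 -> sm speed0 e.
Proof.
move=> ee; have sS : sm (fun z => speed F (Gam z.1) z.2) (e, (0 : R)).
  by apply: sm_speed_family => //; [exact: sG|move=> c ct; exact: family_vel].
exact: (sm_slice1 findim_R findim_R sS).
Qed.

Hypothesis (u0 : forall t, I t -> speed F (Gam 0) t = 1).

Let n00 : `|0 : R| < e0. Proof. by rewrite normr0. Qed.

(** The momentum of the central geodesic paired with the variation field: at unit speed it detects
    the tangential part of the field. *)
Definition momentum (t : R) : R :=
  let c := chart_at (Gam 0 t) in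
  'D_(0, var_field c Gam t) (F c) (ccoord c (Gam 0) t, 'D_1 (ccoord c (Gam 0)) t).

Lemma central_smap t : I t -> smap (Gam 0) t.
Proof. by move=> It; have [H _] := (geodesicP mF _ oI.1).1 (gG n00); exact: H. Qed.

Lemma momentumE t c : I t -> dom c (Gam 0 t) -> momentum t =
  'D_(0, var_field c Gam t) (F c) (ccoord c (Gam 0) t, 'D_1 (ccoord c (Gam 0)) t).
Proof.
move=> It ct; rewrite /momentum; have dt := chart_atP (Gam 0 t); set d := chart_at _ in dt *.
have sGt : smap (fun z : R * R => Gam z.1 z.2) (0, t) by exact: sG.
have xD : 'D_1 (ccoord d (Gam 0)) t = dtrans c d (Gam 0 t) ('D_1 (ccoord c (Gam 0)) t).
  exact: (D_chart _ (central_smap It) ct dt).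
rewrite (var_field_chart sGt ct dt) xD.
exact: (momentum_chart _ mF ct dt (family_vel n00 It ct)).
Qed.

(* By the first variation formula; so a Jacobi field vanishing at both ends
   comes from a variation of stationary speed. *)
Lemma momentum_D t : I t -> is_derive t 1 momentum ('D_1 speed0 0).
Proof.
move=> It; have [oI' _] := oI.
have ct := chart_atP (Gam 0 t); set c := chart_at _ in ct.
have sGt : smap (fun z : R * R => Gam z.1 z.2) (0, t) by exact: sG.
set Y := fun z : R * R => coord c (Gam z.1 z.2).
have sY : sm Y (0, t) by exact: smap_coord sGt ct.
set x := ccoord c (Gam 0).
have sx : sm x t by exact: smap_coord (central_smap It) ct.
have v0 : 'D_1 x t != 0 by exact: family_vel.
have cx : cim c (x t) by exact: cim_coord.
have ELx : EL (F c) x t.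
  have ug : unit_geodesic F I (Gam 0) := conj (gG n00) u0.
  have [_ _ [c' _ H]] := (unit_geodesicP mF _ oI').1 ug t It.
  exact: H.
have nI : nbhs t I by exact: open_nbhs_nbhs.
have nE : \near t, 'D_(0, 'D_(1, 0) Y (0, t)) (F c) (x t, 'D_1 x t) = momentum t.
  apply: nearS (nearI nI (near_dom (smap_cont (central_smap It)) ct)) => u [Iu cu].
  by rewrite (momentumE Iu cu).
apply: (near_eq_is_derive nE).
have sp : sm (fun u : R => ((0 : R), u)) t by apply: sm_pair; [exact: sm_cst|exact: sm_id].
have sYe : sm (fun u => 'D_(1, 0) Y (0, u)) t.
  exact: (@sm_comp _ _ _ _ (fun z => 'D_(1, 0) Y z) (fun u : R => (0, u)) t (findim_prod findim_R findim_R) sp (sm_D _ sY)).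
have sFx := metric_sm mF cx v0.
apply: DeriveDef.
  apply/diff_derivable/sm_diff.
  apply: (@sm_Ddir _ _ _ _ (F c) (fun u => (x u, 'D_1 x u)) (fun u => (0, 'D_(1, 0) Y (0, u)))) => //.
    exact: D_sm_curve.
  by apply: sm_pair => //; exact: sm_cst.
have Yx : \near t, Y (0, t) = x t by exact: nearT.
rewrite (first_variation sx sFx ELx sY Yx) -(@D_slice1 _ R R R (fun z => speed0 z.1) 0 t).
apply: D_ext.
have n00t : `|((0 : R), t).1| < e0 by [].
apply: nearS (nearI (near_strip n00t It) (near_dom (smap_cont sGt) ct)) => -[e u] /= [[ee Iu] cu].
rewrite -(speed0E ee Iu) (D_slice2 Y).
have sGe : smap (Gam e) u by have [H _] := (geodesicP mF _ oI').1 (gG ee); exact: H.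
by rewrite (speed_ccoord mF sGe cu).
Qed.

(** An affine function with zeros at 0 and [l] is zero. Its vanishing excludes that a nonzero value
    of the field is a multiple of the velocity. *)
Lemma momentum_eq0 l : 0 < l -> I l -> variation_field Gam 0 = 0 ->
  variation_field Gam l = 0 ->
  'D_1 speed0 0 = 0 /\ forall t, I t -> momentum t = 0.
Proof.
move=> l0 Il; rewrite !variation_fieldE => v0 vl.
have m0 : momentum 0 = 0 by rewrite /momentum v0 derive0.
have ml : momentum l = 0 by rewrite /momentum vl derive0.
set k := 'D_1 speed0 0.
have C : forall a b, I a -> I b -> momentum a - k * a = momentum b - k * b.
  apply: (derive0_constant (g := fun t => momentum t - k * t) oI.2) => t It.
  have [d1 E1] := momentum_D It.
  have dl : derivable (fun t : R => k *: t) t 1.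
    by apply: derivableZ; exact: derivable_id.
  apply: DeriveDef; first exact: derivableB.
  rewrite [LHS]deriveB // E1 -/k.
  have -> : 'D_1 ( *%R k) t = k *: 'D_1 (fun t : R => t) t.
    by apply: (@D_scale_cst _ R R k (fun t : R => t) t 1).
  by rewrite derive_id -[k *: 1]/(k * 1) mulr1 subrr.
have k0 : k = 0.
  have := C 0 l I0 Il; rewrite m0 ml mulr0 subr0 sub0r => /esym/eqP.
  by rewrite oppr_eq0 mulf_eq0 (gt_eqF l0) orbF => /eqP.
split; first exact: k0.
move=> t It; have := C t 0 It I0; rewrite m0 mulr0 subr0.
have -> : k * t = 0 by rewrite k0 mul0r.
by rewrite subr0.
Qed.

End MomentumOfVariations.

(** * Conjugate points under an exact change of metric *)

Section ReparamConjugate.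
Context {R : realType} {n : nat} {M : manifold R n}.
Variables (F F' : chart M -> 'rV[R]_n * 'rV[R]_n -> R) (f : M -> R).
Hypotheses (mF : metric F) (mF' : metric F') (sf : smooth_fun f).
Hypothesis (FF' : forall c x y, cim c x ->
  F' c (x, y) = F c (x, y) + 'D_y (fun x => f (param c x)) x).
Implicit Types (c d : chart M).

Lemma geodesic_speed'_gt0 (I : set R) g t : open I -> geodesic F I g -> I t ->
  0 < speed F' g t.
Proof.
move=> oI /(geodesicP mF _ oI)[sg H] It; have ct := chart_atP (g t).
rewrite (speed_ccoord mF' (sg t It) ct); have [v0 _] := H _ t It ct.
by apply: (metric_pos mF') => //; exact: cim_coord.
Qed.

Lemma arc_length_increasing (J : set R) (g : R -> M) (cc k : R) : open J ->
  geodesic F J g -> (forall u, J u -> speed F g u = cc) ->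
  forall u, J u -> [/\ sm (fun u => cc * u + f (g u) - k) u,
    'D_1 (fun u => cc * u + f (g u) - k) u = speed F' g u & 0 < speed F' g u].
Proof.
move=> oJ gg Scc u Ju; have [sg _] := (geodesicP mF _ oJ).1 gg.
have [sfg SE] := arc_length_D mF mF' sf FF' (sg u Ju).
have sl : sm (fun u : R => cc * u) u by apply: sm_mul; [exact: sm_cst|exact: sm_id].
have slf : sm (fun u : R => cc * u + f (g u)) u by exact: sm_add.
have sk : sm (fun _ : R => k) u by exact: sm_cst.
split; first exact: (sm_sub slf sk).
  rewrite [LHS]deriveB; [|exact/diff_derivable/sm_diff|exact: derivable_cst].
  rewrite derive_cst subr0 [LHS]deriveD; [|exact/diff_derivable/sm_diff|exact/diff_derivable/sm_diff].
  rewrite SE Scc //; congr (_ + _).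
  apply: (etrans (@D_scale_cst _ R R cc (fun u : R => u) u 1 _)) => //.
  by rewrite derive_id -[cc *: 1]/(cc * 1) mulr1.
exact: (geodesic_speed'_gt0 oJ gg Ju).
Qed.

(** All geodesics of the variation are reparametrized by [F']-arc length from time 0. This adds a
    multiple of the velocity to the variation field. The multiple vanishes where the field does,
    since the speed is stationary; it cannot cancel a nonzero value of the field, since the momentum
    is zero. *)
Lemma reparam_unit_conjugate (I0 J : set R) (g rho : R -> M) (s : R -> R) (l l' : R) :
  open_itv J -> J 0 -> unit_geodesic F J g ->
  open_itv I0 -> I0 0 -> I0 l' -> 0 < l' -> s l' = l ->
  (forall t, I0 t -> [/\ J (s t), s t + f (g (s t)) - f (g 0) = t & rho t = g (s t)]) ->
  conjugate F g l -> unit_conjugate F' rho l'.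
Proof.
move=> oiJ J0 ugJ oiI0 I00 I0l' l'0 sl' Hs.
move=> [I1 [Gam [oiI1 lI1 [e0 e00 [sG gG g0]] [vf0 vfl] [v1 v1l vfv]]]].
have [oJ iJ] := oiJ; have [oI1 iI1] := oiI1; have [oI0 iI0] := oiI0.
have [gJ S1J] := ugJ.
have n00 : `|0 : R| < e0 by rewrite normr0.
have {}sG (z : R * R) : `|z.1| < e0 -> I1 z.2 -> smap (fun z : R * R => Gam z.1 z.2) z.
  move=> z1 z2; have sG' := (smooth_mapP (fun z : R * R => Gam z.1 z.2) (@strip_open _ I1 e0 oI1)).1 sG.
  exact: (sG' z (conj z1 z2)).
have Jl : J l by rewrite -sl'; have [] := Hs l' I0l'.
(* [F']-arc length along [g]; it is increasing and inverse to [s]. *)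
pose Tg u : R := 1 * u + f (g u) - f (g 0).
have HTg := arc_length_increasing (f (g 0)) oJ gJ S1J.
have Tg_mono a b : J a -> J b -> (Tg a < Tg b) = (a < b).
  apply: (derive_gt0_lt (dg := fun u => 'D_1 Tg u) iJ) => u /HTg[sT DT T0].
    by apply: DeriveDef => //; exact/diff_derivable/sm_diff.
  by rewrite DT.
have Tgs t : I0 t -> Tg (s t) = t by move=> /Hs[_ + _]; rewrite /Tg mul1r.
have Tg0 : Tg 0 = 0 by rewrite /Tg mulr0 add0r subrr.
have Tgl : Tg l = l' by rewrite -sl' Tgs.
have l0 : 0 < l by rewrite -(Tg_mono 0 l) // Tg0 Tgl.
have Tg_inj a b : J a -> J b -> Tg a = Tg b -> a = b.
  move=> Ja Jb E; apply/eqP; rewrite eq_le !leNgt -(Tg_mono a b) // -(Tg_mono b a) // E.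
  by rewrite ltxx.
have Tg_le a b : J a -> J b -> a <= b -> Tg a <= Tg b.
  by move=> Ja Jb ab; rewrite leNgt (Tg_mono b a) // -leNgt.
have s0 : s 0 = 0 by apply: Tg_inj => //; [case: (Hs 0 I00)|rewrite Tgs].
have I1l : I1 l by apply: lI1; rewrite /= in_itv /= lexx ltW.
have I10 : I1 0 by apply: lI1; rewrite /= in_itv /= lexx ltW.
pose K : set R := I1 `&` J.
have oK : open K by exact: openI.
have iK : is_interval K.
  by move=> a b [a1 a2] [b1 b2] y ayb; split; [exact: (iI1 a b)|exact: (iJ a b)].
pose cs := speed0 F Gam.
(* [F']-arc length along [Gam e] from its point at time 0, where [cs e] is the constant
   [F]-speed. *)
pose T (z : R * R) : R := cs z.1 * z.2 + f (Gam z.1 z.2) - f (Gam z.1 0).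
have cs1 : cs 0 = 1.
  have n1 : nbhs (0 : R) I1 by exact: open_nbhs_nbhs.
  have E' : \forall u \near (0 : R), Gam 0 u = g u by apply: nearS n1 => u; exact: g0.
  by rewrite /cs /speed0 (speed_ext F E') S1J.
have u1 t : I1 t -> speed F (Gam 0) t = 1.
  by move=> It; rewrite (speed0E mF oiI1 I10 gG n00 It).
have [Dcs q0] := momentum_eq0 mF oiI1 I10 e00 sG gG u1 l0 I1l vf0 vfl.
have sFam (z : R * R) : `|z.1| < e0 -> I1 z.2 -> sm (fun z : R * R => f (Gam z.1 z.2)) z.
  by move=> z1 z2; apply: (smooth_fun_smap sf (s := fun z : R * R => Gam z.1 z.2)); exact: sG.
have sz1 (z : R * R) : sm (fun z : R * R => z.1) z by exact/sm_fst/sm_id.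
have sz2 (z : R * R) : sm (fun z : R * R => z.2) z by exact/sm_snd/sm_id.
have sz10 (z : R * R) : sm (fun z : R * R => (z.1, 0 : R)) z.
  by apply: sm_pair => //; exact: sm_cst.
have sFam0 (z : R * R) : `|z.1| < e0 -> sm (fun z : R * R => f (Gam z.1 0)) z.
  move=> z1; apply: (@sm_comp _ _ _ _ (fun z : R * R => f (Gam z.1 z.2)) (fun z => (z.1, 0))) => //.
  exact: sFam.
have scs (z : R * R) : `|z.1| < e0 -> sm (fun z : R * R => cs z.1) z.
  move=> z1; apply: (@sm_comp _ _ _ _ cs (fun z : R * R => z.1)) => //.
  exact: (speed0_sm mF oiI1 I10 sG gG z1).
have smT (z : R * R) : `|z.1| < e0 -> I1 z.2 -> sm T z.
  move=> z1 z2; apply: sm_sub; last exact: sFam0.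
  apply: sm_add; last exact: sFam.
  by apply: sm_mul; [exact: scs|exact: sz2].
have DT (e u : R) : `|e| < e0 -> I1 u ->
    'D_(0, 1) T (e, u) = speed F' (Gam e) u /\ 0 < speed F' (Gam e) u.
  move=> ee Iu.
  have ce t : I1 t -> speed F (Gam e) t = cs e by move=> It; exact: (speed0E mF oiI1 I10 gG ee It).
  have [_ E P] := arc_length_increasing (f (Gam e 0)) oI1 (gG e ee) ce Iu.
  by rewrite D_slice2.
have T0E u : K u -> T (0, u) = Tg u.
  by move=> [Iu Ju]; rewrite /T /Tg /= cs1 !g0.
(* Room on both sides of [[0, l]]: for small [e] the values of [T (e, .)] between [a] and [b] cover
   a neighbourhood of [[0, l']]. *)
have [a [b [Ka Kb a0 lb]]] : exists a b, [/\ K a, K b, a < 0 & l < b].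
  have K0 : K 0 by []. have Kl : K l by [].
  have /nbhs_ballP[r /= r0 Hr] : nbhs (0 : R) K by exact: open_nbhs_nbhs.
  have /nbhs_ballP[r' /= r'0 Hr'] : nbhs l K by exact: open_nbhs_nbhs.
  exists (- (r / 2)), (l + r' / 2); split.
  - apply: Hr; rewrite /ball /= opprK add0r gtr0_norm ?divr_gt0 //.
    by rewrite ltr_pdivrMr // ltr_pMr // ltr1n.
  - apply: Hr'; rewrite /ball /= opprD addNKr normrN gtr0_norm ?divr_gt0 //.
    by rewrite ltr_pdivrMr // ltr_pMr // ltr1n.
  - by rewrite oppr_lt0 divr_gt0.
  - by rewrite ltrDl divr_gt0.
have Ta : T (0, a) < 0 by rewrite T0E // -Tg0 (Tg_mono a 0) //; case: Ka.
have Tb : l' < T (0, b) by rewrite T0E // -Tgl (Tg_mono l b) //; case: Kb.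
have ab : a <= b by rewrite ltW // (lt_trans a0) // (lt_trans l0).
have abK u : a <= u <= b -> K u by move=> ?; exact: (iK a b).
have [d0 d00 Hd0] : exists2 d0 : R, 0 < d0 & forall e : R, `|e| < d0 ->
    T (e, a) < T (0, a) / 2 /\ (T (0, b) + l') / 2 < T (e, b).
  have sa : sm (fun e : R => T (e, a)) 0.
    by apply: (sm_slice1 findim_R findim_R); apply: smT => //; case: Ka.
  have sb : sm (fun e : R => T (e, b)) 0.
    by apply: (sm_slice1 findim_R findim_R); apply: smT => //; case: Kb.
  have ha : T (0, a) < T (0, a) / 2 by lra.
  have hb : (T (0, b) + l') / 2 < T (0, b) by lra.
  have := nearI (sm_near_im sa (lt_nbhsl ha)) (sm_near_im sb (lt_nbhsr hb)).
  move=> /nbhs_ballP[r /= r0 Hr]; exists r => // e er; apply: Hr.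
  by rewrite /ball /= sub0r normrN.
(* The last two bounds give [T (0, a) / 2 <= - d] and [l' + d <= (T (0, b) + l') / 2], so
   intermediate values reach every time in [I']. *)
pose d := Num.min (Num.min d0 e0) (Num.min (- T (0, a) / 2) ((T (0, b) - l') / 2)).
have dp : 0 < d.
  by rewrite !lt_min d00 e00 !divr_gt0 // ?oppr_gt0 // subr_gt0.
have [dd0 de0 da db] : [/\ d <= d0, d <= e0, d <= - T (0, a) / 2 & d <= (T (0, b) - l') / 2].
  by split; rewrite !ge_min lexx ?orbT.
pose I' : set R := [set t | - d < t < l' + d] `&` I0.
have oI' : open I'.
  apply: openI => //; rewrite openE => y /= /andP[ay yb].
  by apply: nearS (nearI (lt_nbhsr ay) (lt_nbhsl yb)) => z [az zb] /=; rewrite az zb.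
have iI' : is_interval I'.
  move=> x y [/= /andP[a1 a2] x0] [/= /andP[b1 b2] y0] z xzy; split; last exact: (iI0 x y).
  by have /andP[xz zy] := xzy; rewrite /= (lt_le_trans a1) // (le_lt_trans zy).
have lI' : `[0, l'] `<=` I'.
  move=> t /=; rewrite in_itv /= => t0l'; have /andP[t1 t2] := t0l'.
  split; last exact: (iI0 0 l').
  by rewrite /= (lt_le_trans _ t1) ?oppr_lt0 // (le_lt_trans t2) // ltrDl.
have ex (z : R * R) : `|z.1| < d -> I' z.2 -> exists u, a <= u <= b /\ T (z.1, u) = z.2.
  move=> zd [/= /andP[z2 z2'] _].
  have ze : `|z.1| < e0 by exact: lt_le_trans de0.
  have [Tea Teb] := Hd0 z.1 (lt_le_trans zd dd0).
  have [||u uab Tu] := @IVT_sm _ (fun u => T (z.1, u)) a b z.2 ab; last by exists u.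
    move=> u /abK[Iu _]; exact: (sm_slice2 findim_R findim_R (smT (z.1, u) ze Iu)).
  by apply/andP; split; lra.
(* The default 0 is only taken where the equation has no solution in [[a, b]], hence never on the
   strip. *)
pose S (z : R * R) : R := xget 0 [set u | a <= u <= b /\ T (z.1, u) = z.2].
have HS (z : R * R) : `|z.1| < d -> I' z.2 -> a <= S z <= b /\ T (z.1, S z) = z.2.
  by move=> zd z2; have [u Hu] := ex z zd z2; exact: (@xgetPex _ 0 [set u | a <= u <= b /\ T (z.1, u) = z.2] (ex_intro _ u Hu)).
have KS (z : R * R) : `|z.1| < d -> I' z.2 -> K (S z) by move=> zd z2; apply: abK; case: (HS z zd z2).
have nst (z : R * R) : `|z.1| < d -> I' z.2 -> \forall z \near z, `|z.1| < d /\ I' z.2.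
  move=> zd z2; have oz : open_nbhs z [set z : R * R | `|z.1| < d /\ I' z.2].
    by split; [exact: (@strip_open _ I' d oI')|].
  exact: (open_nbhs_nbhs oz).
have smS (z : R * R) : `|z.1| < d -> I' z.2 -> sm S z.
  move=> zd z2; apply: (@inverse_family _ T S z K (conj oK iK)).
  apply: nearS (nst z zd z2) => y [yd y2]; have [_ Ty] := HS y yd y2.
  split=> //; first exact: KS.
  move=> u [Iu Ju]; have ye := lt_le_trans yd de0.
  by have [E P] := DT y.1 u ye Iu; split; [exact: smT|rewrite E].
have nd0 : `|0 : R| < d by rewrite normr0.
have S0 t : I' t -> S (0, t) = s t.
  move=> I't; have [_ TS] := HS (0, t) nd0 I't; have KSt := KS (0, t) nd0 I't.
  have [Jst _ _] := Hs t I't.2; apply: Tg_inj => //; first by case: KSt.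
  by rewrite -T0E // TS Tgs //; case: I't.
pose Rv e t := Gam e (S (e, t)).
have smS1 (z : R * R) : `|z.1| < d -> I' z.2 -> sm (fun z => (z.1, S z)) z.
  by move=> zd z2; apply: sm_pair => //; exact: smS.
have sRv (z : R * R) : `|z.1| < d -> I' z.2 -> smap (fun z : R * R => Rv z.1 z.2) z.
  move=> zd z2; have ye := lt_le_trans zd de0.
  have sGz : smap (fun z : R * R => Gam z.1 z.2) (z.1, S z) by apply: sG => //; case: (KS z zd z2).
  have := @smap_comp _ _ _ _ _ (fun z : R * R => Gam z.1 z.2) (fun z => (z.1, S z)) z (findim_prod findim_R findim_R) (smS1 z zd z2) sGz.
  by apply: smap_ext; apply: nearT => -[].
(* The variation field of the reparametrized family at [t] is that of [Gam] at
   [s t], corrected by a multiple of the velocity. *)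
have vfE t c : I' t -> dom c (Gam 0 (s t)) -> exists k : R,
    [/\ var_field c Rv t = var_field c Gam (s t) + k *: 'D_1 (ccoord c (Gam 0)) (s t),
        speed F' (Gam 0) (s t) * k = - 'D_(var_field c Gam (s t)) (fun x => f (param c x)) (coord c (Gam 0 (s t))) &
        K (s t)].
  move=> I't cc; exists ('D_(1, 0) S (0, t)).
  have St := S0 t I't; have Ks : K (s t) by rewrite -St; exact: KS.
  have [Is Js] := Ks.
  have sGs : smap (fun z : R * R => Gam z.1 z.2) (0, s t) by exact: sG.
  have sY := smap_coord sGs cc; set Y := (fun z : R * R => coord c (Gam z.1 z.2)) in sY.
  have sSt := smS (0, t) nd0 I't; have sS1 := smS1 (0, t) nd0 I't.
  have D1z : 'D_(1, 0) (fun z : R * R => (z.1, S z)) (0, t) = (1, 'D_(1, 0) S (0, t)).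
    rewrite (D_pair _ (sm_diff (sz1 _)) (sm_diff sSt)); congr pair.
    by apply: (@D_clin _ _ _ fst); exact: continuous_fst.
  split=> //.
  - have sY' : sm Y ((0 : R, t).1, S (0, t)) by rewrite St.
    have := @D_comp _ _ _ _ Y (fun z : R * R => (z.1, S z)) (0, t) (1, 0) (sm_diff sS1) (sm_diff sY').
    rewrite D1z /= St (D_pair_dir _ _ (sm_diff sY)).
    have -> : (0, 'D_(1, 0) S (0, t)) = 'D_(1, 0) S (0, t) *: (0, 1) :> R * R.
      by congr pair; rewrite /= ?scaler0 // -[_ *: 1]/(_ * 1) mulr1.
    rewrite (D_scale_dir _ _ (sm_diff sY)) (@D_slice2 _ _ _ _ Y 0 (s t) 1) => <-.
    by apply: D_ext; apply: nearT => -[].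
  - have sT : sm T ((0 : R, t).1, S (0, t)) by rewrite St; exact: smT.
    have := @D_comp _ _ _ _ T (fun z : R * R => (z.1, S z)) (0, t) (1, 0) (sm_diff sS1) (sm_diff sT).
    have -> : 'D_(1, 0) (fun z : R * R => T (z.1, S z)) (0, t) = 0.
      rewrite (@D_ext _ _ _ _ (fun z : R * R => z.2)).
        by apply: (@D_clin _ _ _ snd); exact: continuous_snd.
      by apply: nearS (nst (0, t) nd0 I't) => y [yd y2]; have [] := HS y yd y2.
    rewrite D1z /= St in sT *; rewrite (D_pair_dir _ _ (sm_diff sT)).
    have -> : (0, 'D_(1, 0) S (0, t)) = 'D_(1, 0) S (0, t) *: (0, 1) :> R * R.
      by congr pair; rewrite /= ?scaler0 // -[_ *: 1]/(_ * 1) mulr1.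
    rewrite (D_scale_dir _ _ (sm_diff sT)) (DT 0 (s t) n00 Is).1.
    (* The speed is stationary at [e = 0] and the field vanishes at time 0, so of the three terms of
       [T] only [f (Gam e u)] contributes. *)
    have -> : 'D_(1, 0) T (0, s t) = 'D_(var_field c Gam (s t)) (fun x => f (param c x)) (coord c (Gam 0 (s t))).
      have sA := scs (0, s t) n00; have sA2 := sm_mul sA (sz2 (0, s t)).
      have sB := sFam (0, s t) n00 Is; have sC := sFam0 (0, s t) n00.
      have sAB := sm_add sA2 sB.
      rewrite /T [LHS]deriveB; [|exact/diff_derivable/sm_diff|exact/diff_derivable/sm_diff].
      rewrite [X in X - _]deriveD; [|exact/diff_derivable/sm_diff|exact/diff_derivable/sm_diff].
      have -> : 'D_(1, 0) (fun z : R * R => cs z.1 * z.2) (0, s t) = 0.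
        rewrite (D_mul _ (sm_diff sA) (sm_diff (sz2 _))).
        have -> : 'D_(1, 0) (fun z : R * R => z.2) (0, s t) = 0.
          by apply: (@D_clin _ _ _ snd); exact: continuous_snd.
        by rewrite (@D_slice1 _ R R R (fun z => cs z.1)) Dcs mulr0 mul0r addr0.
      have -> : 'D_(1, 0) (fun z : R * R => f (Gam z.1 0)) (0, s t) = 0.
        have sG0 : smap (fun z : R * R => Gam z.1 z.2) (0, 0) by exact: sG.
        have c0 := chart_atP (Gam 0 0).
        have E0 := @D_smooth_fun _ _ _ f (R * R)%type (fun z : R * R => Gam z.1 z.2) (0, 0) (1, 0) _ sf sG0 c0.
        have Dz : 'D_(1, 0) (fun z : R * R => f (Gam z.1 z.2)) (0, 0) =
            'D_(1, 0) (fun z : R * R => f (Gam z.1 0)) (0, s t).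
          by rewrite (@D_slice1 _ R R R (fun z => f (Gam z.1 z.2))) (@D_slice1 _ R R R (fun z => f (Gam z.1 0))).
        rewrite -Dz E0.
        have -> : 'D_(1, 0) (fun z : R * R => coord (chart_at (Gam 0 0)) (Gam z.1 z.2)) (0, 0) = 0.
          by rewrite -/(var_field _ Gam 0) -variation_fieldE.
        exact: derive0.
      by rewrite add0r subr0 (@D_smooth_fun _ _ _ f (R * R)%type (fun z : R * R => Gam z.1 z.2) (0, s t) (1, 0) _ sf sGs cc).
    rewrite -[_ *: _]/(_ * _) mulrC => /esym/eqP.
    by rewrite addrC addr_eq0 => /eqP ->.
have sRv0 t : I' t -> smap (fun z : R * R => Rv z.1 z.2) (0, t) by move=> I't; exact: sRv.
have Rv0 t : I' t -> Rv 0 t = Gam 0 (s t) by move=> I't; rewrite /Rv S0.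
have vz t : I' t -> variation_field Gam (s t) = 0 -> variation_field Rv t = 0.
  move=> I't vt; have cc := chart_atP (Gam 0 (s t)); set c := chart_at _ in cc.
  have [k [E1 E2 [Is Js]]] := vfE t c I't cc.
  have v0 : var_field c Gam (s t) = 0.
    by apply: ((variation_field0 _ cc).1 vt); exact: sG.
  rewrite v0 derive0 oppr0 in E2.
  have k0 : k = 0.
    have [_ P] := DT 0 (s t) n00 Is.
    by move/eqP: E2; rewrite mulf_eq0 (gt_eqF P) => /eqP.
  have cc' : dom c (Rv 0 t) by rewrite Rv0.
  apply: ((variation_field0 (sRv0 t I't) cc').2).
  by rewrite E1 v0 k0 scale0r addr0.
have I'0 : I' 0 by apply: lI'; rewrite /= in_itv /= lexx ltW.
have I'l : I' l' by apply: lI'; rewrite /= in_itv /= lexx ltW.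
exists I', Rv, d; split.
- by split; [split|].
- by split.
- split=> [e ed|t I't]; last first.
    have Ks : K (s t) by rewrite -S0 //; exact: KS.
    rewrite Rv0 //; have [_ _ ->] := Hs t I't.2.
    by rewrite g0 //; case: Ks.
  have ee := lt_le_trans ed de0.
  have ce t : I1 t -> speed F (Gam e) t = cs e by move=> It; exact: (speed0E mF oiI1 I10 gG ee It).
  apply: (reparam_geodesic mF mF' sf FF' (s := fun t => S (e, t)) (k := f (Gam e 0)) oI1 (gG e ee) ce oI') => t I't.
  have [_ TS] := HS (e, t) ed I't; have [IS _] := KS (e, t) ed I't.
  split=> //; exact: (sm_slice2 findim_R findim_R (smS (e, t) ed I't)).
- split; [apply: (vz 0 I'0)|apply: (vz l' I'l)]; first by rewrite s0; exact: vf0.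
  by rewrite sl'; exact: vfl.
- have Jv : J v1 by apply: (iJ 0 l).
  have Iv : I1 v1 by apply: (iI1 0 l).
  (* The time whose reparametrized value is [v1], where the given field is not zero. *)
  pose t := Tg v1.
  have tl : 0 <= t <= l'.
    have /andP[v10 v1l'] := v1l.
    by rewrite -[X in X <= _]Tg0 -Tgl; apply/andP; split; exact: Tg_le.
  have I't : I' t by apply: lI'; rewrite /= in_itv.
  have st : s t = v1.
    by have [Jst _ _] := Hs t I't.2; apply: Tg_inj => //; rewrite Tgs //; case: I't.
  exists t; first exact: tl.
  apply: contra_neq vfv => vt.
  have cc := chart_atP (Gam 0 v1); set c := chart_at _ in cc.
  have cc1 : dom c (Gam 0 (s t)) by rewrite st.
  have cc' : dom c (Rv 0 t) by rewrite Rv0.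
  have [k [E1 _ _]] := vfE t c I't cc1.
  have v0 := (variation_field0 (sRv0 t I't) cc').1 vt.
  rewrite v0 st in E1.
  (* If the new field vanished, the old one would be tangential, and its zero momentum would force
     [k = 0]. *)
  have {}E1 : var_field c Gam v1 = (- k) *: 'D_1 (ccoord c (Gam 0)) v1.
    by rewrite scaleNr; apply/eqP; rewrite -addr_eq0 -E1.
  have cx := cim_coord cc.
  have vel0 : 'D_1 (ccoord c (Gam 0)) v1 != 0 by exact: (family_vel mF oiI1 gG n00 Iv cc).
  have sFx := metric_sm mF cx vel0.
  have := q0 v1 Iv; rewrite (momentumE mF oiI1 e00 sG gG Iv cc) E1.
  have -> : (0, (- k) *: 'D_1 (ccoord c (Gam 0)) v1) = (- k) *: (0, 'D_1 (ccoord c (Gam 0)) v1) :> 'rV[R]_n * 'rV[R]_n.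
    by congr pair; rewrite /= scaler0.
  rewrite (D_scale_dir _ _ (sm_diff sFx)) (euler mF cx vel0).
  have -> : F c (coord c (Gam 0 v1), 'D_1 (ccoord c (Gam 0)) v1) = 1.
    have sGv : smap (Gam 0) v1 by have [H _] := (geodesicP mF _ oI1).1 (gG 0 n00); exact: H.
    by have := speed_ccoord mF sGv cc; rewrite u1.
  rewrite -[_ *: 1]/(_ * 1) mulr1 => k0.
  apply: ((variation_field0 _ cc).2); first exact: sG.
  by rewrite E1 k0 scale0r.
Qed.

End ReparamConjugate.

(** * Lengths of paths *)

Section HFormSmooth.
Context {R : realType} {n : nat} {M : manifold R n}.
Variables (h : chart M -> 'rV[R]_n -> 'M[R]_n).
Hypothesis hh : riemannian h.

Lemma sm_hform (E : normedModType R) c (x v w : E -> 'rV[R]_n) u : cim c (x u) ->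
  sm x u -> sm v u -> sm w u -> sm (fun u => hform h c (x u) (v u) (w u)) u.
Proof.
move=> cx sx sv sw.
have -> : (fun u => hform h c (x u) (v u) (w u)) =
    (fun u => \sum_i \sum_j v u 0 i * h c (x u) i j * w u 0 j).
  by apply/funext => y; rewrite /hform formE.
apply: sm_sum => i; apply: sm_sum => j; apply: sm_mul; last exact: sm_coord.
apply: sm_mul; first exact: sm_coord.
exact: (@sm_comp _ _ _ _ (fun x => h c x i j) x u (findim_rV n) sx (h_sm hh i j cx)).
Qed.

End HFormSmooth.

(** * Smooth majorants of the speed *)

Section Majorant.
Context {R : realType} {n : nat} {M : manifold R n}.
Variables (h : chart M -> 'rV[R]_n -> 'M[R]_n) (U : chart M -> 'rV[R]_n -> 'rV[R]_n).
Variable (F : chart M -> 'rV[R]_n * 'rV[R]_n -> R).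
Hypotheses (hh : riemannian h) (vU : vector_field U).
Hypotheses (hU1 : forall c x, cim c x -> rnorm h c (x, U c x) < 1).
Hypothesis (hF : zermelo (rnorm h) U F).
Implicit Types (c d : chart M).
Local Notation q := (hform h).

(* The square root in [zermelo_formula] is regularized to be smooth at y = 0. *)
Definition regularized (eps : R) c x y : R := (lambda h U c x)^-1 * (- q c x y (U c x) +
  Num.sqrt (q c x y (U c x) ^+ 2 + lambda h U c x * q c x y y + (eps * lambda h U c x) ^+ 2)).

Lemma regularized0 c x y : cim c x -> regularized 0 c x y = F c (x, y).
Proof.
move=> cx; rewrite /regularized mul0r expr0n /= addr0 -(zermelo_formula hh hU1 hF y cx).
by rewrite mulKf // gt_eqF // (lambda_gt0 hU1).
Qed.

(** Adding [e ^ 2] under a square root increases it by at most [e]; with [e = eps * lambda] the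
    division by [lambda] leaves [eps]. *)
Lemma regularized_bounds eps c x y : cim c x -> 0 <= eps ->
  F c (x, y) <= regularized eps c x y <= F c (x, y) + eps.
Proof.
move=> cx e0; have l0 := lambda_gt0 hU1 cx.
rewrite -(ler_pM2l l0) -(ler_pM2l l0 (regularized _ _ _ _)) mulrDr (zermelo_formula hh hU1 hF y cx) /regularized.
rewrite mulVKf ?gt_eqF //.
set S := _ ^+ 2 + _ * _; have S0 : 0 <= S.
  by rewrite addr_ge0 ?sqr_ge0 // mulr_ge0 ?(ltW l0) // hform_ge0.
move: S S0 => S S0; have el0 : 0 <= eps * lambda h U c x by rewrite mulr_ge0 // ltW.
rewrite lerD2l -addrA lerD2l; apply/andP; split.
  by rewrite ler_wsqrtr // lerDl sqr_ge0.
rewrite [lambda _ _ _ _ * eps]mulrC -[leRHS]ger0_norm ?addr_ge0 ?sqrtr_ge0 //.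
rewrite -sqrtr_sqr ler_wsqrtr // sqrrD sqr_sqrtr // -addrA lerD2l lerDr.
by rewrite mulrn_wge0 // mulr_ge0 ?sqrtr_ge0.
Qed.

Lemma regularized_chart eps c d p v : dom c p -> dom d p ->
  regularized eps d (coord d p) (dtrans c d p v) = regularized eps c (coord c p) v.
Proof.
move=> cp dp; have lE : lambda h U d (coord d p) = lambda h U c (coord c p).
  rewrite !(lambdaE U hh) ?(vU.2 c d p) //; try exact: cim_coord.
  by rewrite (hform_chart hh).
by rewrite /regularized lE (vU.2 c d p cp dp) !(hform_chart hh).
Qed.

Definition majorant (eps : R) (g : R -> M) (t : R) : R :=
  let c := chart_at (g t) in regularized eps c (coord c (g t)) (vel c g t).

Lemma majorant_bounds eps g t : 0 <= eps ->
  speed F g t <= majorant eps g t <= speed F g t + eps.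
Proof. by move=> e0; apply: regularized_bounds => //; exact/cim_coord/chart_atP. Qed.

(** The chart in [majorant] changes with the point; chart invariance allows the chart at [g t] to be
    kept for all nearby times. *)
Lemma near_majorant eps g t : smap g t -> let c := chart_at (g t) in
  \near t, regularized eps c (ccoord c g t) ('D_1 (ccoord c g) t) = majorant eps g t.
Proof.
move=> sg c; have ct : dom c (g t) := chart_atP (g t).
apply: nearS (nearI (near_dom (smap_cont sg) ct) (smap_near sg)) => u [cu su].
have du := chart_atP (g u); rewrite /majorant (vel_chart su cu du).
by rewrite (regularized_chart _ _ cu du) velE.
Qed.

Lemma regularized_sm g t : smap g t -> let c := chart_at (g t) in
  [/\ sm (fun u => hform h c (ccoord c g u) ('D_1 (ccoord c g) u) (U c (ccoord c g u))) t,
      sm (fun u => hform h c (ccoord c g u) ('D_1 (ccoord c g) u) ('D_1 (ccoord c g) u)) t,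
      sm (fun u => lambda h U c (ccoord c g u)) t & cim c (ccoord c g t)].
Proof.
move=> sg c; have ct : dom c (g t) := chart_atP (g t).
have sx : sm (ccoord c g) t := smap_coord sg ct.
have cx : cim c (ccoord c g t) by exact: cim_coord.
have sv := sm_D (1 : R) sx.
have sU : sm (fun u => U c (ccoord c g u)) t.
  exact: (@sm_comp _ _ _ _ (U c) (ccoord c g) t (findim_rV n) sx (vector_field_sm vU cx)).
split=> //; [exact: sm_hform|exact: sm_hform|].
apply: (@sm_ext _ _ _ (fun u => 1 - hform h c (ccoord c g u) (U c (ccoord c g u)) (U c (ccoord c g u)))).
  apply: nearS (sm_near_im sx (near_cim cx)) => u cu.
  by rewrite (lambdaE U hh).
by apply: sm_sub; [exact: sm_cst|exact: sm_hform].
Qed.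

Lemma majorant_sm eps g t : 0 < eps -> smap g t -> sm (majorant eps g) t.
Proof.
move=> e0 sg; apply: sm_ext (near_majorant eps sg) _.
have := regularized_sm sg; set c := chart_at _ => -[sB sA sl cx].
have l0 := lambda_gt0 hU1 cx.
apply: sm_mul; first by apply: sm_inv => //; rewrite gt_eqF.
apply: sm_add; first exact: sm_opp.
apply: sm_sqrt; last first.
  rewrite -[X in sm X _]/(fun u => _ ^+ 2 + _ + (_ * _) ^+ 2).
  apply: sm_add; first by apply: sm_add; [exact: sm_mul|exact: sm_mul].
  by have se : sm (fun u => eps * lambda h U c (ccoord c g u)) t;
    [apply: sm_mul => //; exact: sm_cst|exact: sm_mul].
rewrite ltr_wpDl // ?exprn_gt0 ?mulr_gt0 //.
by rewrite addr_ge0 ?sqr_ge0 // mulr_ge0 ?(ltW l0) // hform_ge0.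
Qed.

(** With [eps = 0] the majorant is the speed itself, and its formula is continuous also where the
    velocity vanishes, as the square root is continuous at 0. *)
Lemma zermelo_speed_continuous g t : smap g t -> {for t, continuous (speed F g)}.
Proof.
move=> sg.
have E0 : majorant 0 g = speed F g.
  by apply/funext => u; apply: regularized0; exact/cim_coord/chart_atP.
rewrite -E0; have nM := near_majorant 0 sg.
have := regularized_sm sg; set c := chart_at _ => -[sB sA sl cx].
have l0 := lambda_gt0 hU1 cx.
have C : {for t, continuous (fun u => regularized 0 c (ccoord c g u) ('D_1 (ccoord c g) u))}.
  have s0 : sm (fun u => 0 * lambda h U c (ccoord c g u)) t.
    by apply: sm_mul => //; exact: sm_cst.
  have sS := sm_add (sm_add (sm_mul sB sB) (sm_mul sl sA)) (sm_mul s0 s0).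
  have sI : sm (fun u => (lambda h U c (ccoord c g u))^-1) t.
    by apply: sm_inv => //; rewrite gt_eqF.
  apply: (@continuousM _ _ (fun u => (lambda h U c (ccoord c g u))^-1)); first exact: sm_cont sI.
  apply: (@continuousD _ _ _ (fun u => - q c (ccoord c g u) ('D_1 (ccoord c g) u) (U c (ccoord c g u)))).
    exact: (sm_cont (sm_opp sB)).
  exact: (@continuous_comp _ _ _ _ Num.sqrt t (sm_cont sS) (@sqrt_continuous _ _)).
have E := nbhs_singleton nM; rewrite /prop_for /continuous_at -E.
by apply: cvg_trans C; apply: near_eq_cvg.
Qed.

End Majorant.

(** * Comparison of integrals *)

Section Comparison.
Context {R : realType}.

Lemma itv_enlarge (I : set R) a b : open I -> a <= b -> `[a, b] `<=` I ->
  exists2 d, 0 < d & forall x, a - d <= x <= b + d -> I x.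
Proof.
move=> oI ab abI.
have Ia : I a by apply: abI; rewrite /= in_itv /= lexx.
have Ib : I b by apply: abI; rewrite /= in_itv /= lexx andbT.
have /nbhs_ballP[r /= r0 Hr] : nbhs a I by exact: open_nbhs_nbhs.
have /nbhs_ballP[r' /= r'0 Hr'] : nbhs b I by exact: open_nbhs_nbhs.
pose d := Num.min (r / 2) (r' / 2).
have d0 : 0 < d by rewrite lt_min !divr_gt0.
have dr : d < r by rewrite gt_min ltr_pdivrMr // ltr_pMr // ltr1n.
have dr' : d < r'.
  by rewrite gt_min orbC ltr_pdivrMr // ltr_pMr // ltr1n.
exists d => // x /andP[ax xb]; case: (ltP x a) => xa.
  apply: Hr; rewrite /ball /= ger0_norm ?subr_ge0 ?ltW //.
  by apply: le_lt_trans dr; rewrite lerBlDr -lerBlDl.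
case: (ltP b x) => bx; last by apply: abI; rewrite /= in_itv /= xa.
apply: Hr'; rewrite /ball /= distrC ger0_norm ?subr_ge0 ?ltW //.
by apply: le_lt_trans dr'; rewrite lerBlDl.
Qed.

(** A primitive obtained by integration is differentiable only strictly inside its interval, which
    is therefore enlarged to contain [a] and [b]. *)
Lemma primitive_on (I : set R) (f : R -> R) a b : open I -> a <= b -> `[a, b] `<=` I ->
  (forall x, I x -> {for x, continuous f}) ->
  exists2 d, 0 < d & exists2 G : R -> R, (forall x, a - d < x < b + d ->
    [/\ I x, differentiable G x & 'D_1 G x = f x]) &
    (\int[@lebesgue_measure R]_(x in `[a, b]) f x)%R = G b - G a.
Proof.
move=> oI ab abI cf; have [d d0 Hd] := itv_enlarge oI ab abI.
have ad : a - d < a by rewrite gtrBl.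
have bd : b < b + d by rewrite ltrDl.
have [|x /Hd|G HG] := @primitive R f (a - d) (b + d); [lra|exact: cf|].
have HG' x : a - d < x < b + d -> [/\ I x, differentiable G x & 'D_1 G x = f x].
  move=> xab; have [dG DG] := HG x xab; split=> //; apply: Hd.
  by have /andP[ax xb] := xab; rewrite !ltW.
exists d => //; exists G => //; apply: Rintegral_D => // x /andP[ax xb].
have [|Ix dG DG] := HG' x; first by apply/andP; split; lra.
by split=> //; exact: cf.
Qed.

(** With primitives [F] of [f] and [G] of [g], the function [G x + e * x - F x] has nonnegative
    derivative. *)
Lemma Rintegral_le (I : set R) (f g : R -> R) (e a b : R) : open I -> a <= b ->
  `[a, b] `<=` I -> (forall x, I x -> {for x, continuous f}) ->
  (forall x, I x -> {for x, continuous g}) ->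
  (forall x, a <= x <= b -> f x <= g x + e) ->
  (\int[@lebesgue_measure R]_(x in `[a, b]) f x)%R <=
  (\int[@lebesgue_measure R]_(x in `[a, b]) g x)%R + e * (b - a).
Proof.
move=> oI ab abI cf cg fg.
have [d d0 [F HF ->]] := primitive_on oI ab abI cf.
have [d' d'0 [G HG ->]] := primitive_on oI ab abI cg.
pose Q x := G x + e * x - F x.
have HQ x : a <= x <= b -> is_derive x 1 Q (g x + e - f x).
  move=> /andP[ax xb].
  have [|_ dF DF] := HF x; first by apply/andP; split; lra.
  have [|_ dG DG] := HG x; first by apply/andP; split; lra.
  have de : derivable (fun x : R => e * x) x 1 by apply: derivableM; [exact: derivable_cst|exact: derivable_id].
  have dF' : derivable F x 1 by exact: diff_derivable.
  have dG' : derivable G x 1 by exact: diff_derivable.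
  have dGe := derivableD dG' de.
  apply: DeriveDef; first exact: (derivableB dGe dF').
  apply: (etrans (deriveB dGe dF')); rewrite DF; congr (_ - _).
  apply: (etrans (deriveD dG' de)); rewrite DG; congr (_ + _).
  apply: (etrans (@D_scale_cst _ R R e (fun u : R => u) x 1 _)) => //.
  by rewrite derive_id -[e *: 1]/(e * 1) mulr1.
have iab : is_interval [set x : R | a <= x <= b].
  move=> x y /= /andP[ax xb] /andP[ay yb] z /andP[xz zy].
  by rewrite (le_trans ax xz) (le_trans zy yb).
have : Q a <= Q b.
  apply: (derive_ge0_le (dg := fun x => g x + e - f x) iab) => //=.
  - by move=> x xab; rewrite subr_ge0; exact: fg.
  - by rewrite lexx.
  - by rewrite lexx andbT.
by rewrite /Q; lra.
Qed.

Lemma Rintegral_const (f : R -> R) (a b k : R) : a <= b ->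
  (forall x, a <= x <= b -> f x = k) ->
  (\int[@lebesgue_measure R]_(x in `[a, b]) f x)%R = k * (b - a).
Proof.
move=> ab H; rewrite (@eq_Rintegral _ _ _ _ _ (fun=> k)); last first.
  by move=> x /set_mem /=; rewrite in_itv /=; exact: H.
rewrite Rintegral_cst //= lebesgue_measure_itv /= lte_fin.
case: ltP => [//|ba]; have -> : a = b by apply/eqP; rewrite eq_le ab.
by rewrite subrr.
Qed.

End Comparison.

(** * Paths, distances and their transport *)

Section Paths.
Context {R : realType} {n : nat} {M : manifold R n}.
Implicit Types (c d : chart M) (F : chart M -> 'rV[R]_n * 'rV[R]_n -> R) (p q r : M).

Lemma speed_ge0 F g t : metric F -> 0 <= speed F g t.
Proof. by move=> mF; apply: metric_ge0 => //; exact/cim_coord/chart_atP. Qed.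

Lemma pw_path_ge0 F p q L : metric F -> pw_path F p q L -> 0 <= L.
Proof.
move=> mF; elim=> // {}p {}q r s I a b len _ ab _ _ _ _ _ len0.
by rewrite addr_ge0 // Rintegral_ge0 // => t _; exact: speed_ge0.
Qed.

Lemma has_lbound_lengths F p q : metric F -> has_lbound [set L | pw_path F p q L].
Proof. by move=> mF; exists 0 => L /= /(pw_path_ge0 mF). Qed.

Lemma dist_le F p q L : metric F -> pw_path F p q L -> dist F p q <= L.
Proof. by move=> mF pL; apply: (ge_inf (has_lbound_lengths p q mF)). Qed.

Lemma dist_lt F p q L T : pw_path F p q L -> dist F p q < T ->
  exists2 L, pw_path F p q L & L < T.
Proof. by move=> pL; apply: inf_lt; exists L. Qed.

Lemma le_dist F p q L k : pw_path F p q L ->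
  (forall L, pw_path F p q L -> k <= L) -> k <= dist F p q.
Proof. by move=> pL H; apply: lb_le_inf => //; exists L. Qed.

Lemma pw_path_arc F p q (s : R -> M) (I : set R) (a b k : R) : open I -> a <= b ->
  `[a, b] `<=` I -> smooth_map I s -> s a = p -> s b = q ->
  (forall t, a <= t <= b -> speed F s t = k) -> pw_path F p q (k * (b - a)).
Proof.
move=> oI ab abI ss sa sb Hk; rewrite -(Rintegral_const ab Hk) -[X in pw_path _ _ _ X]addr0.
by apply: (pw_cons oI ab abI ss sa sb); exact: pw_nil.
Qed.

Lemma unit_geodesic_path F I g a b : open_itv I -> unit_geodesic F I g -> I a -> I b ->
  a <= b -> pw_path F (g a) (g b) (b - a).
Proof.
move=> oiI [[sg _] ug] Ia Ib ab; rewrite -[b - a]mul1r.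
have abI := open_itv_between oiI Ia Ib.
apply: (pw_path_arc oiI.1 ab abI sg) => // t tab; apply: ug.
by apply: abI; rewrite /= in_itv.
Qed.

Section ExactChange.
Variables (F F' : chart M -> 'rV[R]_n * 'rV[R]_n -> R) (f : M -> R).
Hypotheses (mF : metric F) (mF' : metric F') (sf : smooth_fun f).
Hypothesis (FF' : forall c x y, cim c x ->
  F' c (x, y) = F c (x, y) + 'D_y (fun x => f (param c x)) x).
Hypothesis (cF : forall (g : R -> M) t, smap g t -> {for t, continuous (speed F g)}).

(** On each arc the two speeds differ by the derivative of [f] along it, and the boundary terms
    telescope. *)
Lemma pw_path_change p q L : pw_path F p q L -> pw_path F' p q (L + f q - f p).
Proof.
elim=> [{}p|{}p {}q r s I a b len oI ab abI ss sa sb _ IH].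
  by rewrite add0r subrr; exact: pw_nil.
have sms := (smooth_mapP s oI).1 ss.
have cS x : I x -> {for x, continuous (speed F s)} by move=> /sms/cF.
have [d d0 [G HG EG]] := primitive_on oI ab abI cS.
have sE x : I x -> sm (fun u => f (s u)) x /\
    speed F' s x = speed F s x + 'D_1 (fun u => f (s u)) x.
  by move=> /sms; exact: (arc_length_D mF mF' sf FF').
have E : (\int[@lebesgue_measure R]_(t in `[a, b]) speed F' s t)%R =
    (\int[@lebesgue_measure R]_(t in `[a, b]) speed F s t)%R + f q - f p.
  rewrite EG -sa -sb; transitivity ((G b + f (s b)) - (G a + f (s a))); last by lra.
  apply: (@Rintegral_D _ (fun u => G u + f (s u))) => // x /andP[ax xb].
  have [|Ix dG DG] := HG x; first by apply/andP; split; lra.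
  have [sfx SE] := sE x Ix; split.
  - by apply: differentiableD => //; exact: sm_diff.
  - rewrite [LHS]deriveD ?DG ?SE //; first exact: diff_derivable.
    exact/diff_derivable/sm_diff.
  - have E : \near x, speed F s x + 'D_1 (fun u => f (s u)) x = speed F' s x.
      have nI : nbhs x I by exact: open_nbhs_nbhs.
      by apply: nearS nI => u /sE[].
    have C : {for x, continuous (fun x => speed F s x + 'D_1 (fun u => f (s u)) x)}.
      apply: (@continuousD _ _ _ (speed F s)); first exact: cS.
      exact: (sm_cont (sm_D (1 : R) sfx)).
    rewrite /prop_for /continuous_at -(nbhs_singleton E).
    by apply: cvg_trans C; exact: near_eq_cvg.
have -> : (\int[@lebesgue_measure R]_(t in `[a, b]) speed F s t)%R + len + f r - f p =
    (\int[@lebesgue_measure R]_(t in `[a, b]) speed F' s t)%R + (len + f r - f q).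
  by rewrite E; lra.
exact: (pw_cons oI ab abI ss sa sb).
Qed.

End ExactChange.

(* Paths are carried along the flow of [X] while time runs at least at their
   G'-speed [k]: the resulting velocity [y + k X] has G-norm at most [k].  Time
   left over is spent along a flow line, which is strictly G-shorter. *)
Section Shortcut.
Variables (G G' : chart M -> 'rV[R]_n * 'rV[R]_n -> R).
Variables (X : chart M -> 'rV[R]_n -> 'rV[R]_n) (D : set (R * M)) (chi : R -> M -> M).
Hypotheses (mG : metric G) (mG' : metric G').
Hypothesis (fl : local_flow X D chi).
Hypothesis (Dfull : forall t p, D (t, p)).
Hypothesis (inv : forall c d x t y, cim c x -> D (t, param c x) ->
  dom d (chi t (param c x)) ->
  G' d (coord d (chi t (param c x)), push chi c x y d t) = G' c (x, y)).
Hypothesis (le_rel : forall c x y (k : R), cim c x -> 0 <= k -> G' c (x, y) <= k ->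
  G c (x, y + k *: X c x) <= k).
Hypothesis (lt1 : forall c x, cim c x -> G c (x, X c x) < 1).
Hypothesis (flow_line : forall c d p t, dom c p -> dom d (chi t p) ->
  G d (coord d (chi t p), X d (coord d (chi t p))) = G c (coord c p, X c (coord c p))).
Hypothesis (cG : forall (g : R -> M) t, smap g t -> {for t, continuous (speed G g)}).
Hypothesis (maj : forall eps : R, 0 < eps -> exists k : (R -> M) -> R -> R, forall g t,
  speed G' g t <= k g t <= speed G' g t + eps /\ (smap g t -> sm (k g) t)).
Hypothesis (cG' : forall (g : R -> M) t, smap g t -> {for t, continuous (speed G' g)}).

(** The velocity is the pushed velocity of [g], whose [G']-length is unchanged, plus ['D_1 theta t]
    times [X]: the situation of [le_rel]. *)
Lemma carried_speed (g : R -> M) (theta : R -> R) t : smap g t -> sm theta t ->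
  speed G' g t <= 'D_1 theta t ->
  smap (fun u => chi (theta u) (g u)) t /\
  speed G (fun u => chi (theta u) (g u)) t <= 'D_1 theta t.
Proof.
move=> sg st le; have [sP _] := smap_flow fl findim_R sg st (Dfull _ _).
split; first exact: sP.
have ct := chart_atP (g t); set c := chart_at (g t) in ct.
have dt := chart_atP (chi (theta t) (g t)); set d := chart_at _ in dt.
rewrite (speed_ccoord mG sP dt); pose x := ccoord c g.
have sx : sm x t := smap_coord sg ct.
have cx : cim c (x t) by exact: cim_coord.
have gE : param c (x t) = g t by rewrite /x /ccoord coordK.
have Dt : D (theta t, param c (x t)) by exact: Dfull.
have sPhi := lflow_smooth fl cx Dt.
have dt' : dom d (chi (theta t) (param c (x t))) by rewrite gE.
pose Phi := fun z : R * 'rV[R]_n => coord d (chi z.1 (param c z.2)).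
have sF : sm Phi (theta t, x t) := smap_coord sPhi dt'.
have E : \near t, ccoord d (fun u => chi (theta u) (g u)) t = Phi (theta t, x t).
  apply: nearS (near_dom (smap_cont sg) ct) => u cu.
  by rewrite /Phi /x /ccoord /= coordK.
have spr : sm (fun u => (theta u, x u)) t by exact: sm_pair.
have -> : 'D_1 (ccoord d (fun u => chi (theta u) (g u))) t =
    push chi c (x t) ('D_1 x t) d (theta t) + 'D_1 theta t *: X d (Phi (theta t, x t)).
  rewrite (D_ext _ E).
  apply: (etrans (@D_comp _ _ _ _ Phi (fun u => (theta u, x u)) _ _ (sm_diff spr) (sm_diff sF))).
  rewrite (D_pair _ (sm_diff st) (sm_diff sx)).
  have -> : ('D_1 theta t, 'D_1 x t) = (0, 'D_1 x t) + 'D_1 theta t *: (1, 0) :> R * 'rV[R]_n.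
    by congr pair; rewrite /= ?add0r ?scaler0 ?addr0 // -[_ *: 1]/(_ * 1) mulr1.
  rewrite (D_add_dir _ _ (sm_diff sF)) (D_scale_dir _ _ (sm_diff sF)).
  by rewrite (lflow_ode fl cx Dt dt') -push_slice.
have -> : ccoord d (fun u => chi (theta u) (g u)) t = Phi (theta t, x t).
  by rewrite (nbhs_singleton E).
have cd : cim d (Phi (theta t, x t)) by exact: cim_coord.
apply: le_rel => //; first exact: le_trans (speed_ge0 _ _ mG') le.
by rewrite (inv _ cx Dt dt') -(speed_ccoord mG' sg ct).
Qed.

Lemma flow_line_smap p t : smap (chi^~ p) t.
Proof.
have sp : smap (fun _ : R => p) t.
  by split=> [|c cp]; [apply: nearT => u; exact: cvg_cst|exact: sm_cst].
exact: (smap_flow fl findim_R sp (sm_id t) (Dfull _ _)).1.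
Qed.

Lemma flow_line_speed c p t : dom c p -> speed G (chi^~ p) t = G c (coord c p, X c (coord c p)).
Proof.
move=> cp; have dt := chart_atP (chi t p); set d := chart_at _ in dt.
rewrite (speed_ccoord mG (flow_line_smap p t) dt) -(flow_line cp dt).
have cx := cim_coord cp; have dt' : dom d (chi t (param c (coord c p))) by rewrite coordK.
have := lflow_ode fl cx (Dfull t _) dt'.
rewrite (D_slice1 (fun z : R * 'rV[R]_n => coord d (chi z.1 (param c z.2)))) /= coordK // => E.
by rewrite /ccoord E.
Qed.

Lemma flow_line_path p a b : a < b ->
  exists2 L, pw_path G (chi a p) (chi b p) L & L < b - a.
Proof.
move=> ab; have cp := chart_atP p; set c := chart_at p in cp.
exists (G c (coord c p, X c (coord c p)) * (b - a)); last first.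
  by rewrite gtr_pMl ?subr_gt0 // lt1 //; exact: cim_coord.
apply: (@pw_path_arc _ _ _ (chi^~ p) setT) => //; [exact: openT|exact: ltW| |].
  by apply/smooth_mapP => [|u _]; [exact: openT|exact: flow_line_smap].
by move=> t _; exact: flow_line_speed.
Qed.

(** [theta0] is the flow time at which the path starts and [T] the one at which it must end. The
    induction lets [theta0] vary, since every arc advances the clock, and keeps the inequality
    strict, since every majorant consumes some slack. *)
Lemma shortcut p r L theta0 T : pw_path G' p r L -> L < T - theta0 ->
  exists2 L', pw_path G (chi theta0 p) (chi T r) L' & L' < T - theta0.
Proof.
move=> pL; elim: pL theta0 => [{}p|{}p {}q {}r s I a b len oI ab abI ss sa sb _ IH] theta0 lt.
  (* At the end of the path the remaining time is positive and is spent along the flow line. *)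
  by apply: flow_line_path; rewrite -subr_gt0.
set l := (\int[_]_(t in _) _)%R in lt *.
(* At most half of the slack is spent on this arc, leaving some for the later ones; the summand 1
   covers [a = b]. *)
pose eps := (T - theta0 - (l + len)) / (2 * (b - a + 1)).
have ba1 : 0 < b - a + 1 by rewrite ltr_wpDl // subr_ge0.
have e0 : 0 < eps by rewrite divr_gt0 ?subr_gt0 // mulr_gt0.
have eb : eps * (b - a) < T - theta0 - (l + len).
  apply: (@le_lt_trans _ _ ((T - theta0 - (l + len)) / 2)).
    rewrite /eps invfM mulrA -mulrA -[leRHS]mulr1 ler_pM2l ?divr_gt0 ?subr_gt0 //.
    by rewrite mulrC ler_pdivrMr // mul1r lerDl.
  by rewrite ltr_pdivrMr // ltr_pMr ?subr_gt0 // ltr1n.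
have [k Hk] := maj e0.
have sms := (smooth_mapP s oI).1 ss.
have sk x : I x -> sm (k s) x by move=> /sms; exact: (Hk s x).2.
have ck x : I x -> {for x, continuous (k s)} by move=> /sk/sm_cont.
have [d d0 [K HK EK]] := primitive_on oI ab abI ck.
have adb x : a <= x <= b -> a - d < x < b + d by move=> /andP[ax xb]; apply/andP; split; lra.
have sK : forall x, a - d < x < b + d -> sm K x.
  apply: (@primitive_sm _ K (k s)) => x /HK[Ix dK DK] //; exact: sk.
(* The clock along the arc runs at the rate of the majorant [k s] and starts at [theta0]. *)
pose theta x := theta0 + (K x - K a).
pose J := [set x | a - d < x < b + d].
have oJ : open J.
  rewrite openE => y /= /andP[ay yb].
  by apply: nearS (nearI (lt_nbhsr ay) (lt_nbhsl yb)) => z [az zb] /=; rewrite /J /= az zb.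
have sth x : J x -> sm theta x /\ 'D_1 theta x = k s x.
  move=> Jx; have [Ix dK DK] := HK x Jx; split.
    apply: sm_add; first exact: sm_cst.
    by apply: sm_sub; [exact: sK|exact: sm_cst].
  have dK1 : derivable K x 1 by exact: diff_derivable.
  have da : derivable (fun _ : R => K a) x 1 by exact: derivable_cst.
  have d0' : derivable (fun _ : R => theta0) x 1 by exact: derivable_cst.
  apply: (etrans (deriveD d0' (derivableB dK1 da))); rewrite derive_cst add0r.
  by apply: (etrans (deriveB dK1 da)); rewrite derive_cst subr0.
pose s' x := chi (theta x) (s x).
have ca x : J x -> smap s' x /\ speed G s' x <= k s x.
  move=> Jx; have [Ix _ _] := HK x Jx; have [st Dt] := sth x Jx; rewrite -Dt.
  apply: carried_speed => //; first exact: sms.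
  by rewrite Dt; have [/andP[]] := Hk s x.
have abJ : `[a, b] `<=` J by move=> x /=; rewrite in_itv /=; exact: adb.
have JI : J `<=` I by move=> x /HK[].
have len1 : (\int[@lebesgue_measure R]_(t in `[a, b]) speed G s' t)%R <= K b - K a.
  rewrite -EK -[leRHS]addr0 -[X in _ + X](mul0r (b - a)).
  apply: (Rintegral_le oJ ab abJ) => [x /ca[/cG]|x /JI/ck|x] //.
  by move=> /adb/ca[_]; rewrite addr0.
have len2 : K b - K a <= l + eps * (b - a).
  rewrite -EK; apply: (Rintegral_le oI ab abI ck) => [x /sms/cG'|x _] //.
  by have [/andP[]] := Hk s x.
have tb : theta b = theta0 + (K b - K a) by [].
have [|L' pL' L'T] := IH (theta b); first by rewrite tb; lra.
exists ((\int[@lebesgue_measure R]_(t in `[a, b]) speed G s' t)%R + L').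
  apply: (pw_cons oJ ab abJ (s := s') (q := chi (theta b) q)) => //.
  - by apply/smooth_mapP => // x /ca[].
  - by rewrite /s' /theta subrr addr0 sa.
  - by rewrite /s' sb.
by rewrite tb in L'T; lra.
Qed.

End Shortcut.
End Paths.

(** * Reparametrization by arc length *)

Section UnitReparametrization.
Context {R : realType} {n : nat} {M : manifold R n}.

Lemma unit_geodesic_ext (F : chart M -> 'rV[R]_n * 'rV[R]_n -> R) (I : set R) (g g' : R -> M) :
  metric F -> open I -> (forall t, I t -> g t = g' t) ->
  unit_geodesic F I g -> unit_geodesic F I g'.
Proof.
move=> mF oI E /(unit_geodesicP mF _ oI) H; apply/(unit_geodesicP mF _ oI) => t It.
have [sg S [c ct HE]] := H t It.
have nI : nbhs t I by exact: open_nbhs_nbhs.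
have nE : \near t, g t = g' t by exact: nearS nI.
split; first exact: smap_ext sg.
  by rewrite -(speed_ext F nE).
exists c => [|d dt]; first by rewrite -E.
apply: EL_ext (HE d _); last by rewrite E.
by apply: nearS nE => u; rewrite /ccoord => ->.
Qed.

Variables (F F' : chart M -> 'rV[R]_n * 'rV[R]_n -> R) (f : M -> R).
Hypotheses (mF : metric F) (mF' : metric F') (sf : smooth_fun f).
Hypothesis (FF' : forall c x y, cim c x ->
  F' c (x, y) = F c (x, y) + 'D_y (fun x => f (param c x)) x).
Variables (J : set R) (g : R -> M).
Hypotheses (oiJ : open_itv J) (J0 : J 0) (gg : unit_geodesic F J g).

(** Closed form of the [F']-length of [g] from time 0, as [g] has unit [F]-speed and [F' = F + df];
    see [integral0_arc_length]. *)
Definition arc_length (u : R) : R := u + f (g u) - f (g 0).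

Lemma arc_length0 : arc_length 0 = 0.
Proof. by rewrite /arc_length add0r subrr. Qed.

Lemma arc_lengthP u : J u -> [/\ sm arc_length u,
  'D_1 arc_length u = speed F' g u & 0 < 'D_1 arc_length u].
Proof.
move=> Ju; have [oJ _] := oiJ; have [gF uF] := gg.
have E : (fun u => 1 * u + f (g u) - f (g 0)) = arc_length.
  by apply/funext => v; rewrite mul1r.
have [sT DT pT] := arc_length_increasing mF mF' sf FF' (f (g 0)) oJ gF uF Ju.
by rewrite E in sT DT; split=> //; rewrite DT.
Qed.

Lemma arc_length_lt a b : J a -> J b -> (arc_length a < arc_length b) = (a < b).
Proof.
have [_ iJ] := oiJ.
apply: (derive_gt0_lt (dg := fun u => 'D_1 arc_length u) iJ) => u /arc_lengthP[sT _ T0] //.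
by apply: DeriveDef => //; exact/diff_derivable/sm_diff.
Qed.

Lemma arc_length_inj a b : J a -> J b -> arc_length a = arc_length b -> a = b.
Proof.
by move=> Ja Jb E; apply/eqP; rewrite eq_le !leNgt -(arc_length_lt Ja Jb) -(arc_length_lt Jb Ja) E ltxx.
Qed.

Lemma integral0_arc_length u : J u -> integral0 (speed F' g) u = arc_length u.
Proof.
move=> Ju; have [oJ iJ] := oiJ.
rewrite (@integral0_D _ arc_length _ J) // ?arc_length0 ?subr0 // => x Jx.
have [sT DT _] := arc_lengthP Jx; split=> //; first exact: sm_diff.
have E : \near x, 'D_1 arc_length x = speed F' g x.
  have nJ : nbhs x J by exact: open_nbhs_nbhs.
  by apply: nearS nJ => v /arc_lengthP[].
rewrite /prop_for /continuous_at -(nbhs_singleton E).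
by apply: cvg_trans (sm_cont (sm_D (1 : R) sT)); exact: near_eq_cvg.
Qed.

Lemma reparam_unit_geodesic (I : set R) (s : R -> R) : open I ->
  (forall t, I t -> J (s t) /\ arc_length (s t) = t) ->
  unit_geodesic F' I (fun t => g (s t)).
Proof.
move=> oI Hs; have [oJ _] := oiJ; have [gF uF] := gg.
have ss : forall t, I t -> sm s t.
  by apply: (inverse_sm1 oiJ oI) Hs => u /arc_lengthP[].
apply: (reparam_geodesic (k := f (g 0)) mF mF' sf FF' oJ gF uF oI) => t It.
by have [Jt Tt] := Hs t It; rewrite mul1r; split=> //; exact: ss.
Qed.

Lemma unit_reparametrization : exists (I : set R) (s : R -> R),
  [/\ open_itv I /\ I 0, unit_geodesic F' I (fun t => g (s t)),
      forall t, I t -> J (s t) /\ arc_length (s t) = t &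
      forall u, J u -> I (arc_length u) /\ s (arc_length u) = u].
Proof.
pose I := arc_length @` J.
have oiI : open_itv I by apply: open_itv_image => // u /arc_lengthP[].
(* The implication makes this total: outside [I] the witness 0 is a default. *)
have H t : exists u, I t -> J u /\ arc_length u = t.
  by have [[u Ju <-]|nI] := pselect (I t); [exists u|exists 0].
pose s t := projT1 (cid (H t)).
have Hs t : I t -> J (s t) /\ arc_length (s t) = t by rewrite /s; case: cid.
exists I, s; split=> //.
- by split=> //; exists 0 => //; exact: arc_length0.
- exact: reparam_unit_geodesic oiI.1 Hs.
- move=> u Ju; have It : I (arc_length u) by exists u.
  by split=> //; have [Jt Tt] := Hs _ It; exact: arc_length_inj.
Qed.

End UnitReparametrization.

Section ExactOpposite.
Context {R : realType} {n : nat} {M : manifold R n}.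
Implicit Types (F : chart M -> 'rV[R]_n * 'rV[R]_n -> R) (f : M -> R).

Lemma smooth_fun_opp f : smooth_fun f -> smooth_fun (fun p => - f p).
Proof.
move=> sf c; apply: (Cinf_sm _ (@cim_open _ _ _ c)).2 => x cx.
by apply: sm_opp; exact: smooth_fun_sm.
Qed.

Lemma exact_change_opp F F' f : smooth_fun f ->
  (forall c x y, cim c x -> F' c (x, y) = F c (x, y) + 'D_y (fun x => f (param c x)) x) ->
  forall c x y, cim c x -> F c (x, y) = F' c (x, y) + 'D_y (fun x => - f (param c x)) x.
Proof.
move=> sf FF' c x y cx; rewrite FF' //.
have df : derivable (fun x => f (param c x)) x y by exact/diff_derivable/sm_diff/smooth_fun_sm.
have -> : 'D_y (fun x => - f (param c x)) x = - 'D_y (fun x => f (param c x)) x by exact: deriveN.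
by rewrite addrK.
Qed.

(** Normalizing the speeds of a variation is the exact change of metric with [f = 0]. *)
Lemma conjugate_unit_conjugate F (I : set R) (g : R -> M) l : metric F -> open_itv I ->
  I 0 -> I l -> 0 < l -> unit_geodesic F I g -> conjugate F g l -> unit_conjugate F g l.
Proof.
move=> mF oiI I0 Il l0 ug.
have s0 : smooth_fun (fun _ : M => 0 : R).
  move=> c; apply: (Cinf_sm _ (@cim_open _ _ _ c)).2 => x cx; exact: sm_cst.
have FF c x y : cim c x -> F c (x, y) = F c (x, y) + 'D_y (fun x => (0 : R)) x.
  by move=> _; rewrite derive_cst addr0.
apply: (@reparam_unit_conjugate _ _ _ F F (fun _ => 0) mF mF s0 FF I I g g id l l) => //.
by move=> t It; split=> //; rewrite addr0 subr0.
Qed.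

(** The given path makes both sets of lengths nonempty, so that neither infimum is a default value;
    paths transform in both directions. *)
Lemma dist_exact_change F F' f p q L : metric F -> metric F' -> smooth_fun f ->
  (forall c x y, cim c x -> F' c (x, y) = F c (x, y) + 'D_y (fun x => f (param c x)) x) ->
  (forall (g : R -> M) t, smap g t -> {for t, continuous (speed F g)}) ->
  (forall (g : R -> M) t, smap g t -> {for t, continuous (speed F' g)}) ->
  pw_path F p q L -> dist F' p q = dist F p q + f q - f p.
Proof.
move=> mF mF' sf FF' cF cF' pL; have pL' := pw_path_change mF mF' sf FF' cF pL.
have FF := exact_change_opp sf FF'.
apply/eqP; rewrite eq_le; apply/andP; split.
  rewrite -lerBDr opprK -lerBlDr; apply: (le_dist pL) => L0 pL0.
  have := dist_le mF' (pw_path_change mF mF' sf FF' cF pL0); lra.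
apply: (le_dist pL') => L0 pL0.
have := dist_le mF (pw_path_change mF' mF (smooth_fun_opp sf) FF cF' pL0).
lra.
Qed.

End ExactOpposite.

(** * The navigation problem *)

Section Navigation.
Context {R : realType} {n : nat} {M : manifold R n}.
Variables (h : chart M -> 'rV[R]_n -> 'M[R]_n).
Variables (V W : chart M -> 'rV[R]_n -> 'rV[R]_n).
Variables (F1 Ft : chart M -> 'rV[R]_n * 'rV[R]_n -> R).
Variables (f : M -> R) (D : set (R * M)) (phi : R -> M -> M).
Hypotheses (hh : riemannian h) (hV : vector_field V) (hW : vector_field W).
Hypothesis (hV1 : forall c x, cim c x -> rnorm h c (x, V c x) < 1).
Hypothesis (hVW1 : forall c x, cim c x -> rnorm h c (x, V c x + W c x) < 1).
Hypotheses (hb1 : killing h W)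
  (hb2 : forall c x p, cim c x -> poisson (star V c) (star W c) (x, p) = 0).
Hypotheses (hF1 : zermelo (rnorm h) V F1) (hFt : zermelo F1 W Ft).
Hypotheses (hf : smooth_fun f)
  (hdf : forall c x, cim c x -> forall i : 'I_n,
    partial i (f \o param c) x = randers_b h V c x 0 i).
Hypothesis (hphi : flow W D phi).
Implicit Types (c d : chart M).
Local Notation alpha := (rnorm (randers_a h V)).
Let VW c x := V c x + W c x.
Let W' c x := - W c x.

Let mF1 : metric F1 := zermelo_metric hF1.
Let mFt : metric Ft := finsler_metric hFt.1.
Let mA : metric alpha := alpha_metric hh hV1 hF1 hf hdf.
Let vVW : vector_field VW := vector_field_add hV hW.
Let vW' : vector_field W' := vector_field_opp hW.
Let hFt' : zermelo (rnorm h) VW Ft := zermelo_add hF1 hFt.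

Let br1 c x : cim c x -> 'D_(W c x) (V c) x = 'D_(V c x) (W c) x.
Proof. by move=> cx; apply: poisson_bracket => // p; exact: hb2. Qed.

Let brt c x : cim c x -> 'D_(W c x) (VW c) x = 'D_(VW c x) (W c) x.
Proof.
move=> cx; have dV := sm_diff (vector_field_sm hV cx).
have dW := sm_diff (vector_field_sm hW cx).
rewrite /VW (D_add_dir _ _ dW) -br1 //.
exact: (deriveD (diff_derivable dV) (diff_derivable dW)).
Qed.

Let rel1 c x y : cim c x -> Ft c (x, y) = 1 <-> F1 c (x, y - W c x) = 1.
Proof. by move=> cx; apply: translated_unit; exact: hFt.2. Qed.

Let relt c x y : cim c x -> F1 c (x, y) = 1 <-> Ft c (x, y - W' c x) = 1.
Proof. by move=> cx; apply: translated_unit; exact: ((zermelo_sub hF1.1 hFt).2 c x cx). Qed.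

Let inv1 c d x t y : cim c x -> D (t, param c x) -> dom d (phi t (param c x)) ->
  F1 d (coord d (phi t (param c x)), push phi c x y d t) = F1 c (x, y).
Proof. exact: (zermelo_push hh hV hW hb1 hphi br1 hF1). Qed.

Let invt c d x t y : cim c x -> D (t, param c x) -> dom d (phi t (param c x)) ->
  Ft d (coord d (phi t (param c x)), push phi c x y d t) = Ft c (x, y).
Proof. exact: (zermelo_push hh vVW hW hb1 hphi brt hFt'). Qed.

Let fl : local_flow W D phi := flow_local hh hW hb1 hphi.
Let fl' : local_flow W' [set z | D (- z.1, z.2)] (fun t => phi (- t)) := local_flow_opp fl.

Lemma pull_point t p q : D (- t, p) -> q = phi (- t) p -> D (t, q) /\ p = phi t q.
Proof. by move=> Dp ->; have := flow_inverse hh hW hb1 hphi Dp; rewrite opprK => -[? ->]. Qed.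

Lemma push_point t p q : D (t, q) -> p = phi t q -> D (- t, p) /\ q = phi (- t) p.
Proof. by move=> Dq ->; have [? ->] := flow_inverse hh hW hb1 hphi Dq. Qed.

Lemma push_unit_geodesic (I : set R) (P rho : R -> M) : open I ->
  (forall t, I t -> D (t, rho t) /\ P t = phi t (rho t)) ->
  unit_geodesic F1 I rho -> unit_geodesic Ft I P.
Proof.
move=> oI HP ug; apply: (unit_geodesic_ext (g := fun t => phi t (rho t)) mFt oI).
  by move=> t /HP[].
by apply: (zermelo_geodesic mF1 mFt hW rel1 fl inv1 oI ug) => t /HP[].
Qed.

(** The navigation theorem for the data [Ft], the wind [- W] and the reversed flow. *)
Lemma pull_unit_geodesic (I : set R) (P : R -> M) : open I ->
  (forall t, I t -> D (- t, P t)) ->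
  unit_geodesic Ft I P -> unit_geodesic F1 I (fun t => phi (- t) (P t)).
Proof.
move=> oI HP ug; apply: (zermelo_geodesic mFt mF1 vW' relt fl' _ oI ug HP).
by move=> c d x t y; exact: invt.
Qed.

Lemma navigation_geodesics (I : set R) (P : R -> M) : open_itv I ->
  (forall t, I t -> D (- t, P t)) ->
  (unit_geodesic Ft I P <->
   exists rho : R -> M, unit_geodesic F1 I rho /\
     forall t, I t -> D (t, rho t) /\ P t = phi t (rho t)).
Proof.
move=> [oI _] HP; split=> [ug|[rho [ug Hr]]]; last exact: push_unit_geodesic Hr ug.
exists (fun t => phi (- t) (P t)); split; first exact: pull_unit_geodesic.
by move=> t /HP/pull_point; exact.
Qed.

Let FF c x y : cim c x -> F1 c (x, y) = alpha c (x, y) + 'D_y (fun x => f (param c x)) x.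
Proof. exact: (randers_alpha hh hV1 hF1 hf hdf). Qed.
Let hf' : smooth_fun (fun p => - f p) := smooth_fun_opp hf.
Let FF' c x y : cim c x ->
  alpha c (x, y) = F1 c (x, y) + 'D_y (fun x => - f (param c x)) x.
Proof. exact: (exact_change_opp hf FF). Qed.

Lemma arc_parameterP (I J : set R) (gamma : R -> M) (s : R -> R) :
  open_itv J -> J 0 -> unit_geodesic alpha J gamma ->
  arc_parameter F1 I J gamma s <->
  (forall t, I t -> J (s t) /\ arc_length f gamma (s t) = t).
Proof.
move=> oiJ J0 ug; have E := integral0_arc_length mA mF1 hf FF oiJ J0 ug.
split=> H t /H[Jt]; first by rewrite E.
by move=> Tt; rewrite E.
Qed.

Lemma navigation_geodesics_alpha (I : set R) (P : R -> M) : open_itv I -> I 0 ->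
  (forall t, I t -> D (- t, P t)) ->
  (unit_geodesic Ft I P <->
   exists (J : set R) (gamma : R -> M) (s : R -> R),
     [/\ open_itv J /\ J 0, unit_geodesic alpha J gamma,
         arc_parameter F1 I J gamma s &
         forall t, I t -> D (t, gamma (s t)) /\ P t = phi t (gamma (s t))]).
Proof.
move=> oiI I0 HP; rewrite (navigation_geodesics oiI HP); split; last first.
  move=> [J [gamma [s [[oiJ J0] ug /(arc_parameterP I s oiJ J0 ug) Hs Hr]]]].
  exists (fun t => gamma (s t)); split=> //.
  exact: (reparam_unit_geodesic mA mF1 hf FF oiJ ug oiI.1 Hs).
move=> [rho [ug Hr]].
have [J [S [[oiJ J0] ugJ HS Hs]]] := unit_reparametrization mF1 mA hf' FF' oiI I0 ug.
(* The [alpha]-length along [rho]: [gamma] is [rho] parametrized by it, and [S] is the inverse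
   parameter change. *)
pose s := arc_length (fun p => - f p) rho.
have S0 : S 0 = 0 by have [_] := Hs 0 I0; rewrite arc_length0.
have sS t : I t -> rho (S (s t)) = rho t by move=> It; rewrite (Hs t It).2.
exists J, (fun t => rho (S t)), s; split=> //.
- apply/arc_parameterP => // t It; split; first by have [] := Hs t It.
  by rewrite /arc_length sS // S0 /s /arc_length; ring.
- by move=> t It; rewrite sS //; exact: Hr.
Qed.

Lemma navigation_conjugate (I : set R) (P rho : R -> M) (l : R) :
  open_itv I -> I 0 -> I l -> 0 < l ->
  unit_geodesic Ft I P -> unit_geodesic F1 I rho ->
  (forall t, I t -> D (t, rho t) /\ P t = phi t (rho t)) ->
  conjugate Ft P l <-> conjugate F1 rho l.
Proof.
move=> oiI I0 Il l0 uP ur Hr; have lI := open_itv_between oiI I0 Il.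
split=> C; apply: unit_conjugate_conjugate.
  have U := conjugate_unit_conjugate mFt oiI I0 Il l0 uP C.
  apply: (push_unit_conjugate mFt mF1 vW' relt fl' _ (ltW l0) oiI lI _ U).
    by move=> c d x t y; exact: invt.
  by move=> t /Hr[Dt Pt]; exact: push_point.
have U := conjugate_unit_conjugate mF1 oiI I0 Il l0 ur C.
exact: (push_unit_conjugate mF1 mFt hW rel1 fl inv1 (ltW l0) oiI lI Hr U).
Qed.

Lemma navigation_conjugate_alpha (I J : set R) (rho gamma : R -> M) (s : R -> R) (l : R) :
  open_itv I -> I 0 -> I l -> 0 < l -> unit_geodesic F1 I rho ->
  open_itv J -> J 0 -> unit_geodesic alpha J gamma ->
  arc_parameter F1 I J gamma s -> (forall t, I t -> rho t = gamma (s t)) ->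
  conjugate F1 rho l <-> conjugate alpha gamma (s l).
Proof.
move=> oiI I0 Il l0 ur oiJ J0 ug /(arc_parameterP I s oiJ J0 ug) Hs Hr.
have s0 : s 0 = 0.
  have [J0' T0] := Hs 0 I0.
  apply: (arc_length_inj mA mF1 hf FF oiJ ug J0' J0).
  by rewrite T0 arc_length0.
have g0 : rho 0 = gamma 0 by rewrite Hr // s0.
(* The two arc lengths are inverse to each other, because the terms in [f] and [- f] cancel. *)
have sE t : I t -> arc_length (fun p => - f p) rho t = s t.
  move=> It; have [_] := Hs t It; rewrite /arc_length g0 Hr // => {1}<-; ring.
have [I' [S [[oiI' I'0] _ HS HS']]] := unit_reparametrization mF1 mA hf' FF' oiI I0 ur.
split=> C; apply: unit_conjugate_conjugate.
- have sl0 : 0 < s l.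
    rewrite -sE // -[ltLHS](arc_length0 (fun p => - f p) rho).
    by rewrite (arc_length_lt mF1 mA hf' FF' oiI ur).
  have [I'l Sl] := HS' l Il; rewrite sE // in I'l Sl.
  apply: (@reparam_unit_conjugate _ _ _ F1 alpha (fun p => - f p) mF1 mA hf' FF' I' I rho gamma S l (s l)) => //.
  move=> t I't; have [It Tt] := HS t I't; split=> //.
  by rewrite Hr // -sE // Tt.
- apply: (@reparam_unit_conjugate _ _ _ alpha F1 f mA mF1 hf FF I J gamma rho s (s l) l) => //.
  by move=> t It; have [Jt Tt] := Hs t It; split=> //; exact: Hr.
Qed.

Let cF1 (g : R -> M) t : smap g t -> {for t, continuous (speed F1 g)}.
Proof. exact: (zermelo_speed_continuous hh hV hV1 hF1). Qed.

Let cFt (g : R -> M) t : smap g t -> {for t, continuous (speed Ft g)}.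
Proof. exact: (zermelo_speed_continuous hh vVW hVW1 hFt'). Qed.

(** The [alpha]-speed differs from the [F1]-speed by the derivative of [f] along the curve, which is
    smooth. *)
Let cA (g : R -> M) t : smap g t -> {for t, continuous (speed alpha g)}.
Proof.
move=> sg; have E : \near t, speed F1 g t + 'D_1 (fun u => - f (g u)) t = speed alpha g t.
  by apply: nearS (smap_near sg) => u su; rewrite (arc_length_D mF1 mA hf' FF' su).2.
have C : {for t, continuous (fun t => speed F1 g t + 'D_1 (fun u => - f (g u)) t)}.
  apply: (@continuousD _ _ _ (speed F1 g)); first exact: cF1.
  exact: (sm_cont (sm_D (1 : R) (smooth_fun_smap hf' sg))).
rewrite /prop_for /continuous_at -(nbhs_singleton E).
by apply: cvg_trans C; exact: near_eq_cvg.
Qed.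

(** Both inequalities say that [y - k (V + W)] has [h]-length at most [k]. *)
Let le_relP c x y (k : R) : cim c x -> 0 <= k -> Ft c (x, y) <= k <-> F1 c (x, y - k *: W c x) <= k.
Proof.
move=> cx k0; rewrite (zermelo_le hh hVW1 hFt' y cx k0) (zermelo_le hh hV1 hF1 _ cx k0).
suff -> : y - k *: (V c x + W c x) = y - k *: W c x - k *: V c x by [].
by rewrite scalerDr opprD addrA [RHS]addrAC.
Qed.

Hypothesis Dfull : forall t p, D (t, p).

(** [- W - V] has [h]-length less than 1. *)
Let lt1V c x : cim c x -> F1 c (x, W' c x) < 1.
Proof.
move=> cx; apply: (zermelo_lt1 hh hV1 hF1 cx).
have := lambda_gt0 hVW1 cx; rewrite (lambdaE _ hh cx) subr_gt0 => H.
by rewrite -hform_opp opprB /W' opprK.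
Qed.

(** [W - (V + W) = - V] has [h]-length less than 1. *)
Let lt1t c x : cim c x -> Ft c (x, W c x) < 1.
Proof.
move=> cx; apply: (zermelo_lt1 hh hVW1 hFt' cx).
have := lambda_gt0 hV1 cx; rewrite (lambdaE _ hh cx) subr_gt0 => H.
by rewrite -hform_opp opprB addrK.
Qed.

Let brW c x : cim c x -> 'D_(W c x) (W' c) x = 'D_(W' c x) (W c) x.
Proof.
move=> cx; have dW := sm_diff (vector_field_sm hW cx).
rewrite /W' (D_opp_dir _ dW); exact: (deriveN (diff_derivable dW)).
Qed.

Lemma pull_path p r L T : pw_path Ft p r L -> L < T ->
  exists2 L', pw_path F1 p (phi (- T) r) L' & L' < T.
Proof.
move=> pL LT; have p0 : phi (- 0) p = p by rewrite oppr0 (flow0 hphi p).2.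
have Dfull' (t : R) q : [set z | D (- z.1, z.2)] (t, q) by exact: Dfull.
have := @shortcut _ _ _ F1 Ft W' _ _ mF1 mFt fl' Dfull' _ _ lt1V _ cF1 _ cFt p r L 0 T pL.
rewrite subr0 p0; apply=> //.
- by move=> c d x t y cx Dx; exact: invt.
- by move=> c x y k cx k0; rewrite scalerN; exact: (le_relP _ cx k0).1.
(* The flow preserves both [- W] and [F1], so the [F1]-length of [- W] is constant along flow
   lines. *)
- move=> c d q t cq dq; have qE : q = param c (coord c q) by rewrite coordK.
  have cx := cim_coord cq; have dq' : dom d (phi (- t) (param c (coord c q))) by rewrite -qE.
  rewrite {1 2}qE -(push_field hh hW hb1 hphi vW' brW cx (Dfull _ _) dq').
  exact: inv1.
- move=> eps e0; exists (majorant h VW eps) => g t; split.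
    exact: (majorant_bounds hh hVW1 hFt' g t (ltW e0)).
  exact: (majorant_sm hh vVW hVW1 e0).
Qed.

Lemma push_path p r L T : pw_path F1 p r L -> L < T ->
  exists2 L', pw_path Ft p (phi T r) L' & L' < T.
Proof.
move=> pL LT; have p0 : phi 0 p = p by rewrite (flow0 hphi p).2.
have := @shortcut _ _ _ Ft F1 W _ _ mFt mF1 fl Dfull inv1 _ lt1t _ cFt _ cF1 p r L 0 T pL.
rewrite subr0 p0; apply=> //.
- move=> c x y k cx k0 H; apply: (le_relP _ cx k0).2.
  by rewrite addrK.
- move=> c d q t cq dq; have qE : q = param c (coord c q) by rewrite coordK.
  have cx := cim_coord cq; have dq' : dom d (phi t (param c (coord c q))) by rewrite -qE.
  rewrite {1 2}qE -(push_field hh hW hb1 hphi hW _ cx (Dfull _ _) dq') //.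
  exact: invt.
- move=> eps e0; exists (majorant h V eps) => g t; split.
    exact: (majorant_bounds hh hV1 hF1 g t (ltW e0)).
  exact: (majorant_sm hh hV hV1 e0).
Qed.

Lemma navigation_cut p qh : Cut alpha p qh ->
  let l := dist F1 p qh in
  l = dist alpha p qh + f qh - f p /\ Cut Ft p (phi l qh).
Proof.
move=> [J [g [la [[oiJ J0] ug g0 [la0 Jla gla] [dla cut]]]]].
have HT := @arc_length_lt _ _ _ _ _ f mA mF1 hf FF J g oiJ ug.
have [I [s [[oiI I0] ur Hs HsT]]] := unit_reparametrization mA mF1 hf FF oiJ J0 ug.
have pathA u : J u -> 0 <= u -> pw_path alpha p (g u) u.
  by move=> Ju u0; have := unit_geodesic_path oiJ ug J0 Ju u0; rewrite g0 subr0.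
have distE u : J u -> 0 <= u -> dist F1 p (g u) = dist alpha p (g u) + f (g u) - f p.
  by move=> Ju u0; exact: (dist_exact_change mA mF1 hf FF cA cF1 (pathA u Ju u0)).
have lE : dist F1 p qh = dist alpha p qh + f qh - f p by rewrite -gla distE // ltW.
move=> l; split; first exact: lE.
have Tla : arc_length f g la = l by rewrite /l lE dla /arc_length g0 gla.
have [Il sl] := HsT la Jla; rewrite Tla in Il sl.
have s0 : s 0 = 0 by have [_] := HsT 0 J0; rewrite arc_length0.
have l0 : 0 < l by rewrite -Tla -[ltLHS](arc_length0 f g) HT.
pose P t := phi t (g (s t)).
have HP t : I t -> D (t, g (s t)) /\ P t = phi t (g (s t)) by split.
have uP : unit_geodesic Ft I P := push_unit_geodesic oiI.1 HP ur.
have P0 : P 0 = p by rewrite /P s0 g0 (flow0 hphi p).2.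
have Pl : P l = phi l qh by rewrite /P sl gla.
have pathF1 t : I t -> 0 <= t -> pw_path F1 p (g (s t)) t.
  by move=> It t0; have := unit_geodesic_path oiI ur I0 It t0; rewrite s0 g0 subr0.
have pathFt t : I t -> 0 <= t -> pw_path Ft p (P t) t.
  by move=> It t0; have := unit_geodesic_path oiI uP I0 It t0; rewrite P0 subr0.
exists I, P, l; split=> //; split.
- apply/eqP; rewrite eq_le -Pl; apply/andP; split; first exact: dist_le (pathFt l Il (ltW l0)).
  apply: (le_dist (pathFt l Il (ltW l0))) => L pL; rewrite leNgt; apply/negP => Ll.
  (* An [Ft]-path to [P l] shorter than [l] would pull back to an [F1]-path from [p] to [qh] shorter
     than their [F1]-distance. *)
  have [L' pL' L'l] := pull_path pL Ll.
  have E : phi (- l) (P l) = qh.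
    by rewrite Pl; have [_] := flow_inverse hh hW hb1 hphi (Dfull l qh).
  rewrite E in pL'; have := dist_le mF1 pL'; rewrite -/l => lL'.
  by have := le_lt_trans lL' L'l; rewrite ltxx.
- move=> t It lt E.
  have [Js Ts] := Hs t It.
  (* Beyond [l] the parameter [s t] is beyond the cut value [la], so a strictly shorter [alpha]-path
     exists; it is strictly [F1]-shorter as well, and is pushed to a strictly [Ft]-shorter path to
     [P t]. *)
  have las : la < s t by rewrite -HT // Tla Ts.
  have st0 : 0 <= s t by rewrite ltW // (lt_trans la0).
  have t0 : 0 <= t by rewrite ltW // (lt_trans l0).
  have lts : dist alpha p (g (s t)) < s t.
    by rewrite lt_neqAle (dist_le mA (pathA _ Js st0)) andbT; apply/eqP; exact: cut.
  have ltt : dist F1 p (g (s t)) < t.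
    by rewrite distE // -[ltRHS]Ts /arc_length g0; lra.
  have [L pL Lt] := dist_lt (pathF1 t It t0) ltt.
  have [L' pL' L't] := push_path pL Lt.
  by have := le_lt_trans (dist_le mFt pL') L't; rewrite -/(P t) E ltxx.
Qed.

End Navigation.

Theorem theorem2p20 (R : realType) (n : nat) (M : manifold R n)
  (h : chart M -> 'rV[R]_n -> 'M[R]_n)
  (V W : chart M -> 'rV[R]_n -> 'rV[R]_n)
  (F1 Ft : chart M -> 'rV[R]_n * 'rV[R]_n -> R)
  (f : M -> R) (D : set (R * M)) (phi : R -> M -> M)
  (hM : simply_connected R M)
  (hh : riemannian h)
  (hV : vector_field V) (hW : vector_field W)
  (hV1 : forall c x, cim c x -> rnorm h c (x, V c x) < 1)
  (hVW1 : forall c x, cim c x -> rnorm h c (x, V c x + W c x) < 1)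
  (ha : forall c x, cim c x -> forall i j : 'I_n,
    ext_deriv (flat h V c) x i j
    = dwedge (fun z => ln (lambda h V c z)) (flat h V c) x i j)
  (hb1 : killing h W)
  (hb2 : forall c x p, cim c x -> poisson (star V c) (star W c) (x, p) = 0)
  (hF1 : zermelo (rnorm h) V F1)
  (hFt : zermelo F1 W Ft)
  (hf : smooth_fun f)
  (hdf : forall c x, cim c x -> forall i : 'I_n,
    partial i (f \o param c) x = randers_b h V c x 0 i)
  (hphi : flow W D phi) :
  let alpha := rnorm (randers_a h V) in
  (* (i) *)
  (forall (I : set R) (P : R -> M), open_itv I ->
    (forall t, I t -> D (- t, P t)) ->
    (unit_geodesic Ft I P <->
     exists rho : R -> M, unit_geodesic F1 I rho /\
       forall t, I t -> D (t, rho t) /\ P t = phi t (rho t))) /\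
  (forall (I : set R) (P : R -> M), open_itv I -> I 0 ->
    (forall t, I t -> D (- t, P t)) ->
    (unit_geodesic Ft I P <->
     exists (J : set R) (gamma : R -> M) (s : R -> R),
       [/\ open_itv J /\ J 0, unit_geodesic alpha J gamma,
           arc_parameter F1 I J gamma s &
           forall t, I t -> D (t, gamma (s t)) /\ P t = phi t (gamma (s t))])) /\
  (* (ii) *)
  (forall (I : set R) (P rho : R -> M) (l : R),
    open_itv I -> I 0 -> I l -> 0 < l ->
    unit_geodesic Ft I P -> unit_geodesic F1 I rho ->
    (forall t, I t -> D (t, rho t) /\ P t = phi t (rho t)) ->
    [/\ rho l = phi (- l) (P l),
        conjugate Ft P l <-> conjugate F1 rho l &
        forall (J : set R) (gamma : R -> M) (s : R -> R),
          open_itv J -> J 0 -> unit_geodesic alpha J gamma ->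
          arc_parameter F1 I J gamma s ->
          (forall t, I t -> rho t = gamma (s t)) ->
          (conjugate F1 rho l <-> conjugate alpha gamma (s l))]) /\
  (* (iii) *)
  ((forall t x, D (t, x)) ->
   forall p qh : M, Cut alpha p qh ->
     let l := dist F1 p qh in
     l = dist alpha p qh + f qh - f p /\ Cut Ft p (phi l qh)).
Proof.
move=> alpha; split; [|split; [|split]].
- by move=> I P; exact: (navigation_geodesics hh hV hW hb1 hb2 hF1 hFt hphi).
- by move=> I P; exact: (navigation_geodesics_alpha hh hV hW hV1 hb1 hb2 hF1 hFt hf hdf hphi).
- move=> I P rho l oiI I0 Il l0 uP ur Hr; split.
  + have [Dl ->] := Hr l Il.
    by have [_ ->] := flow_inverse hh hW hb1 hphi Dl.
  + exact: (navigation_conjugate hh hV hW hb1 hb2 hF1 hFt hphi oiI I0 Il l0 uP ur Hr).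
  + move=> J gamma s oiJ J0 ug.
    exact: (navigation_conjugate_alpha hh hV1 hF1 hf hdf oiI I0 Il l0 ur oiJ J0 ug).
- by move=> Dfull p qh; exact: (navigation_cut hh hV hW hV1 hVW1 hb1 hb2 hF1 hFt hf hdf hphi Dfull).
Qed.
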